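(* Consider the adaptive data-collection setting, scores, chronological split, pilot direction $w_n$ and moment and variance estimators defined in the context. Assume: (1) (Ignorability, positivity) For each $b\in\{a,a'\}$ and $t\ge 1$: $Y_t=Y_t(b)$ on $\{A_t=b\}$; $Y_t(b)\perp A_t\mid (X_t,\mathcal F_{t-1})$; and $\pi_t(b\mid X_t)>0$ almost surely. (2) (Kernel) $k_{\mathcal Y}$ is characteristic and $\sup_{y\in\mathcal Y}k_{\mathcal Y}(y,y)\le\kappa<\infty$. (3) (Nuisance envelope) There is $B_\mu<\infty$ with $\sup_{r\in\{1,2\}}\sup_{t\ge 1}\sup_{b\in\mathcal A,x\in\mathcal X}\|\widehat\mu^{(r)}_{t-1}(b,x)\|_{\mathcal H_{\mathcal Y}}\le B_\mu$ a.s. (4) (Nuisance stabilization) There exist $\mu_\infty:\mathcal A\times\mathcal X\to\mathcal H_{\mathcal Y}$ and $\beta>0$ with $\|\widehat\mu^{(2)}_{t-1}-\mu_\infty\|_{L_2(P_X\times\mu_{\mathcal A};\mathcal H_{\mathcal Y})}=O(t^{-\beta})$ a.s. (5) (Policy class) There exist a reference policy $\pi_{\mathrm{ref}}$ and constants $G<\infty$, $p>0$ such that, with $\mathcal G_{\mathrm{ref}}=\{\pi/\pi_{\mathrm{ref}}:\pi\in\Pi\}$, $\sup_{g\in\mathcal G_{\mathrm{ref}}}\|g\|_\infty\le G$ and $\log N_{[]}(\varepsilon,\mathcal G_{\mathrm{ref}},\|\cdot\|_{2,\mathrm{ref}})\lesssim\varepsilon^{-p}$. (6) (Exploration floor) There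 exist $c_\pi>0$ and $\alpha\in[0,1)$ with $\alpha<\min\{\frac1{3+p},\frac1{1+2p},\beta\}$ such that $\pi_t(b\mid x)\ge c_\pi t^{-\alpha}$ for every $t\ge1$, every $b\in\mathcal A$ and $P_X$-almost every $x$. Then there exists a constant $\nu(\alpha,\beta,p)>0$ such that $$\frac1n\sum_{t\in\mathcal I_2}\big|\widehat M_{1,t}(w_n)-M_{1,t}(w_n)\big|=O_{\mathrm{a.s.}}\big(n^{-\nu(\alpha,\beta,p)}\big),$$ $$\frac1n\sum_{t\in\mathcal I_2}\big|\widehat M_{2,t}(w_n)-M_{2,t}(w_n)\big|=O_{\mathrm{a.s.}}\big(n^{-\nu(\alpha,\beta,p)}\big),$$ and consequently $$\frac1n\sum_{t\in\mathcal I_2}\big|\widehat\sigma_t^2(w_n)-\sigma_{0,t}^2(w_n)\big|=O_{\mathrm{a.s.}}\big(n^{-\nu(\alpha,\beta,p)}\big).$$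
   Context: **Adaptive data.** $P_X$ is a distribution on $\mathcal X$; $\mathcal A$ is a discrete action set with base measure $\mu_{\mathcal A}$ (counting measure, so policy densities are action probabilities); $P_{Y\mid X,A}$ is a fixed conditional distribution on $\mathcal Y$; $\Pi$ is a class of policies (conditional densities on $\mathcal A$ given $x\in\mathcal X$). With $\mathcal F_{t-1}=\sigma(X_1,A_1,Y_1,\dots,X_{t-1},A_{t-1},Y_{t-1})$, at each round $t$: $X_t\sim P_X$ independently of the past; $A_t\sim\pi_t(\cdot\mid X_t)$ given $(\mathcal F_{t-1},X_t)$, where $\pi_t\in\Pi$ may depend on $\mathcal F_{t-1}$; then $Y_t\sim P_{Y\mid X,A}(\cdot\mid X_t,A_t)$, depending only on the current context and action. Potential outcomes $Y_t(b)$, $b\in\mathcal A$, satisfy $Y_t=Y_t(A_t)$. Target actions $a,a'\in\mathcal A$ are fixed. **Embeddings.** $k_{\mathcal Y}$ is a kernel on $\mathcal Y$ with RKHS $\mathcal H_{\mathcal Y}$ and feature map $\phi_{\mathcal Y}(y)=k_{\mathcal Y}(\cdot,y)$; characteristic means that the mean embedding of probability measures is injective. $\mu_{Y\mid A,X}(b,x)=\mathbb E[\phi_{\mathcal Y}(Y)\mid A=b,X=x]$. **Scores.** For a policy $\pi$ and $\bar\mu:\mathcal A\times\mathcal X\to\mathcal H_{\mathcal Y}$, $$D'(\pi,\bar\mu,b)(X,A,Y)=\frac{\mathbf 1\{A=b\}}{\pi(b\mid X)}(\phi_{\mathcal Y}(Y)-\bar\mu(b,X))+\bar\mu(b,X).$$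 $T=2n$, $\mathcal I_1=\{1,\dots,n\}$, $\mathcal I_2=\{n+1,\dots,2n\}$. For $r\in\{1,2\}$, $t\in\mathcal I_r$, $\widehat\mu^{(r)}_{t-1}$ is an $\mathcal F_{t-1}$-measurable estimator of $\mu_{Y\mid A,X}$, and $$\hat\phi^{(r)}_t=D'(\pi_t,\widehat\mu^{(r)}_{t-1},a)(X_t,A_t,Y_t)-D'(\pi_t,\widehat\mu^{(r)}_{t-1},a')(X_t,A_t,Y_t).$$ Pilot witness $v_n=\frac1n\sum_{t\in\mathcal I_1}\hat\phi^{(1)}_t$; pilot direction $w_n=v_n/\|v_n\|_{\mathcal H_{\mathcal Y}}$ if $v_n\ne0$ and $w_n=u_0$ otherwise, where $u_0$ is a fixed unit vector. For $t\in\mathcal I_2$: $\xi_t(w_n)=\langle w_n,\hat\phi^{(2)}_t\rangle_{\mathcal H_{\mathcal Y}}$, $M_{j,t}(w_n)=\mathbb E[\xi_t(w_n)^j\mid\mathcal F_{t-1}]$ for $j=1,2$, and $\sigma_{0,t}^2(w_n)=\mathrm{Var}(\xi_t(w_n)\mid\mathcal F_{t-1})=M_{2,t}(w_n)-M_{1,t}(w_n)^2$. **Variance estimator.** For $t\in\mathcal I_2$ let $S_t=\{s\in\mathcal I_2:s<t\}$, $m_t=|S_t|$, and for $s\in S_t$ $$\check\xi_{s,t}(w_n)=\big\langle w_n,\,D'(\pi_t,\widehat\mu^{(2)}_{s-1},a)(X_s,A_s,Y_s)-D'(\pi_t,\widehat\mu^{(2)}_{s-1},a')(X_s,A_s,Y_s)\big\rangle_{\mathcal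 H_{\mathcal Y}},\quad w_{s,t}=\frac{\pi_t(A_s\mid X_s)}{\pi_s(A_s\mid X_s)}.$$ For $t\ge n+2$: $\widehat M_{1,t}(w_n)=\frac1{m_t}\sum_{s\in S_t}w_{s,t}\check\xi_{s,t}(w_n)$, $\widehat M_{2,t}(w_n)=\frac1{m_t}\sum_{s\in S_t}w_{s,t}\check\xi_{s,t}(w_n)^2$, $\widehat\sigma_t^2(w_n)=(\widehat M_{2,t}(w_n)-\widehat M_{1,t}(w_n)^2)_+$. For $t=n+1$: $\widehat M_{1,n+1}=0$, $\widehat M_{2,n+1}=1$, $\widehat\sigma^2_{n+1}=1$. **Norms.** $\|m\|^2_{L_2(P_X\times\mu_{\mathcal A};\mathcal H_{\mathcal Y})}=\int\!\int\|m(b,x)\|^2_{\mathcal H_{\mathcal Y}}d\mu_{\mathcal A}(b)dP_X(x)$; $\|h\|^2_{2,\mathrm{ref}}=\mathbb E_{X\sim P_X}[\int h(b,X)^2\pi_{\mathrm{ref}}(b\mid X)d\mu_{\mathcal A}(b)]$; $N_{[]}$ is the bracketing number. The reference policy $\pi_{\mathrm{ref}}$ is a fixed strictly positive conditional density. $Z_n=O_{\mathrm{a.s.}}(r_n)$ means $\limsup_n|Z_n|/r_n<\infty$ almost surely.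
   Formalization: In (6), the exceptional P_X-null set of x is required to be one fixed set that does not depend on the observed data; if it may depend on the past (e.g. contain an earlier context), the claim fails. *)

(* Defs.v *)
From HB Require Import structures.
From mathcomp Require Import all_boot all_order all_algebra sesquilinear.
From mathcomp Require Import all_classical all_reals all_analysis.

Set Implicit Arguments.
Unset Strict Implicit.
Unset Printing Implicit Defensive.

Import Order.TTheory GRing.Theory Num.Theory.
Import numFieldNormedType.Exports.

Local Open Scope classical_set_scope.
Local Open Scope ring_scope.

Section rkhs.
Context {R : realType}.

(* The Hilbert space of functions on Y in which evaluation at y is the inner
   product with k(., y): [rkhs_eval] is the identification of an element with
   a function, and it is linear because [rkhs_dot] is.  The existence of such
   a space forces k to be symmetric and positive semidefinite. *)
Record rkhs (Y : Type) (k : Y -> Y -> R) := Rkhs {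
  rkhs_space :> completeNormedModType R ;
  rkhs_dot : {dot rkhs_space for idfun} ;
  rkhs_normE : forall h, `|h| ^+ 2 = rkhs_dot h h ;
  rkhs_eval : rkhs_space -> Y -> R ;
  rkhs_eval_inj : injective rkhs_eval ;
  feature : Y -> rkhs_space ;
  feature_eval : forall y y', rkhs_eval (feature y) y' = k y' y ;
  rkhs_reproducing : forall h y, rkhs_eval h y = rkhs_dot h (feature y)
}.

(* m is the integral of the feature map under Q, in the weak sense.  When k is
   bounded and measurable every Q has exactly one mean embedding, so that
   [characteristic] is then the injectivity of the map from Q to m. *)
Definition mean_embedding d (Y : measurableType d) (k : Y -> Y -> R)
    (H : rkhs k) (Q : probability Y R) (m : H) : Prop :=
  forall h : H, Q.-integrable setT (EFin \o rkhs_eval h) /\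
    (rkhs_dot H m h)%:E = (\int[Q]_y (rkhs_eval h y)%:E)%E.

Definition characteristic d (Y : measurableType d) (k : Y -> Y -> R)
    (H : rkhs k) : Prop :=
  forall (Q Q' : probability Y R) (m : H),
    mean_embedding Q m -> mean_embedding Q' m ->
    forall B, measurable B -> Q B = Q' B.

(* Pointwise limits of measurable functions with finitely many values; for a
   separable H this is Borel measurability. *)
Definition strongly_measurable d (T : measurableType d)
    (H : completeNormedModType R) (f : T -> H) : Prop :=
  exists s : nat -> T -> H,
    (forall n, finite_set (range (s n)) /\
       forall h, measurable (s n @^-1` [set h])) /\
    (forall x, s ^~ x @ \oo --> f x).

End rkhs.

Section conditioning.
Context {R : realType} {d : measure_display} {Omega : measurableType d}.
Variable P : probability Omega R.

(* g is a version of E[f | G], for a sub-sigma-algebra G. *)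
Definition cond_exp (G : set_system Omega) (f g : Omega -> R) : Prop :=
  [/\ P.-integrable setT (EFin \o f),
      P.-integrable setT (EFin \o g),
      measurable_fun [set: g_sigma_algebraType G] g &
      forall E, G E ->
        (\int[P]_(w in E) (f w)%:E = \int[P]_(w in E) (g w)%:E)%E].

Definition cond_indep d1 d2 (S1 : measurableType d1) (S2 : measurableType d2)
    (G : set_system Omega) (U : Omega -> S1) (V : Omega -> S2) : Prop :=
  forall B C, measurable B -> measurable C ->
    exists f g, [/\ cond_exp G \1_(U @^-1` B) f,
      cond_exp G \1_(V @^-1` C) g &
      cond_exp G \1_(U @^-1` B `&` V @^-1` C) (fun w => f w * g w)].

Definition bigO_as (Z : nat -> Omega -> \bar R) (r : nat -> R) : Prop :=
  {ae P, forall w,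
    (limn_esup (fun n => `|Z n w| * ((r n)^-1)%:E) < +oo)%E}.

End conditioning.

Section policies.
Context {R : realType} {dX dA : measure_display}.
Context {X : measurableType dX} {A : measurableType dA}.

Definition cond_density (g : A -> X -> R) : Prop :=
  [/\ forall b, measurable_fun setT (g b),
      forall b x, 0 <= g b x &
      forall x, (\int[@counting A R]_b (g b x)%:E = 1)%E].

Definition L2_norm (PX : probability X R) (H : completeNormedModType R)
    (m : A -> X -> H) : \bar R :=
  ((\int[PX]_x \int[@counting A R]_b (`|m b x| ^+ 2)%:E) `^ (2^-1))%E.

Definition ref_norm (PX : probability X R) (pi_ref h : A -> X -> R) : \bar R :=
  ((\int[PX]_x \int[@counting A R]_b (h b x ^+ 2 * pi_ref b x)%:E)
     `^ (2^-1))%E.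

Definition bracket_cover (N : (A -> X -> R) -> \bar R)
    (F : set (A -> X -> R)) (eps : R) (n : nat) : Prop :=
  exists l u : 'I_n -> A -> X -> R,
    (forall i, [/\ forall b, measurable_fun setT (l i b),
       forall b, measurable_fun setT (u i b),
       (N (l i) < +oo)%E, (N (u i) < +oo)%E &
       (N (fun b x => (u i b x - l i b x)%R) <= eps%:E)%E]) /\
    (forall g, F g -> exists i, forall b x, l i b x <= g b x <= u i b x).

(* +oo if there is no finite cover. *)
Definition bracketing_number (N : (A -> X -> R) -> \bar R)
    (F : set (A -> X -> R)) (eps : R) : \bar R :=
  ereal_inf [set (n%:R)%:E | n in bracket_cover N F eps].

Definition density_ratios (Pi : set (A -> X -> R)) (pi_ref : A -> X -> R) :
    set (A -> X -> R) :=
  [set (fun b x => g b x / pi_ref b x) | g in Pi].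

End policies.

Section adaptive_data.
Context {R : realType} {dO dX dA dY : measure_display}.
Context {Omega : measurableType dO} {X : measurableType dX}.
Context {A : measurableType dA} {Y : measurableType dY}.

(* Rounds are numbered from 1; the components at index 0 are never used. *)
Record adaptive_data := AdaptiveData {
  ctx : nat -> Omega -> X ;
  act : nat -> Omega -> A ;
  out : nat -> Omega -> Y ;
  pot : nat -> A -> Omega -> Y ;
  pol : nat -> Omega -> A -> X -> R
}.

Implicit Types (D : adaptive_data) (t : nat).

(* F_t *)
Definition history D t : set_system Omega :=
  <<s \bigcup_(s in [set s | (1 <= s <= t)%N])
        (g_sigma_algebra_preimage (ctx D s) `|`
         g_sigma_algebra_preimage (act D s) `|`
         g_sigma_algebra_preimage (out D s)) >>.

(* sigma(F_{t-1}, X_t) *)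
Definition history_ctx D t : set_system Omega :=
  <<s history D t.-1 `|` g_sigma_algebra_preimage (ctx D t) >>.

(* sigma(F_{t-1}, X_t, A_t) *)
Definition history_ctx_act D t : set_system Omega :=
  <<s history_ctx D t `|` g_sigma_algebra_preimage (act D t) >>.

Record adaptive_sampling (P : probability Omega R) (PX : probability X R)
    (PY : R.-pker (X * A)%type ~> Y) (Pi : set (A -> X -> R)) D : Prop :=
  AdaptiveSampling {
  measurable_ctx : forall t, (1 <= t)%N -> measurable_fun setT (ctx D t) ;
  measurable_act : forall t, (1 <= t)%N -> measurable_fun setT (act D t) ;
  measurable_out : forall t, (1 <= t)%N -> measurable_fun setT (out D t) ;
  measurable_pot : forall t b, (1 <= t)%N -> measurable_fun setT (pot D t b) ;
  pol_in_class : forall t w, (1 <= t)%N -> Pi (pol D t w) ;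
  pol_adapted : forall t, (1 <= t)%N ->
    measurable_fun setT
      (fun z : g_sigma_algebraType (history D t.-1) * (A * X) =>
         pol D t z.1 z.2.1 z.2.2) ;
  ctx_law : forall t E B, (1 <= t)%N -> history D t.-1 E -> measurable B ->
    P (E `&` ctx D t @^-1` B) = (P E * PX B)%E ;
  act_law : forall t E b, (1 <= t)%N -> history_ctx D t E ->
    P (E `&` act D t @^-1` [set b]) =
      (\int[P]_(w in E) (pol D t w b (ctx D t w))%:E)%E ;
  out_law : forall t E C, (1 <= t)%N -> history_ctx_act D t E ->
    measurable C ->
    P (E `&` out D t @^-1` C) =
      (\int[P]_(w in E) PY (ctx D t w, act D t w) C)%E ;
  out_pot : forall t, (1 <= t)%N ->
    {ae P, forall w, out D t w = pot D t (act D t w) w}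
}.

Definition ignorability (P : probability Omega R) D (b : A) : Prop :=
  forall t, (1 <= t)%N ->
    [/\ {ae P, forall w, act D t w = b -> out D t w = pot D t b w},
        cond_indep P (history_ctx D t) (pot D t b) (act D t) &
        {ae P, forall w, 0 < pol D t w b (ctx D t w)}].

(* The exceptional P_X-null set N does not depend on the trajectory w: if it
   did, a data-dependent policy could violate the floor exactly at the past
   contexts at which the estimators evaluate it. *)
Definition exploration_floor (P : probability Omega R) (PX : probability X R) D
    (c alpha : R) : Prop :=
  exists2 N : set X, PX.-negligible N &
    {ae P, forall w, forall t b x, (1 <= t)%N -> ~ N x ->
      c * (t%:R `^ (- alpha)) <= pol D t w b x}.

Section estimators.
Variables (k : Y -> Y -> R) (H : rkhs k).

(* [m j] is F_j-measurable; in round t the estimator in use is [m t.-1]. *)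
Definition adapted_nuisance D (m : nat -> Omega -> A -> X -> H) : Prop :=
  forall j, strongly_measurable
    (fun z : g_sigma_algebraType (history D j) * (A * X) =>
       m j z.1 z.2.1 z.2.2).

(* D'(g, m, b) *)
Definition score (g : A -> X -> R) (m : A -> X -> H) (b : A)
    (x : X) (c : A) (y : Y) : H :=
  (\1_[set b] c / g b x) *: (feature H y - m b x) + m b x.

Variables (D : adaptive_data) (a a' : A).
Variables (m1 m2 : nat -> Omega -> A -> X -> H) (u0 : H).

Definition score_diff (g : A -> X -> R) (m : A -> X -> H) t w : H :=
  score g m a (ctx D t w) (act D t w) (out D t w) -
  score g m a' (ctx D t w) (act D t w) (out D t w).

Definition phi_hat (m : nat -> Omega -> A -> X -> H) t w : H :=
  score_diff (pol D t w) (m t.-1 w) t w.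

Definition pilot_witness n w : H :=
  n%:R^-1 *: \sum_(1 <= t < n.+1) phi_hat m1 t w.

Definition pilot_direction n w : H :=
  let v := pilot_witness n w in if v != 0 then `|v|^-1 *: v else u0.

Definition xi n t w : R :=
  rkhs_dot H (pilot_direction n w) (phi_hat m2 t w).

Definition xi_check n s t w : R :=
  rkhs_dot H (pilot_direction n w) (score_diff (pol D t w) (m2 s.-1 w) s w).

Definition weight s t w : R :=
  pol D t w (act D s w) (ctx D s w) / pol D s w (act D s w) (ctx D s w).

(* S_t = {n+1, ..., t-1} has t - (n+1) elements. *)
Definition M1_hat n t w : R :=
  if t == n.+1 then 0 else
  (t - n.+1)%N%:R^-1 *
    \sum_(n.+1 <= s < t) weight s t w * xi_check n s t w.

Definition M2_hat n t w : R :=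
  if t == n.+1 then 1 else
  (t - n.+1)%N%:R^-1 *
    \sum_(n.+1 <= s < t) weight s t w * xi_check n s t w ^+ 2.

Definition sigma2_hat n t w : R :=
  if t == n.+1 then 1 else
  Num.max (M2_hat n t w - M1_hat n t w ^+ 2) 0.

(* n^{-1} times the sum over t in I_2 of |U_{n,t} - V_{n,t}| *)
Definition mean_abs_error (U V : nat -> nat -> Omega -> R) n w : R :=
  n%:R^-1 * \sum_(n.+1 <= t < (2 * n).+1) `|U n t w - V n t w|.

End estimators.
End adaptive_data.

Arguments adaptive_data R {dO dX dA dY} Omega X A Y.

(* Main.v *)
Require Import Defs.
From HB Require Import structures.
From mathcomp Require Import all_boot all_order all_algebra sesquilinear.
From mathcomp Require Import all_classical all_reals all_analysis.
From mathcomp Require Import measurable_realfun ring lra zify.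

Set Implicit Arguments.
Unset Strict Implicit.
Unset Printing Implicit Defensive.

Import Order.TTheory GRing.Theory Num.Theory.
Import numFieldNormedType.Exports.

Local Open Scope classical_set_scope.
Local Open Scope ring_scope.

(* Let O_s be the s-th observation. Given the past it has density pi_s with
   respect to a fixed finite measure Lambda, and almost surely the moment
   estimators are sums over s of terms psi_s(O_s) theta(pi_t(O_s)) / pi_s(O_s),
   where theta(u) is 1/u, 1 or u and psi_s, built from the numerator of the
   inverse-probability correction and from the difference of the estimated
   regressions, is bounded and predictable. The conditional moments are the
   integrals of psi_t theta(pi_t) against Lambda, so that the error splits into
   a martingale evaluated at the data-dependent function theta(pi_t) and the
   drift of psi_s, which is O(n^(alpha - beta)) by nuisance stabilization.

   The martingale is controlled uniformly over the policy class by an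
   exponential inequality (expand e^z up to z^2 and use that pi_s is at least
   n^(-alpha)) and by chaining along nested brackets. The links are truncated
   at the points where a bracket is too wide, so that the bound survives a
   divergent entropy integral: the widths below the threshold enter the
   exponential inequality through their sup norm, those above it through
   Chebyshev's inequality. Balancing the thresholds is where
   alpha < min(1/(3 + p), 1/(1 + 2p)) is used. Borel-Cantelli turns the bound
   into n^(1 - gamma) for all t at once, which loses only a logarithm when it is
   divided by the sample sizes 1, ..., n - 1 and averaged. *)

(** * Hilbert space geometry and measurability *)

(** The functions [theta] come from writing the score along the pilot direction as [r / pi + e].
    Multiplied by the weight [pi_t / pi_s], the score becomes [(r + e pi_t) / pi_s] and its square
    becomes [(r^2 / pi_t + 2 r e + e^2 pi_t) / pi_s]. The pilot direction is a function of the first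
    half of the sample, so [r] and [e] are predictable on the second half. The function
    [theta(pi_t)] is not, since it depends on the observations that are being averaged; uniformity
    over the class removes this dependence. The bad event is a finite union over bracket indices, so
    no supremum has to be measurable. Three powers govern all exponents: on the floor [1/u] is
    bounded by order [n^alpha] and Lipschitz of order [n^(2 alpha)], and the variance of an
    importance-weighted term costs a single further [n^alpha]. The floor also forces the action set
    to be finite, which makes the dominating measure finite. The variance does not follow from the
    two moments by subtraction alone: the first moment estimator can be large while few samples are
    available, and its square needs a separate bound. *)

Section hilbert.
Context {R : realType} {Y : Type} {k : Y -> Y -> R} (H : rkhs k).
Local Notation dot := (rkhs_dot H).

Lemma dotC (f g : H) : dot f g = dot g f.
Proof. by have := @hermC _ _ _ _ (rkhs_dot H) f g; rewrite expr0 mul1r. Qed.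

Lemma dotDl f g h : dot (f + g) h = dot f h + dot g h.
Proof. exact: linearDl. Qed.
Lemma dotZl c f h : dot (c *: f) h = c * dot f h.
Proof. exact: linearZl_LR. Qed.
Lemma dotDr f g h : dot h (f + g) = dot h f + dot h g.
Proof. by rewrite dotC dotDl !(dotC h). Qed.
Lemma dotZr c f h : dot h (c *: f) = c * dot h f.
Proof. by rewrite dotC dotZl dotC. Qed.
Lemma dotNl f h : dot (- f) h = - dot f h.
Proof. by rewrite -scaleN1r dotZl mulN1r. Qed.
Lemma dotNr f h : dot h (- f) = - dot h f.
Proof. by rewrite dotC dotNl dotC. Qed.
Lemma dotBl f g h : dot (f - g) h = dot f h - dot g h.
Proof. by rewrite dotDl dotNl. Qed.
Lemma dotBr f g h : dot h (f - g) = dot h f - dot h g.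
Proof. by rewrite dotDr dotNr. Qed.
Lemma dot0l h : dot 0 h = 0.
Proof. by rewrite -(scale0r 0) dotZl mul0r. Qed.
Lemma dot0r h : dot h 0 = 0.
Proof. by rewrite dotC dot0l. Qed.

Lemma dot_cauchy_schwarz (f g : H) : `|dot f g| <= `|f| * `|g|.
Proof.
rewrite -(ler_pXn2r (n:=2)) ?nnegrE ?mulr_ge0// exprMn !rkhs_normE.
rewrite -normrX ger0_norm ?sqr_ge0//.
have [->|g0] := eqVneq g 0; first by rewrite !dot0r expr0n/= mulr0.
have gg : 0 < dot g g by rewrite -rkhs_normE exprn_gt0// normr_gt0.
have : 0 <= dot (dot g g *: f - dot f g *: g) (dot g g *: f - dot f g *: g).
  by rewrite -rkhs_normE sqr_ge0.
rewrite !(dotBl,dotBr,dotZl,dotZr) (dotC g f) => h.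
rewrite -subr_ge0 -(pmulr_rge0 _ gg); apply: le_trans h _.
by rewrite le_eqVlt; apply/orP; left; apply/eqP; ring.
Qed.

(** Polarization expresses the inner product through norms, and the norm is continuous. *)
Lemma dot_cvg (f g : H^nat) (f0 g0 : H) : f @ \oo --> f0 -> g @ \oo --> g0 ->
  (fun n => dot (f n) (g n)) @ \oo --> dot f0 g0.
Proof.
move=> ff gg.
have pol (u v : H) : dot u v = 4^-1 * (`|u + v| ^+ 2 - `|u - v| ^+ 2).
  by rewrite !rkhs_normE !(dotDl,dotDr,dotNl,dotNr) (dotC v u); field.
under eq_fun do rewrite pol; rewrite pol.
apply: cvgM; first exact: cvg_cst.
apply: cvgB; apply: cvgM; apply: cvg_norm; (apply: cvgD || apply: cvgB) => //; exact: cvgN.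
Qed.

Lemma sqr_norm_feature y : `|feature H y| ^+ 2 = k y y.
Proof. by rewrite rkhs_normE -rkhs_reproducing feature_eval. Qed.

(* The distance from h to V is attained at a point v by completeness, and h - v
   is then orthogonal to V, so that it vanishes at every point of Y. *)
Lemma closed_submod_feature_full (V : set H) :
  closed V -> V 0 -> (forall c f g, V f -> V g -> V (c *: f + g)) ->
  (forall y, V (feature H y)) -> V = setT.
Proof.
move=> cV V0 VD Vf; apply/seteqP; split=> // h _.
have VZ c f : V f -> V (c *: f) by move=> ?; rewrite -[_ *: _]addr0; exact: VD.
have VA f g : V f -> V g -> V (f + g).
  by move=> ? ?; rewrite -[f]scale1r; exact: VD.
pose S := [set `|h - v| ^+ 2 | v in V].
have S0 : S !=set0 by exists (`|h - 0| ^+ 2), 0.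
have lbS : has_lbound S by exists 0 => _ [v _ <-]; rewrite sqr_ge0.
pose d := inf S.
have dle v : V v -> d <= `|h - v| ^+ 2.
  by move=> Vv; apply: ge_inf => //; exists v.
have d0 : 0 <= d by apply: lb_le_inf => // _ [v _ <-]; rewrite sqr_ge0.
have apx (n : nat) : {v | V v & `|h - v| ^+ 2 <= d + n.+1%:R^-1}.
  apply/cid2; have : d < d + n.+1%:R^-1 by rewrite ltrDl invr_gt0.
  case/inf_lt => // _ [v Vv <-] /ltW ?; by exists v.
pose v n := s2val (apx n).
have Vv n : V (v n) by rewrite /v; case: (apx n).
have dv n : `|h - v n| ^+ 2 <= d + n.+1%:R^-1 by rewrite /v; case: (apx n).
(* Parallelogram law: the midpoint of [v m] and [v n] lies in [V], so its squared distance to [h] is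
   at least [d]. This makes the minimizing sequence Cauchy. *)
have par (m n : nat) : `|v m - v n| ^+ 2 <= 2 * (m.+1%:R^-1 + n.+1%:R^-1).
  have /dle : V (2^-1 *: (v m + v n)) by apply/VZ/VA.
  have -> : `|v m - v n| ^+ 2 = 2 * `|h - v m| ^+ 2 + 2 * `|h - v n| ^+ 2
            - 4 * `|h - 2^-1 *: (v m + v n)| ^+ 2.
    rewrite !rkhs_normE !(dotDl,dotDr,dotNl,dotNr,dotZl,dotZr).
    by rewrite (dotC (v m) h) (dotC (v n) h) (dotC (v n) (v m)); field.
  have lin (D x y z e e' : R) : x <= D + e -> y <= D + e' -> D <= z ->
    2 * x + 2 * y - 4 * z <= 2 * (e + e') by lra.
  exact: lin (dv m) (dv n).
have cvg_v : cvgn v.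
  apply: cauchy_cvg; apply/cauchy_ballP => e e0; near_simpl.
  have e2 : 0 < e ^+ 2 / 8 by rewrite divr_gt0// exprn_gt0.
  near=> m n; rewrite -ball_normE/=.
  rewrite -(ltr_pXn2r (n:=2)) ?nnegrE ?(ltW e0)// (le_lt_trans (par _ _))//.
  have : m.+1%:R^-1 < e ^+ 2 / 8 by near: m; exact: near_infty_natSinv_lt (PosNum e2).
  have : n.+1%:R^-1 < e ^+ 2 / 8 by near: n; exact: near_infty_natSinv_lt (PosNum e2).
  have lin (x y z : R) : x < z / 8 -> y < z / 8 -> 0 < z / 8 ->
    2 * (x + y) < z by lra.
  by move=> ? ?; exact: lin.
pose v0 := limn v.
have Vv0 : V v0.
  by apply: (closed_cvg V cV _ _ cvg_v); exact: nearW.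
have dv0 : `|h - v0| ^+ 2 <= d.
  have A : `|h - v n| ^+ 2 @[n --> \oo] --> `|h - v0| ^+ 2.
    by apply: cvgM; apply: cvg_norm; apply: cvgB => //; exact: cvg_cst.
  have B : d + n.+1%:R^-1 @[n --> \oo] --> d + 0.
    by apply: cvgD; [exact: cvg_cst|exact: cvg_harmonic].
  rewrite -[leRHS]addr0; apply: ler_cvg_to A B _; exact: nearW.
have orth u : V u -> dot (h - v0) u = 0.
  move=> Vu; have [->|u0] := eqVneq u 0; first by rewrite dot0r.
  have uu : 0 < dot u u by rewrite -rkhs_normE exprn_gt0// normr_gt0.
  (* The optimal displacement of [v0] along [u] would lower the squared distance by
     [dot e u ^+ 2 / dot u u], where [e = h - v0]; minimality makes this quantity vanish. *)
  have := dle (v0 + (dot (h - v0) u / dot u u) *: u).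
  have -> : h - (v0 + (dot (h - v0) u / dot u u) *: u)
    = (h - v0) - (dot (h - v0) u / dot u u) *: u by rewrite opprD addrA.
  move: dv0; move: (h - v0) => e; rewrite !rkhs_normE.
  have -> : dot (e - (dot e u / dot u u) *: u) (e - (dot e u / dot u u) *: u)
     = dot e e - dot e u ^+ 2 / dot u u.
    rewrite !(dotDl,dotDr,dotNl,dotNr,dotZl,dotZr) (dotC u e).
    by field; rewrite gt_eqF.
  move=> le1 /(_ (VA _ _ Vv0 (VZ _ _ Vu))) le2.
  have : dot e u ^+ 2 / dot u u <= 0 by lra.
  rewrite pmulr_lle0 ?invr_gt0// => le3.
  by apply/eqP; rewrite -sqrf_eq0; apply/eqP/le_anti; rewrite le3 sqr_ge0.
suff -> : h = v0 by [].
apply/eqP; rewrite -subr_eq0; apply/eqP/rkhs_eval_inj/funext => y.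
by rewrite !rkhs_reproducing orth// dot0l.
Unshelve. all: by end_near. Qed.

End hilbert.

Section hilbert_measurability.
Context {R : realType} {dY : measure_display} {Y : measurableType dY}.
Context {k : Y -> Y -> R} (H : rkhs k).
Hypothesis mk : measurable_fun setT (fun z : Y * Y => k z.1 z.2).
Local Notation dot := (rkhs_dot H).

(** The elements [h] with this property form a closed subspace that contains every feature, because
    the sections of [k] are measurable; such a subspace is the whole of [H]. *)
Lemma measurable_dot_feature (h : H) :
  measurable_fun setT (fun y => dot h (feature H y)).
Proof.
suff /seteqP[_] :
    [set h | measurable_fun setT (fun y => dot h (feature H y))] = setT by exact.
apply: (@closed_submod_feature_full _ _ _ H).
- move=> {}h clh.
  have apx (n : nat) : {g : H | measurable_fun setT (fun y => dot g (feature H y)) &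
      ball h n.+1%:R^-1 g}.
    apply/cid2; have [g [? ?]] := clh _ (nbhsx_ballx h n.+1%:R^-1 ltac:(by [])).
    by exists g.
  pose g n := s2val (apx n).
  have gh : g @ \oo --> h.
    apply/cvg_ballP => e e0; near=> n; apply: (@le_ball _ _ _ n.+1%:R^-1).
      by apply/ltW; near: n; exact: near_infty_natSinv_lt (PosNum e0).
    by rewrite /g; case: (apx n).
  apply: (@measurable_fun_cvg _ _ _ _ (fun n y => dot (g n) (feature H y))).
  - by move=> n; rewrite /g; case: (apx n).
  - by move=> y _; apply: dot_cvg => //; exact: cvg_cst.
- rewrite /=; under eq_fun do rewrite dot0l; exact: measurable_cst.
- move=> c f g mf mg /=; under eq_fun do rewrite dotDl dotZl.
  by apply: measurable_funD => //; apply: measurable_funM.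
- move=> y /=.
  have -> : (fun y' => dot (feature H y) (feature H y')) =
            (fun z : Y * Y => k z.1 z.2) \o (fun y' => (y', y)).
    by apply/funext => y'; rewrite -rkhs_reproducing feature_eval.
  by apply: measurableT_comp => //; exact: measurable_pair2.
Unshelve. all: by end_near. Qed.

Lemma measurable_simple_param d (T : measurableType d) (s : T -> H)
    (G : H -> T -> R) : finite_set (range s) ->
  (forall h, measurable (s @^-1` [set h])) ->
  (forall h, measurable_fun setT (G h)) ->
  measurable_fun setT (fun t => G (s t) t).
Proof.
move=> fs ms mG _ B mB; rewrite setTI.
have -> : (fun t => G (s t) t) @^-1` B =
    \bigcup_(h in range s) (s @^-1` [set h] `&` (G h @^-1` B)).
  apply/seteqP; split=> [t Bt|t [_ _ [/= <-]]//].
  by exists (s t) => //; exists t.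
apply: fin_bigcup_measurable => // h _; apply: measurableI => //.
by rewrite -[X in measurable X]setTI; exact: mG.
Qed.

(* A class of H-valued maps, closed under the operations of the estimators,
   whose inner products are measurable although H need not be separable: the
   feature map is in general not strongly measurable. *)
Inductive hmeas d (T : measurableType d) : (T -> H) -> Prop :=
| hmeas_strong f : strongly_measurable f -> hmeas f
| hmeas_feature (y : T -> Y) : measurable_fun setT y ->
    hmeas (fun t => feature H (y t))
| hmeasD f g : hmeas f -> hmeas g -> hmeas (fun t => f t + g t)
| hmeasZ (c : T -> R) f : measurable_fun setT c -> hmeas f ->
    hmeas (fun t => c t *: f t).

Section closure.
Context d (T : measurableType d).
Implicit Types f g : T -> H.

Lemma hmeas_cst h : hmeas (fun _ : T => h).
Proof.
apply: hmeas_strong; exists (fun _ _ => h); split; last first.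
  by move=> x; exact: cvg_cst.
move=> _; split.
  by apply: (sub_finite_set _ (finite_set1 h)) => _ [t _ <-].
move=> h'; have [->|hh'] := eqVneq h h'.
  by rewrite preimage_cst mem_set//; exact: measurableT.
by rewrite preimage_cst memNset//; apply/eqP.
Qed.

Lemma hmeasN f : hmeas f -> hmeas (fun t => - f t).
Proof.
move=> mf; rewrite (_ : (fun t => _) = (fun t => -1 *: f t)).
  exact: hmeasZ.
by apply/funext => t; rewrite scaleN1r.
Qed.

Lemma hmeasB f g : hmeas f -> hmeas g -> hmeas (fun t => f t - g t).
Proof. by move=> mf mg; apply: hmeasD => //; exact: hmeasN. Qed.

Lemma hmeas_sum (I : Type) (r : seq I) (F : I -> T -> H) :
  (forall i, hmeas (F i)) -> hmeas (fun t => \sum_(i <- r) F i t).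
Proof.
move=> mF; elim: r => [|i r IH].
  by under eq_fun do rewrite big_nil; exact: hmeas_cst.
by under eq_fun do rewrite big_cons; exact: hmeasD.
Qed.

Lemma strongly_measurable_dot f (g : T -> H) : strongly_measurable f ->
  (forall h, measurable_fun setT (fun t => dot h (g t))) ->
  measurable_fun setT (fun t => dot (f t) (g t)).
Proof.
move=> [s [sP sf]] mg.
apply: (@measurable_fun_cvg _ _ _ _ (fun n t => dot (s n t) (g t))).
- move=> n; apply: (@measurable_simple_param _ _ (s n) (fun h t => dot h (g t))) => //.
    by case: (sP n).
  by case: (sP n).
- by move=> t _; apply: dot_cvg; [exact: sf|exact: cvg_cst].
Qed.

Lemma hmeas_dot_cst h f : hmeas f -> measurable_fun setT (fun t => dot h (f t)).
Proof.
elim=> {f} [f sf|y my|f g _ mf _ mg|c f mc _ mf].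
- under eq_fun do rewrite dotC.
  by apply: (strongly_measurable_dot sf) => h'; exact: measurable_cst.
- by apply: (@measurableT_comp _ _ _ _ _ _ (fun y => dot h (feature H y))) => //;
    exact: measurable_dot_feature.
- by under eq_fun do rewrite dotDr; exact: measurable_funD.
- by under eq_fun do rewrite dotZr; exact: measurable_funM.
Qed.

(** Induction on both maps. A strongly measurable factor reduces the claim to a constant one by
    approximation; the only other base case pairs two features, whose inner product is [k] at a
    measurable pair of points. *)
Lemma hmeas_dot f g : hmeas f -> hmeas g ->
  measurable_fun setT (fun t => dot (f t) (g t)).
Proof.
move=> mf mg; elim: mf => {f} [f sf|y my|f f' _ mf _ mf'|c f mc _ mf].
- by apply: (strongly_measurable_dot sf) => h; exact: hmeas_dot_cst.
- elim: mg => {g} [g sg|y' my'|g g' _ IH _ IH'|c g mc _ IH].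
  + under eq_fun do rewrite dotC.
    apply: (strongly_measurable_dot sg) => h.
    by apply: hmeas_dot_cst; exact: hmeas_feature.
  + under eq_fun do rewrite -rkhs_reproducing feature_eval.
    apply: (@measurableT_comp _ _ _ _ _ _ (fun z : Y * Y => k z.1 z.2)
      _ (fun t => (y' t, y t))) => //.
    exact: measurable_fun_pair.
  + by under eq_fun do rewrite dotDr; exact: measurable_funD.
  + by under eq_fun do rewrite dotZr; exact: measurable_funM.
- by under eq_fun do rewrite dotDl; exact: measurable_funD.
- by under eq_fun do rewrite dotZl; exact: measurable_funM.
Qed.

Lemma hmeas_norm f : hmeas f -> measurable_fun setT (fun t => `|f t| : R).
Proof.
move=> mf; rewrite (_ : (fun t => _) = (fun t => Num.sqrt (dot (f t) (f t)))).
  apply: measurableT_comp; last exact: hmeas_dot.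
  by apply: nondecreasing_measurable => // x y; exact: ler_wsqrtr.
by apply/funext => t; rewrite -rkhs_normE sqrtr_sqr normr_id.
Qed.

End closure.

Lemma hmeas_comp d d' (T : measurableType d) (T' : measurableType d')
    (u : T' -> T) (f : T -> H) :
  measurable_fun setT u -> hmeas f -> hmeas (fun t => f (u t)).
Proof.
move=> mu; elim=> {f} [f [s [sP sf]]|y my|f g _ mf _ mg|c f mc _ mf].
- apply: hmeas_strong; exists (fun n => s n \o u); split; last by move=> x; exact: sf.
  move=> n; split.
    by apply: (sub_finite_set _ (sP n).1) => _ [t _ <-]; exists (u t).
  by move=> h; rewrite comp_preimage -[X in measurable X]setTI; apply: mu => //;
    case: (sP n).
- by apply: (@hmeas_feature _ _ (fun t => y (u t))); exact: measurableT_comp my mu.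
- exact: hmeasD.
- by apply: (@hmeasZ _ _ (fun t => c (u t))) => //; exact: measurableT_comp mc mu.
Qed.

End hilbert_measurability.

Import KCOMP_FINITE_KERNEL.

Lemma measurable_preimage d d' (T : measurableType d) (U : measurableType d')
    (f : T -> U) B : measurable_fun setT f -> measurable B ->
  measurable (f @^-1` B).
Proof. by move=> mf mB; rewrite -[X in measurable X]setTI; exact: mf. Qed.

(** * Kernels and the law of the observations *)

Section kernel_constructions.
Context {R : realType}.

Section kconst.
Context d d' (T : measurableType d) (Z : measurableType d').
Variable m : {finite_measure set Z -> \bar R}.

Definition kconst (_ : T) : {measure set Z -> \bar R} := m.

Let measurable_kconst U : measurable U -> measurable_fun [set: T] (kconst ^~ U).
Proof. by move=> _; exact: measurable_cst. Qed.

HB.instance Definition _ := isKernel.Build _ _ T Z R kconst measurable_kconst.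

Let kconst_uub : measure_fam_uub kconst.
Proof.
exists (fine (m setT) + 1) => x; rewrite /kconst.
by rewrite -[ltLHS]fineK ?fin_num_measure// lte_fin ltrDl.
Qed.

HB.instance Definition _ := Kernel_isFinite.Build _ _ T Z R kconst kconst_uub.

End kconst.

Section kpre.
Context d d' d'' (T : measurableType d) (U : measurableType d')
  (Z : measurableType d'') (f : T -> U) (K : R.-fker U ~> Z).

Definition kpre (mf : measurable_fun setT f) (t : T) :
  {measure set Z -> \bar R} := K (f t).

Hypothesis mf : measurable_fun setT f.

Let measurable_kpre V : measurable V -> measurable_fun [set: T] (kpre mf ^~ V).
Proof.
by move=> mV; exact: (measurableT_comp (measurable_kernel K V mV) mf).
Qed.

HB.instance Definition _ := isKernel.Build _ _ T Z R (kpre mf) measurable_kpre.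

Let kpre_uub : measure_fam_uub (kpre mf).
Proof. by have [r Kr] := measure_uub K; exists r => t; exact: Kr. Qed.

HB.instance Definition _ := Kernel_isFinite.Build _ _ T Z R (kpre mf) kpre_uub.

End kpre.

Section mbind.
Context d d' (T : measurableType d) (Z : measurableType d').
Variables (m : {finite_measure set T -> \bar R}) (K : R.-fker T ~> Z).

(** Composition is an operation on kernels, so [m] enters as a kernel from the one-point type. *)
Let mbind_ker : R.-fker unit ~> Z :=
  mkcomp (kconst m : R.-fker unit ~> T)
    (kpre K measurable_snd : R.-fker (unit * T) ~> Z).

Definition mbind : set Z -> \bar R := mbind_ker tt.

HB.instance Definition _ := Measure.on mbind.

Let mbind_fin : fin_num_fun mbind.
Proof. exact: kernel_finite_transition. Qed.

HB.instance Definition _ := Measure_isFinite.Build _ _ _ mbind mbind_fin.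

Lemma ge0_integral_mbind f : (forall z, 0 <= f z)%E -> measurable_fun setT f ->
  (\int[mbind]_z f z = \int[m]_t \int[K t]_z f z)%E.
Proof. by move=> f0 mf; rewrite [LHS]integral_kcomp. Qed.

End mbind.

Section kprod.
Context d d' d'' (T : measurableType d) (U : measurableType d')
  (Z : measurableType d'') (g : T * U -> Z) (K : R.-fker T ~> U).

Definition kpair (mg : measurable_fun setT g) : R.-fker T ~> Z :=
  mkcomp K (kdirac mg : R.-fker (T * U) ~> Z).

Lemma ge0_integral_kpair (mg : measurable_fun setT g) f t :
  (forall z, 0 <= f z)%E -> measurable_fun setT f ->
  (\int[kpair mg t]_z f z = \int[K t]_u f (g (t, u)))%E.
Proof.
move=> f0 mf; rewrite [LHS]integral_kcomp//; apply: eq_integral => u _.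
by rewrite integral_dirac// diracT mul1e.
Qed.

End kprod.
End kernel_constructions.

(* Uniqueness of measures on the pi-system of rectangles. *)
Lemma disintegration {R : realType} d d1 d2 (Om : measurableType d)
    (W : measurableType d1) (Z : measurableType d2)
    (P : {finite_measure set Om -> \bar R}) (e : Om -> W) (V : Om -> Z)
    (K : R.-fker W ~> Z) :
  measurable_fun setT e -> measurable_fun setT V ->
  (forall E C, measurable E -> measurable C ->
     P (e @^-1` E `&` V @^-1` C) = \int[P]_(w in e @^-1` E) K (e w) C)%E ->
  forall f : W * Z -> \bar R, (forall z, 0 <= f z)%E -> measurable_fun setT f ->
  (\int[P]_w f (e w, V w) = \int[P]_w \int[K (e w)]_z f (e w, z))%E.
Proof.
move=> me mV PE f f0 mf.
have meV : measurable_fun setT (fun w => (e w, V w)) by exact: measurable_fun_pair.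
have meZ : measurable_fun setT (fun z : Om * Z => (e z.1, z.2)).
  by apply: measurable_fun_pair => //; exact: measurableT_comp.
(* [m1] is the joint law of [(e, V)] and [m2] the law assembled from that of [e] and the kernel [K];
   the hypothesis says that they agree on rectangles. *)
pose m1 := mbind P (kdirac meV).
pose m2 := mbind P (kpair (kpre K me) meZ).
have -> : (\int[P]_w f (e w, V w) = \int[m1]_z f z)%E.
  rewrite ge0_integral_mbind//; apply: eq_integral => w _.
  by rewrite integral_dirac// diracT mul1e.
have -> : (\int[P]_w \int[K (e w)]_z f (e w, z) = \int[m2]_z f z)%E.
  rewrite ge0_integral_mbind//; apply: eq_integral => w _.
  by rewrite ge0_integral_kpair.
apply: eq_measure_integral => A mA _.
pose G := [set E `*` C | E in @measurable _ W & C in @measurable _ Z].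
apply: (@measure_unique _ _ _ G (fun=> setT)) => //.
- by rewrite measurable_prod_measurableType.
- move=> _ _ [E1 mE1 [C1 mC1 <-]] [E2 mE2 [C2 mC2 <-]].
  exists (E1 `&` E2); first exact: measurableI.
  by exists (C1 `&` C2); [exact: measurableI|rewrite setXI].
- by move=> _; exists setT => //; exists setT => //; rewrite setXTT.
- by rewrite bigcup_const//; exists 0%N.
- move=> _ [E mE [C mC <-]].
  have mEC : measurable (E `*` C) by exact: measurableX.
  have mE' : measurable (e @^-1` E) by exact: measurable_preimage.
  have mC' : measurable (V @^-1` C) by exact: measurable_preimage.
  transitivity (\int[P]_w (\1_(e @^-1` E `&` V @^-1` C) w)%:E)%E.
    apply: eq_integral => w _ /=; rewrite /kpre /kdirac diracE/= !indicE.
    by congr (_%:R%:E); congr nat_of_bool; apply/idP/idP; rewrite !inE.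
  rewrite integral_indic ?setIT//; last exact: measurableI.
  apply: (eq_trans (PE _ _ mE mC)).
  rewrite integral_mkcond; apply: eq_integral => w _ /=.
  transitivity (\int[K (e w)]_z (\1_(E `*` C) (e w, z))%:E)%E; last first.
    by apply: eq_integral => z _; rewrite /kpre /= /kdirac diracE indicE.
  rewrite patchE (_ : (w \in _) = (e w \in E)); last first.
    by apply/idP/idP; rewrite !inE.
  case: ifPn => ewE.
    transitivity (\int[K (e w)]_z (\1_C z)%:E)%E.
      by rewrite integral_indic// setIT.
    by apply: eq_integral => z _; rewrite !indicE in_setX/= ewE.
  rewrite integral0_eq// => z _.
  by rewrite indicE in_setX/= (negbTE ewE).
- by move=> _; rewrite ltey_eq fin_num_measure.
Qed.

Import KCOMP_FINITE_KERNEL.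

Module AtomicKernel.
Section atomic_kernel.
Context {R : realType} {d dA : measure_display}.
Context {W : measurableType d} {A : measurableType dA}.
Variables (s : seq A) (g : W -> A -> R).

(** The absolute value supplies the nonnegative scalar that [mscale] expects and disappears when [g]
    is a policy; the bound by 1 keeps the total mass at most the number of atoms. *)
Definition katom (mg : forall b, measurable_fun setT (g ^~ b))
    (g1 : forall w b, `|g w b| <= 1) (w : W) : {measure set A -> \bar R} :=
  msum (fun i => mscale (`|g w (nth point s i)|%:nng) \d_(nth point s i)) (size s).

Hypothesis mg : forall b, measurable_fun setT (g ^~ b).
Hypothesis g1 : forall w b, `|g w b| <= 1.

Lemma katomE w U : katom mg g1 w U = (\sum_(b <- s) `|g w b| * \1_U b)%:E.
Proof.
rewrite -sumEFin (big_nth point) big_mkord.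
transitivity (\sum_(i < size s)
  mscale (`|g w (nth point s i)|%:nng)%R \d_(nth point s i) U)%E; first by [].
by apply: eq_bigr => i _; rewrite /mscale/= diracE indicE EFinM.
Qed.

Let measurable_katom U : measurable U ->
  measurable_fun [set: W] (katom mg g1 ^~ U).
Proof.
move=> mU; under eq_fun do rewrite katomE.
apply/measurable_EFinP/measurable_sum => b.
by apply: measurable_funM => //; exact: measurableT_comp (mg b).
Qed.

HB.instance Definition _ := isKernel.Build _ _ W A R (katom mg g1) measurable_katom.

Let katom_uub : measure_fam_uub (katom mg g1).
Proof.
exists ((size s)%:R + 1) => w; rewrite katomE lte_fin.
rewrite (@le_lt_trans _ _ (\sum_(b <- s) 1))// ?ler_sum//.
  by move=> b _; rewrite indicT mulr1.
by rewrite big_const_seq count_predT iter_addr_0 ltrDl.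
Qed.

HB.instance Definition _ := Kernel_isFinite.Build _ _ W A R (katom mg g1) katom_uub.

Lemma ge0_integral_katom w f : (forall b, 0 <= f b)%E -> measurable_fun setT f ->
  (\int[katom mg g1 w]_b f b = \sum_(b <- s) `|g w b|%:E * f b)%E.
Proof.
move=> f0 mf; rewrite ge0_integral_measure_sum//.
rewrite (big_nth point) big_mkord; apply: eq_bigr => i _.
by rewrite ge0_integral_mscale// integral_dirac// diracT mul1e.
Qed.

End atomic_kernel.
End AtomicKernel.
Import AtomicKernel.

Lemma ge0_integral_counting {R : realType} dA (A : measurableType dA)
    (s : seq A) (f : A -> \bar R) :
  (forall B : set A, measurable B) -> uniq s -> (forall b, b \in s) ->
  (forall b, 0 <= f b)%E ->
  (\int[@counting A R]_b f b = \sum_(b <- s) f b)%E.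
Proof.
move=> mA us sT f0.
have mf (D : set A) : measurable_fun D f by move=> _ B mB; exact: mA.
have sE : [set: A] = \big[setU/set0]_(b <- s) [set b].
  apply/seteqP; split=> // b _; rewrite -bigcup_seq.
  by exists b => //=; exact: sT.
rewrite sE ge0_integral_bigsetU//; last by move=> b c _ _ [_ [-> ->]].
apply: eq_bigr => b _.
rewrite (eq_integral (cst (f b))); last by move=> c; rewrite inE => ->.
rewrite integral_cst//= /counting asboolT// fset_set1.
by rewrite finmap.cardfs1 mule1.
Qed.

Section observation_law.
Context {R : realType} {dO dX dA dY : measure_display}.
Context {Omega : measurableType dO} {X : measurableType dX}.
Context {A : measurableType dA} {Y : measurableType dY}.
Variables (P : probability Omega R) (PX : probability X R).
Variables (PY : R.-pker (X * A)%type ~> Y) (Pi : set (A -> X -> R)).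
Variables (D : adaptive_data R Omega X A Y) (s : seq A).
Hypothesis mA : forall B : set A, measurable B.
Hypotheses (us : uniq s) (sT : forall b, b \in s).
Hypothesis PiP : Pi `<=` [set g | cond_density g].
Hypothesis samp : adaptive_sampling P PX PY Pi D.

Definition obs t w : (X * A) * Y := ((ctx D t w, act D t w), out D t w).

Let one_meas (b : A) : measurable_fun [set: X] (fun _ : X => 1 : R).
Proof. exact: measurable_cst. Qed.

Let one_le1 (x : X) (b : A) : `|1 : R| <= 1.
Proof. by rewrite normr1. Qed.

Definition kact : R.-fker X ~> A := katom s one_meas one_le1.

(** Counting measure on the actions is left unnormalized: the density of an observation is then the
    action probability itself, and the total mass is the number of actions. *)
Definition obs_measure : {finite_measure set (X * A * Y)%type -> \bar R} :=
  mbind (mbind PX (kpair kact (@measurable_id _ _ setT)))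
    (kpair PY (@measurable_id _ _ setT)).

Lemma ge0_integral_obs_measure (f : (X * A) * Y -> \bar R) :
  (forall o, 0 <= f o)%E -> measurable_fun setT f ->
  (\int[obs_measure]_o f o =
   \int[PX]_x \sum_(b <- s) \int[PY (x, b)]_y f ((x, b), y))%E.
Proof.
move=> f0 mf.
have mfy : measurable_fun setT (fun v => \int[PY v]_y f (v, y))%E.
  exact: measurable_fun_integral_finite_kernel.
have fy0 v : (0 <= \int[PY v]_y f (v, y))%E by exact: integral_ge0.
rewrite ge0_integral_mbind//.
under eq_integral do rewrite ge0_integral_kpair//.
rewrite ge0_integral_mbind//.
apply: eq_integral => x _; rewrite ge0_integral_kpair//.
rewrite [LHS]ge0_integral_katom; last 2 first.
- by move=> b; exact: fy0.
- by move=> _ B _; exact: mA.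
by apply: eq_bigr => b _; rewrite normr1 mul1e.
Qed.

Lemma sigma_algebra_history t : sigma_algebra setT (history D t).
Proof. exact: smallest_sigma_algebra. Qed.

Lemma measurable_historyE t :
  @measurable _ (g_sigma_algebraType (history D t)) = history D t.
Proof. exact/measurable_g_measurableTypeE/sigma_algebra_history. Qed.

Lemma sub_history t t' : (t <= t')%N -> history D t `<=` history D t'.
Proof.
move=> tt'; apply: smallest_sub; first exact: smallest_sigma_algebra.
move=> E [i /= /andP[i1 it] Ei]; apply: sub_sigma_algebra.
by exists i => //=; rewrite i1 (leq_trans it).
Qed.

Lemma history_measurable t : history D t `<=` measurable.
Proof.
apply: smallest_sub; first exact: sigma_algebra_measurable.
move=> E [i /= /andP[i1 it]] [[|]|] [B mB <-]; rewrite setTI;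
  apply: measurable_preimage => //.
- exact: (measurable_ctx samp).
- exact: (measurable_act samp).
- exact: (measurable_out samp).
Qed.

Lemma history_ctx_measurable t : (1 <= t)%N -> history_ctx D t `<=` measurable.
Proof.
move=> t1; apply: smallest_sub; first exact: sigma_algebra_measurable.
move=> E [/history_measurable//|[B mB <-]]; rewrite setTI.
by apply: measurable_preimage => //; exact: (measurable_ctx samp).
Qed.

Lemma history_ctx_act_measurable t : (1 <= t)%N ->
  history_ctx_act D t `<=` measurable.
Proof.
move=> t1; apply: smallest_sub; first exact: sigma_algebra_measurable.
move=> E [/history_ctx_measurable|[B mB <-]]; rewrite ?setTI; first exact.
by apply: measurable_preimage => //; exact: (measurable_act samp).
Qed.

Lemma measurable_fun_id_sub (F F' : set_system Omega) : F `<=` <<s F' >> ->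
  measurable_fun setT (id : g_sigma_algebraType F' -> g_sigma_algebraType F).
Proof.
move=> FF' _ E mE; rewrite setTI preimage_id.
by move: E mE; apply: smallest_sub => //; exact: smallest_sigma_algebra.
Qed.

Lemma measurable_fun_id_g_sigma (F : set_system Omega) : F `<=` measurable ->
  measurable_fun setT (id : Omega -> g_sigma_algebraType F).
Proof.
move=> mF _ E mE; rewrite setTI preimage_id.
by move: E mE; apply: smallest_sub => //; exact: sigma_algebra_measurable.
Qed.

Lemma measurable_fun_id_history t t' : (t <= t')%N ->
  measurable_fun setT
    (id : g_sigma_algebraType (history D t') -> g_sigma_algebraType (history D t)).
Proof.
move=> tt'; apply: measurable_fun_id_sub.
by apply: subset_trans (sub_history tt') _; exact: sub_sigma_algebra.
Qed.

Lemma measurable_fun_history t :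
  measurable_fun setT (id : Omega -> g_sigma_algebraType (history D t)).
Proof. exact/measurable_fun_id_g_sigma/history_measurable. Qed.

Lemma measurable_obs t t' : (1 <= t <= t')%N ->
  measurable_fun [set: g_sigma_algebraType (history D t')] (obs t).
Proof.
move=> /andP[t1 tt'].
have gen E : (g_sigma_algebra_preimage (ctx D t) `|`
         g_sigma_algebra_preimage (act D t) `|`
         g_sigma_algebra_preimage (out D t)) E ->
    measurable (E : set (g_sigma_algebraType (history D t'))).
  move=> tE; apply: sub_sigma_algebra; apply: sub_sigma_algebra.
  by exists t => //=; rewrite t1.
apply: measurable_fun_pair; first apply: measurable_fun_pair.
- by move=> _ B mB; apply: gen; left; left; exists B.
- by move=> _ B mB; apply: gen; left; right; exists B.
- by move=> _ B mB; apply: gen; right; exists B.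
Qed.

Lemma measurable_pol t : (1 <= t)%N -> measurable_fun
  [set: g_sigma_algebraType (history D t.-1) * (X * A * Y)]
  (fun z => pol D t z.1 z.2.1.2 z.2.1.1).
Proof.
move=> t1.
have mg : measurable_fun
    [set: g_sigma_algebraType (history D t.-1) * (X * A * Y)]
    (fun z => (z.1, (z.2.1.2, z.2.1.1))).
  apply: measurable_fun_pair => //; apply: measurable_fun_pair.
  - by apply: measurableT_comp => //; apply: measurableT_comp.
  - by apply: measurableT_comp => //; apply: measurableT_comp.
exact: measurableT_comp (pol_adapted samp t1) mg.
Qed.

Lemma pol_ge0 t w b x : (1 <= t)%N -> 0 <= pol D t w b x.
Proof. by move=> t1; have [_ + _] := PiP (pol_in_class samp w t1); exact. Qed.

Lemma sum_pol t w x : (1 <= t)%N -> \sum_(b <- s) pol D t w b x = 1.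
Proof.
move=> t1; have [_ g0 /(_ x)] := PiP (pol_in_class samp w t1).
rewrite (ge0_integral_counting mA us sT); last first.
  by move=> b; rewrite lee_fin.
by rewrite sumEFin => -[].
Qed.

Lemma pol_le1 t w b x : (1 <= t)%N -> pol D t w b x <= 1.
Proof.
move=> t1; rewrite -(sum_pol w x t1) (big_rem b)//= lerDl sumr_ge0// => c _.
exact: pol_ge0.
Qed.

(* The conditional law of the t-th observation has density pi_t with respect
   to the fixed measure obs_measure. *)
Lemma integral_obs t (f : g_sigma_algebraType (history D t.-1) * (X * A * Y) ->
    \bar R) : (1 <= t)%N -> (forall z, 0 <= f z)%E -> measurable_fun setT f ->
  (\int[P]_w f (w, obs t w) = \int[P]_w \int[obs_measure]_o
     ((pol D t w o.1.2 o.1.1)%:E * f (w, o)))%E.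
Proof.
move=> t1 f0 mf.
set F := history D t.-1 in f f0 mf *.
set F1 := history_ctx D t; set F2 := history_ctx_act D t.
have FF1 : F `<=` <<s F1 >>.
  move=> E FE; apply: sub_sigma_algebra.
  by apply: sub_sigma_algebra; left.
have F1F2 : F1 `<=` <<s F2 >>.
  move=> E FE; apply: sub_sigma_algebra.
  by apply: sub_sigma_algebra; left.
have mX1 : measurable_fun [set: g_sigma_algebraType F1] (ctx D t).
  move=> _ B mB; apply: sub_sigma_algebra.
  by apply: sub_sigma_algebra; right; exists B.
have mA2 : measurable_fun [set: g_sigma_algebraType F2] (act D t).
  move=> _ B mB; apply: sub_sigma_algebra.
  by apply: sub_sigma_algebra; right; exists B.
have mi12 := measurable_fun_id_sub F1F2.
have miF1 := measurable_fun_id_sub FF1.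
have mX2 : measurable_fun [set: g_sigma_algebraType F2] (ctx D t).
  exact: measurableT_comp mX1 mi12.
have miF2 : measurable_fun setT
    (id : g_sigma_algebraType F2 -> g_sigma_algebraType F).
  exact: measurableT_comp miF1 mi12.
have mU2 : measurable_fun [set: g_sigma_algebraType F2]
  (fun w => (ctx D t w, act D t w)) by exact: measurable_fun_pair.
pose f3 (z : g_sigma_algebraType F2 * Y) :=
  f (z.1, ((ctx D t z.1, act D t z.1), z.2)).
have mf3 : measurable_fun setT f3.
  apply: (measurableT_comp mf).
  apply: measurable_fun_pair; first exact: measurableT_comp miF2 measurable_fst.
  by apply: measurable_fun_pair => //; exact: measurableT_comp mU2 measurable_fst.
have e2 : measurable_fun setT (id : Omega -> g_sigma_algebraType F2).
  exact/measurable_fun_id_g_sigma/history_ctx_act_measurable.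
have e1 : measurable_fun setT (id : Omega -> g_sigma_algebraType F1).
  exact/measurable_fun_id_g_sigma/history_ctx_measurable.
have e0 : measurable_fun setT (id : Omega -> g_sigma_algebraType F).
  exact/measurable_fun_id_g_sigma/history_measurable.
have mF1 E : measurable (E : set (g_sigma_algebraType F1)) -> F1 E.
  rewrite [X in X E -> _]measurable_g_measurableTypeE//.
  exact: smallest_sigma_algebra.
have mF2 E : measurable (E : set (g_sigma_algebraType F2)) -> F2 E.
  rewrite [X in X E -> _]measurable_g_measurableTypeE//.
  exact: smallest_sigma_algebra.
have mF E : measurable (E : set (g_sigma_algebraType F)) -> F E.
  rewrite [X in X E -> _]measurable_g_measurableTypeE//.
  exact: smallest_sigma_algebra.
(* The sampling laws are applied in reverse order: the outcome is integrated out given the past, the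
   context and the action, then the action given the past and the context, and finally the context
   given the past. *)
transitivity (\int[P]_w \int[PY (ctx D t w, act D t w)]_y f3 (w, y))%E.
  apply: (disintegration (P := P) (e := id : Omega -> g_sigma_algebraType F2)
    (V := out D t) (K := kpre PY mU2)) => //; last by move=> z; exact: f0.
    exact: (measurable_out samp).
  by move=> E C mE mC; apply: (out_law samp) => //; exact: mF2.
pose f2 (z : g_sigma_algebraType F * (X * A)) :=
  (\int[PY z.2]_y f (z.1, (z.2, y)))%E.
have f20 z : (0 <= f2 z)%E by exact: integral_ge0.
have mf2 : measurable_fun setT f2.
  apply: (measurable_fun_integral_finite_kernel
    (fun z : (g_sigma_algebraType F * (X * A)) * Y =>
       f (z.1.1, (z.1.2, z.2))) (kpre PY measurable_snd)) => //.
  apply: (measurableT_comp mf); apply: measurable_fun_pair.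
    by apply: measurableT_comp.
  by apply: measurable_fun_pair => //; apply: measurableT_comp.
have mg b : measurable_fun [set: g_sigma_algebraType F1]
    (fun w => pol D t w b (ctx D t w)).
  apply: (measurableT_comp (pol_adapted samp t1)
    (g := fun w : g_sigma_algebraType F1 => (w : g_sigma_algebraType F, (b, ctx D t w)))).
  by apply: measurable_fun_pair => //; exact: measurable_fun_pair.
have g1 (w : g_sigma_algebraType F1) b : `|pol D t w b (ctx D t w)| <= 1.
  by rewrite ger0_norm ?pol_ge0// pol_le1.
(* The action law is given on singletons only; as there are finitely many actions, summation extends
   it to every set. *)
have law_act (E : set Omega) (C : set A) : F1 E -> measurable C ->
  P (E `&` act D t @^-1` C) = (\int[P]_(w in E) katom s mg g1 w C)%E.
  move=> FE mC.
  have mE : measurable E by exact: (history_ctx_measurable t1).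
  have mAb b : measurable (act D t @^-1` [set b]).
    by apply: measurable_preimage => //; exact: (measurable_act samp).
  transitivity (\sum_(b <- s) (\1_C b)%:E * P (E `&` act D t @^-1` [set b]))%E.
    transitivity (\int[P]_w (\1_(E `&` act D t @^-1` C) w)%:E)%E.
      rewrite integral_indic ?setIT//; apply: measurableI => //.
      by apply: measurable_preimage => //; exact: (measurable_act samp).
    transitivity (\int[P]_w \sum_(b <- s) ((\1_C b)%:E *
        (\1_(E `&` act D t @^-1` [set b]) w)%:E))%E.
      apply: eq_integral => w _.
      rewrite (bigD1_seq (act D t w))//= big1 ?adde0 => [|b bA].
        rewrite -EFinM !indicE -natrM mulnb; congr (_%:R%:E).
        congr nat_of_bool; apply/idP/andP; rewrite !inE.
          by case.
        by case=> ? [].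
      rewrite [X in (_ * X%:E)%E]indicE memNset ?mule0//.
      by move=> [_ /= ab]; rewrite ab eqxx in bA.
    rewrite ge0_integral_sum//.
    - apply: eq_bigr => b _; rewrite ge0_integralZl_EFin//.
        by rewrite integral_indic ?setIT//; exact: measurableI.
      apply/measurable_EFinP; apply: measurable_indic; exact: measurableI.
    - move=> b; apply/measurable_EFinP; apply: measurable_funM => //.
      apply: measurable_indic; exact: measurableI.
  transitivity (\int[P]_(w in E)
     \sum_(b <- s) ((\1_C b)%:E * (pol D t w b (ctx D t w))%:E))%E; last first.
    apply: eq_integral => w _; rewrite katomE -sumEFin.
    by apply: eq_bigr => b _; rewrite -EFinM mulrC ger0_norm ?pol_ge0.
  have mgE b : measurable_fun E (fun w => (pol D t w b (ctx D t w))%:E).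
    apply: measurable_funTS; apply/measurable_EFinP.
    exact: measurableT_comp (mg b) e1.
  rewrite ge0_integral_sum//.
  - apply: eq_bigr => b _; rewrite ge0_integralZl_EFin//.
      by congr (_ * _)%E; exact: (act_law samp).
    by move=> w _; rewrite lee_fin pol_ge0.
  - by move=> b; apply: emeasurable_funM.
  - by move=> b w _; rewrite -EFinM lee_fin mulr_ge0// pol_ge0.
transitivity (\int[P]_w \int[katom s mg g1 w]_b f2 (w, (ctx D t w, b)))%E.
  apply: (@disintegration _ _ _ _ _ _ _ P (id : Omega -> g_sigma_algebraType F1)
    (act D t) (katom s mg g1) _ _ _
    (fun z : g_sigma_algebraType F1 * A => f2 (z.1, (ctx D t z.1, z.2)))).
  - exact: e1.
  - exact: (measurable_act samp).
  - by move=> E C mE mC; exact: law_act (mF1 _ mE) mC.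
  - by move=> z; exact: f20.
  - apply: (measurableT_comp mf2); apply: measurable_fun_pair.
      exact: measurableT_comp miF1 measurable_fst.
    apply: measurable_fun_pair => //.
    exact: measurableT_comp mX1 measurable_fst.
pose f1 (z : g_sigma_algebraType F * X) :=
  (\sum_(b <- s) (pol D t z.1 b z.2)%:E * f2 (z.1, (z.2, b)))%E.
have f10 z : (0 <= f1 z)%E.
  by apply: sume_ge0 => b _; rewrite mule_ge0// lee_fin pol_ge0.
have mf1 : measurable_fun setT f1.
  apply: emeasurable_sum => b; apply: emeasurable_funM.
    apply/measurable_EFinP.
    apply: (measurableT_comp (pol_adapted samp t1)
      (g := fun z : g_sigma_algebraType F * X => (z.1, (b, z.2)))).
    by apply: measurable_fun_pair => //; exact: measurable_fun_pair.
  apply: (measurableT_comp mf2).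
  by apply: measurable_fun_pair => //; exact: measurable_fun_pair.
transitivity (\int[P]_w f1 (w, ctx D t w))%E.
  apply: eq_integral => w _; rewrite ge0_integral_katom//.
  by apply: eq_bigr => b _; rewrite ger0_norm// pol_ge0.
transitivity (\int[P]_w \int[PX]_x f1 (w, x))%E.
  apply: (@disintegration _ _ _ _ _ _ _ P (id : Omega -> g_sigma_algebraType F)
    (ctx D t) (kconst PX) _ _ _ f1) => //.
    exact: (measurable_ctx samp).
  move=> E C mE mC; apply: (eq_trans (ctx_law samp t1 (mF _ mE) mC)).
  rewrite integral_cst ?preimage_id; last by apply: (@history_measurable t.-1); exact: mF.
  by rewrite muleC.
apply: eq_integral => w _; rewrite ge0_integral_obs_measure//; last 2 first.
- by move=> o; rewrite mule_ge0// lee_fin pol_ge0.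
- apply: emeasurable_funM; last exact: (@measurable_fun_pair2 _ _ _ _ _ _ f w mf).
  by apply/measurable_EFinP; 
  exact: (@measurable_fun_pair2 _ _ _ (g_sigma_algebraType F) (X * A * Y)%type R
    (fun z => pol D t z.1 z.2.1.2 z.2.1.1) w (measurable_pol t1)).
apply: eq_integral => x _; apply: eq_bigr => b _.
rewrite /= -ge0_integralZl_EFin//; last exact: pol_ge0.
apply: (measurableT_comp mf).
by apply: measurable_fun_pair => //; exact: measurable_fun_pair.
Qed.

End observation_law.

(** * An exponential inequality for sequential designs *)

Section bounded_measurable.
Context {R : realType} {d : measure_display} {T : measurableType d}.
Implicit Types f g : T -> R.

(** A class closed under the algebra of the estimators, on which integrability against a finite
    measure is automatic, so that integrals can be manipulated as linear functionals. *)
Definition bmeas f := measurable_fun setT f /\ exists c, forall x, `|f x| <= c.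

Lemma bmeas_cst c : bmeas (fun=> c).
Proof. by split => //; exists `|c|. Qed.

Lemma bmeasN f : bmeas f -> bmeas (fun x => - f x).
Proof.
move=> [mf [c fc]]; split; first exact: measurableT_comp mf.
by exists c => x; rewrite normrN.
Qed.

Lemma bmeasD f g : bmeas f -> bmeas g -> bmeas (fun x => f x + g x).
Proof.
move=> [mf [c fc]] [mg [c' gc]]; split; first exact: measurable_funD.
by exists (c + c') => x; rewrite (le_trans (ler_normD _ _))// lerD.
Qed.

Lemma bmeasB f g : bmeas f -> bmeas g -> bmeas (fun x => f x - g x).
Proof. by move=> bf bg; apply: bmeasD => //; exact: bmeasN. Qed.

Lemma bmeasM f g : bmeas f -> bmeas g -> bmeas (fun x => f x * g x).
Proof.
move=> [mf [c fc]] [mg [c' gc]]; split; first exact: measurable_funM.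
by exists (c * c') => x; rewrite normrM ler_pM.
Qed.

Lemma bmeasX f n : bmeas f -> bmeas (fun x => f x ^+ n).
Proof.
move=> [mf [c fc]]; split; first exact: measurable_funX.
by exists (c ^+ n) => x; rewrite normrX lerXn2r ?nnegrE// (le_trans _ (fc x)).
Qed.

Lemma bmeas_norm f : bmeas f -> bmeas (fun x => `|f x|).
Proof.
move=> [mf [c fc]]; split; first exact: measurableT_comp mf.
by exists c => x; rewrite normr_id.
Qed.

Lemma bmeas_min f g : bmeas f -> bmeas g -> bmeas (fun x => Num.min (f x) (g x)).
Proof.
move=> [mf [c fc]] [mg [c' gc]]; split; first exact: measurable_minr.
exists (Num.max c c') => x; rewrite minEle; case: ifP => _.
  by rewrite (le_trans (fc x))// le_max lexx.
by rewrite (le_trans (gc x))// le_max lexx orbT.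
Qed.

Lemma bmeas_expR f : bmeas f -> bmeas (fun x => expR (f x)).
Proof.
move=> [mf [c fc]]; split; first exact: measurableT_comp mf.
exists (expR c) => x; rewrite ger0_norm ?expR_ge0// ler_expR.
by rewrite (le_trans (ler_norm _)).
Qed.

Lemma bmeas_inv f c : 0 < c -> (forall x, c <= f x) -> bmeas f ->
  bmeas (fun x => (f x)^-1).
Proof.
move=> c0 cf [mf _]; split.
  rewrite (_ : (fun x => _) = (fun x => f x `^ (-1))).
    apply: (measurableT_comp (f := (@powR R)^~ (-1))) => //.
  apply/funext => x; have fx : 0 <= f x by rewrite (le_trans (ltW c0)).
  by rewrite powRN powRr1.
exists c^-1 => x; have fx : 0 < f x := lt_le_trans c0 (cf x).
by rewrite ger0_norm ?invr_ge0 ?(ltW fx)// lef_pV2.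
Qed.

Context (mu : {finite_measure set T -> \bar R}).

Lemma bmeas_integrable f : bmeas f -> mu.-integrable setT (EFin \o f).
Proof.
move=> [mf [c fc]]; apply: measurable_bounded_integrable => //.
  by rewrite ltey_eq fin_num_measure.
exists c; split; first exact: num_real.
by move=> M cM x _; apply: le_trans (fc x) _; exact: ltW.
Qed.

Lemma Rintegral_EFin f : bmeas f ->
  (\int[mu]_x (f x)%:E)%E = (\int[mu]_x f x)%:E.
Proof.
move=> bf; rewrite fineK//; apply: integrable_fin_num => //.
exact: bmeas_integrable.
Qed.

Lemma bmeas_RintegralD f g : bmeas f -> bmeas g ->
  \int[mu]_x (f x + g x) = \int[mu]_x f x + \int[mu]_x g x.
Proof. by move=> bf bg; apply: RintegralD => //; exact: bmeas_integrable. Qed.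

Lemma bmeas_RintegralB f g : bmeas f -> bmeas g ->
  \int[mu]_x (f x - g x) = \int[mu]_x f x - \int[mu]_x g x.
Proof. by move=> bf bg; apply: RintegralB => //; exact: bmeas_integrable. Qed.

Lemma bmeas_RintegralZl c f : bmeas f ->
  \int[mu]_x (c * f x) = c * \int[mu]_x f x.
Proof. by move=> bf; apply: RintegralZl => //; exact: bmeas_integrable. Qed.

Lemma bmeas_le_Rintegral f g : bmeas f -> bmeas g -> (forall x, f x <= g x) ->
  \int[mu]_x f x <= \int[mu]_x g x.
Proof. by move=> bf bg fg; apply: le_Rintegral => //; exact: bmeas_integrable. Qed.

Lemma bmeas_normr_Rintegral f : bmeas f ->
  `|\int[mu]_x f x| <= \int[mu]_x `|f x|.
Proof. by move=> bf; apply: le_normr_Rintegral => //; exact: bmeas_integrable. Qed.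

Lemma bmeas_RintegralN f : bmeas f -> \int[mu]_x (- f x) = - \int[mu]_x f x.
Proof.
move=> bf; rewrite -mulN1r -bmeas_RintegralZl//.
by apply: eq_Rintegral => x _; rewrite mulN1r.
Qed.

End bounded_measurable.

Lemma measurable_sum_nat {R : realType} d (T : measurableType d) (m n : nat)
    (f : nat -> T -> R) :
  (forall i, (m <= i < n)%N -> measurable_fun setT (f i)) ->
  measurable_fun setT (fun x => \sum_(m <= i < n) f i x).
Proof.
move=> mf; rewrite (_ : (fun x => _) = (fun x =>
    \sum_(m <= i < n) (if (m <= i < n)%N then f i x else 0))).
  apply: measurable_sum => i; case: (boolP (m <= i < n)%N) => [/mf//|_].
  exact: measurable_cst.
by apply/funext => x; apply: eq_big_nat => i ->.
Qed.

(** From [e^(-x) >= 1 - x] one gets [e^x <= 1 / (1 - x)], and [(1 - x) (1 + x + 2 x^2) = 1 + x^2 (1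
    - 2 x)], which is at least 1 for [x <= 1/2]. *)
Lemma expR_le_quadratic (R : realType) (x : R) : `|x| <= 2^-1 ->
  expR x <= 1 + x + 2 * x ^+ 2.
Proof.
rewrite ler_norml => /andP[x1 x2].
have x3 : 0 < 1 - x by lra.
have : expR x <= (1 - x)^-1.
  rewrite -[x in expR x]opprK expRN lef_pV2 ?posrE ?expR_gt0//.
  exact: expR_ge1Dx.
move=> /le_trans->//; rewrite -[leLHS]mulr1 ler_pdivrMl//.
have : 0 <= x ^+ 2 * (1 - 2 * x) by rewrite mulr_ge0 ?sqr_ge0//; lra.
by move=> ?; nra.
Qed.

Section supermartingale.
Context {R : realType} {dO d : measure_display}.
Context {Om : measurableType dO} {O : measurableType d}.
Variables (P : probability Om R) (Lam : {finite_measure set O -> \bar R}).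
Variables (F : nat -> set_system Om) (ob : nat -> Om -> O).
Local Notation G t := (g_sigma_algebraType (F t)).

(* ob t has conditional density q t with respect to Lam given F (t - 1), and
   this density is bounded below by fl, for n < t <= 2 n. *)
Record sequential_design (q : nat -> Om -> O -> R) (fl : R) (n : nat) : Prop :=
  SequentialDesign {
  design_id_mono : forall t t', (t <= t')%N ->
    measurable_fun setT (id : G t' -> G t) ;
  design_id : forall t, measurable_fun setT (id : Om -> G t) ;
  design_ob : forall t t', (1 <= t <= t')%N -> measurable_fun [set: G t'] (ob t) ;
  design_q : forall t, (n < t)%N ->
    measurable_fun [set: G t.-1 * O] (fun z => q t z.1 z.2) ;
  design_floor_gt0 : 0 < fl ;
  design_floor : forall t w o, (n < t)%N -> fl <= q t w o <= 1 ;
  design_law : forall t (f : G t.-1 * O -> \bar R), (n < t <= 2 * n)%N ->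
    (forall z, 0 <= f z)%E -> measurable_fun setT f ->
    (\int[P]_w f (w, ob t w) =
     \int[P]_w \int[Lam]_o ((q t w o)%:E * f (w, o)))%E ;
  design_mass : {ae P, forall w, forall t, (n < t <= 2 * n)%N ->
    \int[Lam]_o q t w o <= 1}
}.

Variables (q : nat -> Om -> O -> R) (fl : R) (n : nat).
Hypothesis dsg : sequential_design q fl n.

Lemma measurable_of_history t (f : Om -> R) :
  measurable_fun [set: G t] f -> measurable_fun [set: Om] f.
Proof.
move=> mf _ B mB; rewrite setTI.
exact: (measurable_preimage (design_id dsg (t := t)) (measurable_preimage mf mB)).
Qed.

Lemma measurable_past t t' (f : Om -> O -> R) : (1 <= t <= t')%N ->
  measurable_fun [set: G t.-1 * O] (fun z => f z.1 z.2) ->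
  measurable_fun [set: G t'] (fun w => f w (ob t w)).
Proof.
move=> tt' mf.
have tt : (t.-1 <= t')%N by case/andP: tt' => _; apply: leq_trans; exact: leq_pred.
have mg : measurable_fun setT (fun w : G t' => (w : G t.-1, ob t w)).
  apply: measurable_fun_pair; first exact: (design_id_mono dsg tt).
  exact: (design_ob dsg tt').
exact: measurableT_comp mf mg.
Qed.

(** Supermartingale induction: the earlier factors are functions of the past, and the conditional
    law lets the last factor be integrated against the density, contributing at most 1. This
    constraint is known for almost every trajectory only, hence the almost everywhere comparison of
    integrals. *)
Lemma le1_expectation_prod (e : nat -> Om -> O -> R) :
  (forall t w o, 0 <= e t w o) ->
  (forall t, (n < t)%N ->
     measurable_fun [set: G t.-1 * O] (fun z => e t z.1 z.2)) ->
  {ae P, forall w, forall t, (n < t <= 2 * n)%N ->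
    (\int[Lam]_o ((q t w o)%:E * (e t w o)%:E) <= 1)%E} ->
  forall t, (n < t <= 2 * n)%N ->
  (\int[P]_w (\prod_(n.+1 <= s < t) e s w (ob s w))%:E <= 1)%E.
Proof.
move=> e0 me e1 t; elim: t => // t IH; rewrite ltnS => /andP[nt tn2].
have [tn|{}nt] := leqP t n.
  have -> : t = n by apply/eqP; rewrite eqn_leq tn.
  rewrite (eq_integral (cst 1%E)) => [|w _]; last by rewrite big_geq.
  by rewrite integral_cst// mul1e; exact: probability_le1.
have ntn : (n < t <= 2 * n)%N by rewrite nt ltnW.
pose M w := \prod_(n.+1 <= s < t) e s w (ob s w).
have M0 w : 0 <= M w by apply: prodr_ge0.
have mM : measurable_fun [set: G t.-1] M.
  apply: measurable_prod => s; rewrite mem_index_iota => /andP[ns st].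
  apply: measurable_past; last exact: me.
  by rewrite (leq_ltn_trans _ ns)//= -ltnS prednK// (leq_ltn_trans _ nt).
pose f (z : G t.-1 * O) := (M z.1 * e t z.1 z.2)%:E.
have -> : (\int[P]_w (\prod_(n.+1 <= s < t.+1) e s w (ob s w))%:E =
           \int[P]_w f (w, ob t w))%E.
  by apply: eq_integral => w _; rewrite big_nat_recr.
have mf : measurable_fun setT f.
  apply/measurable_EFinP; apply: measurable_funM; last exact: me.
  exact: measurableT_comp mM measurable_fst.
rewrite (design_law dsg ntn)//; last first.
  by move=> z; rewrite lee_fin mulr_ge0.
apply: le_trans (IH ntn).
have mq := design_q dsg nt.
have q0 w o : 0 <= q t w o.
  case/andP: (design_floor dsg w o nt) => + _; apply: le_trans.
  exact: ltW (design_floor_gt0 dsg).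
apply: ae_ge0_le_integral => //.
- by move=> w _; apply: integral_ge0 => o _; rewrite -EFinM lee_fin !mulr_ge0.
- apply: (measurableT_comp (f := fun w : G t.-1 =>
    (\int[Lam]_o ((q t w o)%:E * f (w, o)))%E)); last exact: (design_id dsg).
  apply: (measurable_fun_integral_finite_kernel
    (fun z : G t.-1 * O => ((q t z.1 z.2)%:E * f z)%E) (kconst Lam)).
    by move=> z; rewrite -EFinM lee_fin !mulr_ge0.
  by apply: emeasurable_funM => //; exact/measurable_EFinP.
- by move=> w _; rewrite lee_fin; exact: M0.
- apply/measurable_EFinP.
  exact: measurable_of_history mM.
- apply: filterS e1 => w /(_ t ntn) e1 _.
  rewrite (_ : (fun o => _) = (fun o => (M w)%:E * ((q t w o)%:E * (e t w o)%:E))%E).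
    rewrite ge0_integralZl_EFin//.
    - by rewrite -[leRHS]mule1; apply: lee_wpmul2l => //; rewrite lee_fin.
    - by move=> o _; rewrite -EFinM lee_fin mulr_ge0.
    - apply: emeasurable_funM; apply/measurable_EFinP.
        exact: (@measurable_fun_pair2 _ _ _ (G t.-1) O R (fun z => q t z.1 z.2) w mq).
      exact: (@measurable_fun_pair2 _ _ _ (G t.-1) O R (fun z => e t z.1 z.2) w (me t nt)).
  by apply/funext => o; rewrite /f/= EFinM muleCA.
Qed.

(** Measurability of kernel integrals concerns nonnegative integrands: [Phi] is shifted by its bound
    [B], and the integral of the constant is subtracted. *)
Lemma measurable_Rintegral_section t (Phi : Om -> O -> R) B :
  measurable_fun [set: G t * O] (fun z => Phi z.1 z.2) ->
  (forall w o, `|Phi w o| <= B) ->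
  measurable_fun [set: G t] (fun w => \int[Lam]_o Phi w o).
Proof.
move=> mPhi PhiB.
have bPhi w : bmeas (Phi w).
  split; last by exists B => o; exact: PhiB.
  exact: (@measurable_fun_pair2 _ _ _ (G t) O R (fun z => Phi z.1 z.2) w mPhi).
rewrite (_ : (fun w => _) = (fun w : G t =>
  \int[kconst Lam w]_o (B + Phi w o) - \int[Lam]_o (cst B o))).
  apply: measurable_funB; last exact: measurable_cst.
  apply: (measurableT_comp (f := @fine R)) => //.
  apply: (measurable_fun_integral_finite_kernel
    (fun z : G t * O => (B + Phi z.1 z.2)%:E) (kconst Lam)).
    move=> z; rewrite lee_fin -lerBlDl sub0r.
    by have := PhiB z.1 z.2; rewrite ler_norml => /andP[].
  by apply/measurable_EFinP; exact: measurable_funD.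
apply/funext => w; rewrite /kconst -bmeas_RintegralB.
- by apply: eq_Rintegral => o _; rewrite addrC addKr.
- by apply: bmeasD => //; exact: bmeas_cst.
- exact: bmeas_cst.
Qed.

Section tail.
Variables (psi : nat -> Om -> O -> R) (C : R) (h : O -> R) (b v : R).
Hypothesis mpsi : forall t, (n < t)%N ->
  measurable_fun [set: G t.-1 * O] (fun z => psi t z.1 z.2).
Hypothesis psiC : forall t w o, `|psi t w o| <= C.
Hypotheses (mh : measurable_fun setT h) (hb : forall o, `|h o| <= b).
Hypothesis hv : \int[Lam]_o (h o ^+ 2) <= v.

(** A martingale in [t] under the design: the conditional density of [ob s] cancels the division by
    [q s], so the subtracted integral is the conditional mean. *)
Definition centered_sum (psi : nat -> Om -> O -> R) (h : O -> R) t w : R :=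
  \sum_(n.+1 <= s < t) (psi s w (ob s w) * h (ob s w) / q s w (ob s w)
                         - \int[Lam]_o (psi s w o * h o)).

Lemma bmeas_h : bmeas h. Proof. by split => //; exists b. Qed.

Lemma bmeas_psi t w : (n < t)%N -> bmeas (psi t w).
Proof.
move=> nt; split; last by exists C => o; exact: psiC.
exact: (@measurable_fun_pair2 _ _ _ (G t.-1) O R (fun z => psi t z.1 z.2) w (mpsi nt)).
Qed.

Lemma bmeas_q t w : (n < t)%N -> bmeas (q t w).
Proof.
move=> nt; split.
  exact: (@measurable_fun_pair2 _ _ _ (G t.-1) O R (fun z => q t z.1 z.2) w
    (design_q dsg nt)).
exists 1 => o; case/andP: (design_floor dsg w o nt) => flq q1.
by rewrite ger0_norm// (le_trans _ flq)// ltW// (design_floor_gt0 dsg).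
Qed.

Lemma bmeas_qV t w : (n < t)%N -> bmeas (fun o => (q t w o)^-1).
Proof.
move=> nt; apply: (bmeas_inv (design_floor_gt0 dsg)); last exact: bmeas_q.
by move=> o; case/andP: (design_floor dsg w o nt).
Qed.

(** Multiplied by [q], the linear term of the expansion has no denominator left and the quadratic
    term keeps a single [1 / q]. The variance proxy [C ^+ 2 * v / fl] therefore pays for the floor
    once, although the square of a summand contains it twice. The integral is then at most
    [e^(-k) (1 + k)], where [k] collects the compensator and the proxy. *)
Lemma le1_conditional_expR lam t w : (n < t)%N -> 0 <= lam ->
  lam * C * b / fl <= 2^-1 -> \int[Lam]_o q t w o <= 1 ->
  \int[Lam]_o (q t w o * expR (lam * (psi t w o * h o / q t w o
    - \int[Lam]_o' (psi t w o' * h o')) - 2 * lam ^+ 2 * C ^+ 2 * v / fl)) <= 1.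
Proof.
move=> nt lam0 lamb q1.
set c := \int[Lam]_o' (psi t w o' * h o').
pose k := lam * c + 2 * lam ^+ 2 * C ^+ 2 * v / fl.
have fl0 := design_floor_gt0 dsg.
have qfl o : fl <= q t w o by case/andP: (design_floor dsg w o nt).
have q0 o : 0 < q t w o := lt_le_trans fl0 (qfl o).
have bq := bmeas_q w nt. have bqV := bmeas_qV w nt.
have bp := bmeas_psi w nt. have bh := bmeas_h.
have bph := bmeasM bp bh.
have C0 (o : O) : 0 <= C := le_trans (normr_ge0 _) (psiC t w o).
have b0 (o : O) : 0 <= b := le_trans (normr_ge0 _) (hb o).
have bsq : bmeas (fun o => h o ^+ 2) by exact: bmeasX.
pose g o := q t w o + lam * (psi t w o * h o) + 2 * lam ^+ 2 * C ^+ 2 / fl * (h o ^+ 2).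
have bg : bmeas g.
  apply: bmeasD; first apply: bmeasD => //.
    by apply: bmeasM => //; exact: bmeas_cst.
  by apply: bmeasM => //; exact: bmeas_cst.
apply: (@le_trans _ _ (\int[Lam]_o (expR (- k) * g o))).
  apply: bmeas_le_Rintegral.
  - apply: bmeasM => //; apply: bmeas_expR; apply: bmeasB; last exact: bmeas_cst.
    apply: bmeasM; first exact: bmeas_cst.
    by apply: bmeasB; [exact: bmeasM|exact: bmeas_cst].
  - by apply: bmeasM => //; exact: bmeas_cst.
  - move=> o; set x := psi t w o * h o / q t w o.
    have xle : `|lam * x| <= 2^-1.
      rewrite normrM (ger0_norm lam0); apply: le_trans lamb.
      rewrite -!mulrA ler_wpM2l// [C * _]mulrA /x !normrM normfV (ger0_norm (ltW (q0 o))).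
      apply: ler_pM.
      - by rewrite mulr_ge0.
      - by rewrite invr_ge0 ltW.
      - exact: ler_pM.
      - by rewrite lef_pV2 ?posrE.
    have -> : lam * (x - c) - 2 * lam ^+ 2 * C ^+ 2 * v / fl = lam * x - k.
      by rewrite /k; ring.
    rewrite expRD mulrCA mulrA mulrC ler_pM2l ?expR_gt0// mulrC.
    apply: (@le_trans _ _ (q t w o * (1 + lam * x + 2 * (lam * x) ^+ 2))).
      by rewrite ler_wpM2l ?(ltW (q0 o))// expR_le_quadratic.
    have -> : q t w o * (1 + lam * x + 2 * (lam * x) ^+ 2) =
      q t w o + lam * (psi t w o * h o) +
      2 * lam ^+ 2 * (psi t w o ^+ 2 / q t w o) * h o ^+ 2.
      by rewrite /x; field; rewrite gt_eqF.
    rewrite /g lerD2l ler_wpM2r ?sqr_ge0// -[leRHS]mulrA.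
    rewrite ler_wpM2l ?mulr_ge0 ?sqr_ge0//.
    rewrite ler_pM ?sqr_ge0 ?invr_ge0 ?(ltW (q0 o))//; last by rewrite lef_pV2 ?posrE.
    by rewrite -(real_normK (num_real _)) lerXn2r ?nnegrE// (C0 o).
rewrite bmeas_RintegralZl//.
have gk : \int[Lam]_o g o <= 1 + k.
  rewrite bmeas_RintegralD ?bmeas_RintegralD ?bmeas_RintegralZl//; last 3 first.
  - by apply: bmeasM => //; exact: bmeas_cst.
  - by apply: bmeasD => //; apply: bmeasM => //; exact: bmeas_cst.
  - by apply: bmeasM => //; exact: bmeas_cst.
  rewrite /k addrA lerD//; first by rewrite lerD2r.
  by rewrite [leRHS]mulrAC ler_wpM2l// divr_ge0 ?(ltW fl0)// -mulrA -exprMn mulr_ge0 ?sqr_ge0.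
rewrite expRN mulrC ler_pdivrMr ?expR_gt0// mul1r.
by rewrite (le_trans gk)// expR_ge1Dx.
Qed.

Lemma measurable_centered_summand t : (n < t)%N -> measurable_fun [set: G t.-1 * O]
  (fun z => psi t z.1 z.2 * h z.2 / q t z.1 z.2
    - \int[Lam]_o (psi t z.1 o * h o)).
Proof.
move=> nt; have mq := design_q dsg nt; have mp := mpsi nt.
have mh2 : measurable_fun [set: G t.-1 * O] (fun z => h z.2).
  exact: measurableT_comp mh measurable_snd.
apply: measurable_funB.
  apply: measurable_funM; first exact: measurable_funM.
  have bq : bmeas (fun z : G t.-1 * O => q t z.1 z.2).
    split=> //; exists 1 => z; case/andP: (design_floor dsg z.1 z.2 nt) => flq q1.
    by rewrite ger0_norm// (le_trans _ flq)// ltW// (design_floor_gt0 dsg).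
  have [] := bmeas_inv (design_floor_gt0 dsg) _ bq.
  - by move=> z; case/andP: (design_floor dsg z.1 z.2 nt).
  - by [].
apply: (@measurableT_comp _ _ _ _ _ _
  (fun w : G t.-1 => \int[Lam]_o (psi t w o * h o)) _ fst) => //.
apply: (measurable_Rintegral_section (Phi := fun w o => psi t w o * h o) (B := C * b)).
  exact: measurable_funM.
by move=> w o; rewrite normrM ler_pM.
Qed.

Lemma measurable_centered_sum t : measurable_fun setT (centered_sum psi h t).
Proof.
rewrite /centered_sum; apply: measurable_sum_nat => s /andP[ns _].
apply: (@measurable_of_history s).
apply: (@measurable_past s s (fun w o => psi s w o * h o / q s w o
  - \int[Lam]_o' (psi s w o' * h o'))); last exact: measurable_centered_summand.
by rewrite (leq_ltn_trans _ ns) /=.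
Qed.

(** Chernoff bound: on this event the exponential supermartingale is at least [e^x], while its
    expectation is at most 1. The sum has [t - n.+1] terms, each contributing one variance proxy. *)
Lemma centered_sum_tail (lam x : R) t : (n < t <= 2 * n)%N -> 0 <= lam ->
  lam * C * b / fl <= 2^-1 ->
  (P [set w | (x + 2 * lam ^+ 2 * C ^+ 2 * v / fl * (t - n.+1)%:R
              <= lam * centered_sum psi h t w)%R] <= (expR (- x))%:E)%E.
Proof.
move=> nt lam0 lamb.
set V := 2 * lam ^+ 2 * C ^+ 2 * v / fl.
pose e s w o := expR (lam * (psi s w o * h o / q s w o
    - \int[Lam]_o' (psi s w o' * h o')) - V).
have me s : (n < s)%N -> measurable_fun [set: G s.-1 * O] (fun z => e s z.1 z.2).
  move=> ns; apply: measurableT_comp => //; apply: measurable_funB => //.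
  by apply: measurable_funM => //; exact: measurable_centered_summand.
have /(_ _ nt) : forall t, (n < t <= 2 * n)%N ->
    (\int[P]_w (\prod_(n.+1 <= s < t) e s w (ob s w))%:E <= 1)%E.
  apply: le1_expectation_prod => //; first by move=> *; exact: expR_ge0.
  apply: filterS (design_mass dsg) => w wm s nsn; have /andP[ns _] := nsn.
  have := le1_conditional_expR ns lam0 lamb (wm s nsn).
  rewrite -lee_fin -Rintegral_EFin; last first.
    apply: bmeasM; first exact: bmeas_q.
    apply: bmeas_expR; apply: bmeasB; last exact: bmeas_cst.
    apply: bmeasM; first exact: bmeas_cst.
    apply: bmeasB; last exact: bmeas_cst.
    apply: bmeasM; last exact: bmeas_qV.
    by apply: bmeasM; [exact: bmeas_psi|exact: bmeas_h].
  by under eq_integral do rewrite EFinM.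
set S := [set w | _].
have mcs := measurable_centered_sum t.
have mS : measurable S.
  rewrite -[S]setTI; apply: measurable_fun_ler => //.
  by apply: measurable_funM.
have ME w : \prod_(n.+1 <= s < t) e s w (ob s w) =
    expR (lam * centered_sum psi h t w - V * (t - n.+1)%:R).
  rewrite /e -expR_sum; congr expR.
  by rewrite sumrB -mulr_sumr sumr_const_nat mulr_natr.
move=> EM.
have : ((expR x)%:E * P S <= 1)%E.
  apply: le_trans EM.
  rewrite (_ : P S = \int[P]_w (\1_S w)%:E)%E; last by rewrite integral_indic ?setIT.
  have mS1 : measurable_fun setT (fun w => (\1_S w : R)%:E).
    by apply/measurable_EFinP; exact: measurable_indic.
  rewrite -ge0_integralZl_EFin ?expR_ge0//.
  under [leRHS]eq_integral do rewrite ME.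
  apply: ge0_le_integral => //.
  - by apply: emeasurable_funM => //; exact: measurable_cst.
  - apply/measurable_EFinP; apply: measurableT_comp => //.
    by apply: measurable_funB => //; exact: measurable_funM.
  - move=> w _; rewrite -EFinM lee_fin indicE.
    have [|_] := boolP (w \in S); last by rewrite mulr0 expR_ge0.
    by rewrite inE /S/= -lerBrDr mulr1 ler_expR.
rewrite -(fineK (fin_num_measure P S mS)) -EFinM !lee_fin expRN => xS.
by rewrite -[_^-1]mul1r ler_pdivlMr ?expR_gt0// mulrC.
Qed.

End tail.
End supermartingale.

(** * Chaining along nested brackets *)

Section centered_sum_theory.
Context {R : realType} {dO d : measure_display}.
Context {Om : measurableType dO} {O : measurableType d}.
Variables (P : probability Om R) (Lam : {finite_measure set O -> \bar R}).
Variables (F : nat -> set_system Om) (ob : nat -> Om -> O).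
Variables (q : nat -> Om -> O -> R) (fl : R) (n : nat).
Hypothesis dsg : sequential_design P Lam F ob q fl n.
Variables (psi : nat -> Om -> O -> R) (C : R).
Hypothesis mpsi : forall t, (n < t)%N ->
  measurable_fun [set: g_sigma_algebraType (F t.-1) * O] (fun z => psi t z.1 z.2).
Hypothesis psiC : forall t w o, `|psi t w o| <= C.
Local Notation cs psi h t w := (centered_sum Lam ob q n psi h t w).

Lemma centered_sumD h1 h2 t w : bmeas h1 -> bmeas h2 ->
  cs psi (fun o => h1 o + h2 o) t w = cs psi h1 t w + cs psi h2 t w.
Proof.
move=> b1 b2; rewrite /centered_sum -big_split/=.
apply: eq_big_nat => s /andP[ns _]; have bp := bmeas_psi mpsi psiC w ns.
rewrite mulrDr mulrDl addrACA -opprD; congr (_ - _).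
rewrite -bmeas_RintegralD; [|exact: bmeasM|exact: bmeasM].
by apply: eq_Rintegral => o _; rewrite mulrDr.
Qed.

Lemma centered_sumN h t w : bmeas h ->
  cs (fun t w o => - psi t w o) h t w = - cs psi h t w :> R.
Proof.
move=> bh; rewrite /centered_sum -sumrN; apply: eq_big_nat => s /andP[ns _].
have bp := bmeas_psi mpsi psiC w ns.
under eq_Rintegral do rewrite mulNr.
by rewrite bmeas_RintegralN ?opprB ?opprK ?mulNr 1?addrC//; exact: bmeasM.
Qed.

(** Removes from a sum the dependence on an uncontrolled function: [r] will vary with the policy,
    [f] only with a bracket. A centered sum is not monotone in its argument, so both compensators
    are paid for, whence the factor 2. *)
Lemma centered_sum_dominated r f t w : bmeas r -> bmeas f ->
  (forall o, `|r o| <= f o) ->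
  `|cs psi r t w| <= cs (fun _ _ _ => C) f t w
     + 2 * C * \int[Lam]_o f o * (t - n.+1)%:R.
Proof.
move=> br bf rf.
rewrite mulr_natr -sumr_const_nat /centered_sum -big_split/=.
apply: (le_trans (ler_norm_sum _ _ _)); apply: ler_sum_nat => s /andP[ns _].
have fl0 := design_floor_gt0 dsg.
have q0 : 0 < q s w (ob s w).
  by case/andP: (design_floor dsg w (ob s w) ns) => + _; exact: lt_le_trans.
have bp := bmeas_psi mpsi psiC w ns.
have bpr := bmeasM bp br.
have C0 : 0 <= C := le_trans (normr_ge0 _) (psiC s w (ob s w)).
apply: (le_trans (ler_normB _ _)).
rewrite bmeas_RintegralZl// -addrA lerD//.
  rewrite !normrM normfV (ger0_norm (ltW q0)) ler_wpM2r ?invr_ge0 ?(ltW q0)//.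
  exact: ler_pM.
apply: (@le_trans _ _ (C * \int[Lam]_o f o)); last by rewrite le_eqVlt; apply/orP; left; apply/eqP; ring.
apply: (le_trans (bmeas_normr_Rintegral _ bpr)).
rewrite -bmeas_RintegralZl//; apply: bmeas_le_Rintegral.
- exact: bmeas_norm.
- by apply: bmeasM => //; exact: bmeas_cst.
- by move=> o; rewrite normrM ler_pM.
Qed.

End centered_sum_theory.

Section chain.
Context {R : realType} {d : measure_display} {O : measurableType d}.
Variables (N : nat -> nat) (lo up : nat -> nat -> O -> R).
Variables (theta : R -> R) (L B : R) (tau : nat -> R).

(** An index records the brackets chosen at levels 1 to [k], so that [i.1] is its parent and
    brackets can be nested along the path. The cardinality is the product of the bracketing numbers,
    whose logarithm is of the order of that of the last level. *)
Fixpoint chain_index (k : nat) : finType :=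
  if k is k'.+1 then (chain_index k' * 'I_(N k))%type else unit.

Definition clamp (l u x : R) := Num.min (Num.max l x) u.

(* The lower and upper brackets at level k, nested by clamping, and the
   indicator of the points where all their widths are below the thresholds. *)
Fixpoint chain_state (k : nat) : chain_index k -> O -> R * R * R :=
  match k with
  | 0 => fun _ _ => (0, 1, 1)
  | k'.+1 => fun i o =>
      let: (l, u, A) := chain_state i.1 o in
      let l' := clamp l u (lo k'.+1 i.2 o) in
      let u' := clamp l u (up k'.+1 i.2 o) in
      (l', u', if u' - l' <= tau k'.+1 then A else 0)
  end.

Definition chain_lo k (i : chain_index k) o := (chain_state i o).1.1.
Definition chain_up k (i : chain_index k) o := (chain_state i o).1.2.
Definition chain_ind k (i : chain_index k) o := (chain_state i o).2.

(** Envelope, on the points still retained, of [theta (g o) - theta (chain_lo i o)] over all [g]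
    inside the bracket: the minimum of the bound from the range of [theta] and the Lipschitz
    bound. *)
Definition chain_dom k (i : chain_index k) o :=
  Num.min (2 * B) (L * (chain_up i o - chain_lo i o)) * chain_ind i o.

Definition chain_inc k : chain_index k -> O -> R :=
  match k with
  | 0 => fun _ _ => theta 0
  | k'.+1 => fun i o => (theta (chain_lo (k := k'.+1) i o) - theta (chain_lo i.1 o))
                        * chain_ind i.1 o
  end.

(** Supported on the points dropped exactly at this level: retained by the parent, but with a new
    width above the threshold. There the chain stops and the remaining error is replaced by its
    envelope. *)
Definition chain_rem k : chain_index k -> O -> R :=
  match k with
  | 0 => fun _ _ => 0
  | k'.+1 => fun i o =>
      if chain_up (k := k'.+1) i o - chain_lo (k := k'.+1) i o <= tau k'.+1 then 0 else
      Num.min (2 * B) (L * (chain_up (k := k'.+1) i o - chain_lo (k := k'.+1) i o))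
      * chain_ind i.1 o
  end.

Hypothesis lo_up : forall k i o, [/\ 0 <= lo k i o, lo k i o <= up k i o & up k i o <= 1].
Hypothesis mlo : forall k i, measurable_fun setT (lo k i).
Hypothesis mup : forall k i, measurable_fun setT (up k i).
Hypotheses (L0 : 0 <= L) (B0 : 0 <= B).
Hypothesis mtheta : measurable_fun setT theta.
Hypothesis thetaL : forall u v, `|theta u - theta v| <= L * `|u - v|.
Hypothesis thetaB : forall u, `|theta u| <= B.
Hypothesis tau0 : forall k, 0 < tau k.

Lemma clamp_itv l u x : l <= u -> l <= clamp l u x <= u.
Proof. by move=> lu; rewrite /clamp le_min ge_min le_max lexx lu lexx orbT. Qed.

Lemma le_clamp l u : {homo clamp l u : x y / x <= y}.
Proof.
move=> x y xy; rewrite /clamp le_min ge_min ge_min lexx orbT andbT.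
by apply/orP; left; rewrite ge_max !le_max lexx xy orbT.
Qed.

Lemma clamp_lipschitz l u x y : x <= y -> clamp l u y - clamp l u x <= y - x.
Proof. by move=> xy; rewrite /clamp !minEle !maxEle; repeat case: ifP; lra. Qed.

Lemma chain_stateS k (i : chain_index k.+1) o :
  [/\ chain_lo i o = clamp (chain_lo i.1 o) (chain_up i.1 o) (lo k.+1 i.2 o),
      chain_up i o = clamp (chain_lo i.1 o) (chain_up i.1 o) (up k.+1 i.2 o) &
      chain_ind i o = if chain_up i o - chain_lo i o <= tau k.+1
                      then chain_ind i.1 o else 0].
Proof.
rewrite /chain_lo /chain_up /chain_ind /=.
by case: (chain_state i.1 o) => [[l u] A].
Qed.

Lemma chain_stateP k (i : chain_index k) o :
  [/\ 0 <= chain_lo i o, chain_lo i o <= chain_up i o, chain_up i o <= 1 &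
      chain_ind i o = 0 \/ chain_ind i o = 1].
Proof.
elim: k i => [[]|k IH i]; first by split; rewrite // /chain_lo ?lexx//; right.
have [l0 lu u1 A01] := IH i.1; have [-> -> ->] := chain_stateS i o.
have [a b c] := lo_up k.+1 i.2 o.
have /andP[h1 h2] := clamp_itv (lo k.+1 i.2 o) lu.
have /andP[h3 h4] := clamp_itv (up k.+1 i.2 o) lu.
split; [exact: le_trans h1|exact: le_clamp|exact: le_trans u1|].
by case: ifP => _; [exact: A01|left].
Qed.

Lemma chain_nested k (i : chain_index k.+1) o :
  chain_lo i.1 o <= chain_lo i o /\ chain_up i o <= chain_up i.1 o.
Proof.
have [_ lu _ _] := chain_stateP i.1 o; have [-> -> _] := chain_stateS i o.
have /andP[h1 h2] := clamp_itv (lo k.+1 i.2 o) lu.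
by have /andP[h3 h4] := clamp_itv (up k.+1 i.2 o) lu.
Qed.

Lemma chain_width k (i : chain_index k.+1) o :
  chain_up i o - chain_lo i o <= up k.+1 i.2 o - lo k.+1 i.2 o.
Proof.
have [-> -> _] := chain_stateS i o; apply: clamp_lipschitz.
by have [] := lo_up k.+1 i.2 o.
Qed.

Lemma bmeas_chain_state k (i : chain_index k) :
  [/\ bmeas (chain_lo i), bmeas (chain_up i) & bmeas (chain_ind i)].
Proof.
have fin (f : O -> R) : (forall o, 0 <= f o <= 1) -> measurable_fun setT f -> bmeas f.
  by move=> f01 mf; split=> //; exists 1 => o; case/andP: (f01 o) => f0 f1; rewrite ger0_norm.
elim: k i => [[]|k IH i]; first by split; exact: bmeas_cst.
have [[ml _] [mu _] [mA _]] := IH i.1.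
have mcl f : measurable_fun setT f ->
    measurable_fun setT (fun o => clamp (chain_lo i.1 o) (chain_up i.1 o) (f o)).
  by move=> mf; apply: measurable_minr => //; exact: measurable_maxr.
have ml' : measurable_fun setT (chain_lo i).
  rewrite (_ : chain_lo i = (fun o => clamp (chain_lo i.1 o) (chain_up i.1 o)
    (lo k.+1 i.2 o))); first exact: mcl.
  by apply/funext => o; have [] := chain_stateS i o.
have mu' : measurable_fun setT (chain_up i).
  rewrite (_ : chain_up i = (fun o => clamp (chain_lo i.1 o) (chain_up i.1 o)
    (up k.+1 i.2 o))); first exact: mcl.
  by apply/funext => o; have [] := chain_stateS i o.
split; apply: fin => //.
- by move=> o; have [l0 lu u1 _] := chain_stateP i o; rewrite l0 (le_trans lu).
- by move=> o; have [l0 lu u1 _] := chain_stateP i o; rewrite u1 (le_trans l0).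
- by move=> o; have [_ _ _ [->|->]] := chain_stateP i o; rewrite ?lexx ?ler01.
- rewrite (_ : chain_ind i = (fun o => if chain_up i o - chain_lo i o <= tau k.+1
    then chain_ind i.1 o else 0)); last first.
    by apply/funext => o; have [] := chain_stateS i o.
  apply: measurable_fun_ifT => //.
  by apply: measurable_fun_ler => //; exact: measurable_funB.
Qed.

Lemma chain_dom_ge0 k (i : chain_index k) o : 0 <= chain_dom i o.
Proof.
have [_ lu _ A] := chain_stateP i o; apply: mulr_ge0.
  by rewrite le_min !mulr_ge0// subr_ge0.
by case: A => ->.
Qed.

Lemma bmeas_chain_dom k (i : chain_index k) : bmeas (chain_dom i).
Proof.
have [bl bu bA] := bmeas_chain_state i.
apply: bmeasM => //; apply: bmeas_min; first exact: bmeas_cst.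
by apply: bmeasM; [exact: bmeas_cst|exact: bmeasB].
Qed.

Lemma bmeas_theta (f : O -> R) : measurable_fun setT f -> bmeas (fun o => theta (f o)).
Proof.
by move=> mf; split; [exact: measurableT_comp|exists B => o; exact: thetaB].
Qed.

Lemma bmeas_chain_inc k (i : chain_index k) : bmeas (chain_inc i).
Proof.
case: k i => [|k] i; first exact: bmeas_cst.
have [[ml _] _ _] := bmeas_chain_state i.
have [[ml' _] _ bA] := bmeas_chain_state i.1.
by apply: bmeasM => //; apply: bmeasB; exact: bmeas_theta.
Qed.

Lemma bmeas_chain_rem k (i : chain_index k) : bmeas (chain_rem i).
Proof.
case: k i => [|k] i; first exact: bmeas_cst.
have [bl bu _] := bmeas_chain_state i.
have [_ _ bA] := bmeas_chain_state i.1.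
have bD : bmeas (fun o => Num.min (2 * B) (L * (chain_up i o - chain_lo i o))
    * chain_ind i.1 o).
  apply: bmeasM => //; apply: bmeas_min; first exact: bmeas_cst.
  by apply: bmeasM; [exact: bmeas_cst|exact: bmeasB].
split.
  apply: measurable_fun_ifT; last by case: bD.
  - by apply: measurable_fun_ler => //; case: (bmeasB bu bl).
  - exact: measurable_cst.
case: bD => _ [c cb]; exists c => o; rewrite /chain_rem.
case: ifP => _; last exact: cb.
by rewrite normr0 (le_trans _ (cb o)).
Qed.

Lemma chain_rem_ge0 k (i : chain_index k) o : 0 <= chain_rem i o.
Proof.
case: k i => [|k] i //=; case: ifP => // _.
have [_ lu _ _] := chain_stateP i o; have [_ _ _ A] := chain_stateP i.1 o.
apply: mulr_ge0; last by case: A => ->.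
by rewrite le_min !mulr_ge0// subr_ge0.
Qed.

(** Both lower brackets lie in the parent bracket, so their distance is at most the parent width. *)
Lemma chain_inc_le k (i : chain_index k.+1) o : `|chain_inc i o| <= chain_dom i.1 o.
Proof.
have [_ lu _ A] := chain_stateP i.1 o; have [ll uu] := chain_nested i o.
have [_ lu' _ _] := chain_stateP i o.
have A0 : 0 <= chain_ind i.1 o by case: A => ->.
rewrite /= normrM (ger0_norm A0) ler_wpM2r// le_min; apply/andP; split.
  by rewrite (le_trans (ler_normB _ _))// mulr_natl lerD.
rewrite (le_trans (thetaL _ _))// ler_wpM2l// ger0_norm ?subr_ge0//.
by rewrite lerD2r (le_trans lu').
Qed.

Lemma chain_rem_le k (i : chain_index k.+1) o : chain_rem i o <= chain_dom i.1 o.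
Proof.
rewrite /=; case: ifP => _; first exact: chain_dom_ge0.
have [_ _ _ A] := chain_stateP i.1 o; have [ll uu] := chain_nested i o.
rewrite ler_wpM2r//; first by case: A => ->.
by rewrite le_min !ge_min lexx/= ler_wpM2l ?orbT// lerB.
Qed.

Lemma chain_dom_le k (i : chain_index k.+1) o : chain_dom i o <= chain_dom i.1 o.
Proof.
have [_ _ _ A] := chain_stateP i.1 o; have [ll uu] := chain_nested i o.
have [_ lu' _ _] := chain_stateP i o.
have [_ _ Ai] := chain_stateS i o; rewrite /chain_dom; apply: ler_pM.
- by rewrite le_min !mulr_ge0// subr_ge0.
- by have [_ _ _ [->|->]] := chain_stateP i o.
- by rewrite le_min !ge_min lexx/= ler_wpM2l ?orbT// lerB.
- by rewrite Ai; case: ifP => // _; case: A => ->.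
Qed.

Lemma chain_dom_le2B k (i : chain_index k) o : chain_dom i o <= 2 * B.
Proof.
have [_ lu _ A] := chain_stateP i o.
rewrite /chain_dom -[leRHS]mulr1 ler_pM//.
- by rewrite le_min !mulr_ge0// subr_ge0.
- by case: A => ->.
- by rewrite ge_min lexx.
- by case: A => ->.
Qed.

Lemma chain_dom_le_tau k (i : chain_index k.+1) o : chain_dom i o <= L * tau k.+1.
Proof.
rewrite /chain_dom; have [_ _ ->] := chain_stateS i o.
case: ifP => [le_tau|_]; last by rewrite mulr0 mulr_ge0// ltW.
have [_ lu _ _] := chain_stateP i o; have [_ _ _ A] := chain_stateP i.1 o.
rewrite -[leRHS]mulr1 ler_pM//.
- by rewrite le_min !mulr_ge0// subr_ge0.
- by case: A => ->.
- by rewrite ge_min ler_wpM2l ?orbT.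
- by case: A => ->.
Qed.

Lemma chain_dom_le_width k (i : chain_index k.+1) o :
  chain_dom i o <= L * (up k.+1 i.2 o - lo k.+1 i.2 o).
Proof.
have [_ lu _ A] := chain_stateP i o.
rewrite /chain_dom -[leRHS]mulr1 ler_pM//.
- by rewrite le_min !mulr_ge0// subr_ge0.
- by case: A => ->.
- by rewrite ge_min ler_wpM2l ?orbT// chain_width.
- by case: A => ->.
Qed.

(** Chebyshev: where a width [D] exceeds [tau], one has [D <= D ^+ 2 / tau]. A large threshold thus
    makes the integral of the remainder small, at the expense of the sup norm of the retained
    part. *)
Lemma chain_rem_le_sqr k (i : chain_index k.+1) o :
  chain_rem i o <= L / tau k.+1 * (up k.+1 i.2 o - lo k.+1 i.2 o) ^+ 2.
Proof.
rewrite /=; case: ifPn => [_|].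
  by rewrite mulr_ge0 ?sqr_ge0// divr_ge0// ltW.
rewrite -ltNge => tau_lt.
have [_ lu _ _] := chain_stateP i o; have [_ _ _ A] := chain_stateP i.1 o.
set D := chain_up i o - chain_lo i o in tau_lt *.
have D0 : 0 <= D by rewrite subr_ge0.
apply: (@le_trans _ _ (L * D)).
  rewrite -[leRHS]mulr1 ler_pM//.
  - by rewrite le_min !mulr_ge0.
  - by case: A => ->.
  - by rewrite ge_min lexx orbT.
  - by case: A => ->.
rewrite -mulrA ler_wpM2l// ler_pdivlMl//.
apply: (@le_trans _ _ (D * D)); first by rewrite ler_wpM2r// ltW.
by rewrite ler_pM// chain_width.
Qed.

End chain.

Lemma measure_bigsetU_le {R : realType} d (T : measurableType d)
    (mu : {measure set T -> \bar R}) (I : Type) (r : seq I) (A : I -> set T) :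
  (forall i, measurable (A i)) ->
  measurable (\big[setU/set0]_(i <- r) A i) /\
  (mu (\big[setU/set0]_(i <- r) A i) <= \sum_(i <- r) mu (A i))%E.
Proof.
move=> mA; elim: r => [|i r [mU IH]].
  by rewrite !big_nil measure0; split.
rewrite !big_cons; split; first exact: measurableU.
by apply: le_trans (measureU2 _ _ _) _ => //; rewrite leeD2l.
Qed.

(** Turns an L2 bound into an L1 bound: if the squares integrate to at most [e ^+ 2], this choice of
    [e] bounds the integral of [y] by [e] times one plus the total mass. *)
Lemma le_scaled_sqr (R : realType) (e y : R) : 0 < e -> y <= e + e^-1 * y ^+ 2.
Proof.
move=> e0; rewrite -(ler_pM2l e0) mulrDr mulrA divff ?gt_eqF// mul1r; nra.
Qed.

(** Bookkeeping of one link: the increment and the dominating remainder cost one [w1] each, the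
    compensators of the remainder cost one [w2]. *)
Lemma lin_step (R : realType) (x y na nbc nb nc c1 c2 w1 w2 cr ci : R) :
  x <= c1 * w1 + c2 * w2 + y -> y <= na + nbc -> nbc <= nb + nc ->
  nb <= w1 -> nc <= cr + ci -> cr <= w1 -> ci <= w2 ->
  x <= (c1 + 2) * w1 + (c2 + 1) * w2 + na.
Proof. by rewrite !mulrDl; lra. Qed.

Lemma lin_last (R : realType) (x c1 c2 w1 w2 cr ci : R) :
  x <= cr + ci -> cr <= w1 -> ci <= w2 ->
  c1 * w1 + c2 * w2 + x <= (c1 + 1) * w1 + (c2 + 1) * w2.
Proof. by rewrite !mulrDl; lra. Qed.

Section chain_bound.
Context {R : realType} {dO d : measure_display}.
Context {Om : measurableType dO} {O : measurableType d}.
Variables (P : probability Om R) (Lam : {finite_measure set O -> \bar R}).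
Variables (F : nat -> set_system Om) (ob : nat -> Om -> O).
Variables (q : nat -> Om -> O -> R) (fl : R) (n : nat).
Hypothesis dsg : sequential_design P Lam F ob q fl n.
Variables (psi : nat -> Om -> O -> R) (C : R).
Hypothesis mpsi : forall t, (n < t)%N ->
  measurable_fun [set: g_sigma_algebraType (F t.-1) * O] (fun z => psi t z.1 z.2).
Hypothesis psiC : forall t w o, `|psi t w o| <= C.
Local Notation cs psi h t w := (centered_sum Lam ob q n psi h t w).
Variables (N : nat -> nat) (lo up : nat -> nat -> O -> R).
Variables (theta : R -> R) (L B : R) (tau : nat -> R).
Hypothesis lo_up : forall k i o, [/\ 0 <= lo k i o, lo k i o <= up k i o & up k i o <= 1].
Hypothesis mlo : forall k i, measurable_fun setT (lo k i).
Hypothesis mup : forall k i, measurable_fun setT (up k i).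
Hypotheses (L0 : 0 <= L) (B0 : 0 <= B).
Hypothesis mtheta : measurable_fun setT theta.
Hypothesis thetaL : forall u v, `|theta u - theta v| <= L * `|u - v|.
Hypothesis thetaB : forall u, `|theta u| <= B.
Hypothesis tau0 : forall k, 0 < tau k.
Local Notation cidx k := (chain_index N k).
Local Notation inc i := (chain_inc lo up theta tau i).
Local Notation rem i := (chain_rem lo up L B tau i).
Local Notation dom i := (chain_dom lo up L B tau i).

(** Deterministic part of chaining. The level-0 constant [theta 0] costs [W], each of the [K] links
    costs [2 W + W'], and the envelope that closes the chain costs [W + W']. *)
Lemma chain_decomposition (K : nat) (W W' : R) (g : O -> R) (t : nat) w :
  (forall k (i : cidx k), (k <= K)%N ->
     [/\ `|cs psi (inc i) t w| <= W,
         cs (fun _ _ _ => C) (rem i) t w <= W,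
         cs (fun _ _ _ => C) (dom i) t w <= W &
         2 * C * \int[Lam]_o rem i o * (t - n.+1)%:R <= W']) ->
  (forall i : cidx K, 2 * C * \int[Lam]_o dom i o * (t - n.+1)%:R <= W') ->
  measurable_fun setT g -> (forall o, 0 <= g o <= 1) ->
  (forall k, exists i : 'I_(N k), forall o, lo k i o <= g o <= up k i o) ->
  `|cs psi (fun o => theta (g o)) t w| <= (2 * K + 2)%:R * W + K.+1%:R * W'.
Proof.
move=> good goodK mg g01 gbr.
pose T k (i : cidx k) o := (theta (g o) - theta (chain_lo lo up tau i o))
  * chain_ind lo up tau i o.
have bth := bmeas_theta mtheta thetaB mg.
have bT k (i : cidx k) : bmeas (T k i).
  have [[ml _] _ bA] := bmeas_chain_state tau lo_up mlo mup i.
  by apply: bmeasM => //; apply: bmeasB => //; exact: (bmeas_theta mtheta thetaB ml).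
have step k : (k <= K)%N -> exists i : cidx k,
    (forall o, chain_lo lo up tau i o <= g o <= chain_up lo up tau i o) /\
    `|cs psi (fun o => theta (g o)) t w| <=
      (2 * k + 1)%:R * W + k%:R * W' + `|cs psi (T k i) t w|.
  elim: k => [_|k IH kK].
    exists tt; split => //.
    have -> : (fun o => theta (g o)) = (fun o => theta 0 + T 0 tt o).
      by apply/funext => o; rewrite /T /chain_lo /chain_ind/= mulr1 addrC subrK.
    rewrite (centered_sumD Lam ob q mpsi psiC)//; last exact: bmeas_cst.
    rewrite mul0r addr0 mul1r (le_trans (ler_normD _ _))// lerD2r.
    by have [] := good 0%N tt (leq0n _).
  have [i [ig IHi]] := IH (ltnW kK).
  have [j jg] := gbr k.+1.
  pose i' : cidx k.+1 := (i, j); exists i'.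
  have ig' o : chain_lo lo up tau i' o <= g o <= chain_up lo up tau i' o.
    have [-> -> _] := chain_stateS lo up tau i' o; rewrite /=.
    case/andP: (ig o) => l1 u1; case/andP: (jg o) => l2 u2.
    rewrite /clamp le_min ge_min ge_max l1 l2 u1 /= andbT.
    by rewrite le_max u2 orbT.
  split => //.
  have [g1 g2 g3 g4] := good _ i' kK.
  (* This part still depends on [g] and so belongs to no finite family; it is bounded through the
     remainder, which depends on the bracket only. *)
  pose r o := if chain_up lo up tau i' o - chain_lo lo up tau i' o <= tau k.+1 then 0
    else (theta (g o) - theta (chain_lo lo up tau i' o)) * chain_ind lo up tau i o.
  have TE : T k i = (fun o => T k.+1 i' o + (inc i' o + r o)).
    apply/funext => o; rewrite /T /r /=.
    have [_ _ ->] := chain_stateS lo up tau i' o; rewrite /=.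
    by case: ifP => _; ring.
  have binc : bmeas (inc i') by exact: (bmeas_chain_inc tau lo_up mlo mup mtheta thetaB i').
  have brem : bmeas (rem i') by exact: (bmeas_chain_rem L B tau lo_up mlo mup i').
  have br : bmeas r.
    have -> : r = (fun o => T k i o - (T k.+1 i' o + inc i' o)).
      by apply/funext => o; rewrite TE; ring.
    by apply: bmeasB => //; exact: bmeasD.
  have rle o : `|r o| <= rem i' o.
    rewrite /r /=; case: ifP => _; first by rewrite normr0.
    have [_ _ _ A] := chain_stateP tau lo_up i o.
    have A0 : 0 <= chain_ind lo up tau i o by case: A => ->.
    rewrite normrM (ger0_norm A0) ler_wpM2r// le_min; apply/andP; split.
      by rewrite (le_trans (ler_normB _ _))// mulr_natl lerD.
    case/andP: (ig' o) => l1 u1.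
    rewrite (le_trans (thetaL _ _))// ler_wpM2l// ger0_norm ?subr_ge0//.
    by rewrite lerD2r.
  have := centered_sum_dominated dsg mpsi psiC t w br brem rle.
  move: IHi; rewrite TE (centered_sumD Lam ob q mpsi psiC)//; last exact: bmeasD.
  rewrite (centered_sumD Lam ob q mpsi psiC)//.
  set a := cs psi (T k.+1 i') t w; set b := cs psi (inc i') t w.
  set c := cs psi r t w => IHi cle.
  have n1 := ler_normD a (b + c); have n2 := ler_normD b c.
  have -> : (2 * k.+1 + 1)%:R = (2 * k + 1)%:R + 2 :> R.
    by rewrite !natrD !natrM -natr1; ring.
  have -> : k.+1%:R = k%:R + 1 :> R by rewrite -natr1.
  exact: lin_step IHi n1 n2 g1 cle g2 g4.
have [i [ig]] := step K (leqnn K); move/le_trans; apply.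
have bdom : bmeas (dom i) by exact: (bmeas_chain_dom L B tau lo_up mlo mup i).
have Tle o : `|T K i o| <= dom i o.
  have [_ _ _ A] := chain_stateP tau lo_up i o.
  have A0 : 0 <= chain_ind lo up tau i o by case: A => ->.
  rewrite normrM (ger0_norm A0) ler_wpM2r// le_min; apply/andP; split.
    by rewrite (le_trans (ler_normB _ _))// mulr_natl lerD.
  case/andP: (ig o) => l1 u1.
  rewrite (le_trans (thetaL _ _))// ler_wpM2l// ger0_norm ?subr_ge0//.
  by rewrite lerD2r.
have := centered_sum_dominated dsg mpsi psiC t w (bT K i) bdom Tle.
have [_ _ g3 _] := good _ i (leqnn K); have g4 := goodK i => le1.
have -> : (2 * K + 2)%:R = (2 * K + 1)%:R + 1 :> R.
  by rewrite !natrD; ring.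
have -> : K.+1%:R = K%:R + 1 :> R by rewrite -natr1.
exact: lin_last le1 g3 g4.
Qed.

Variables (K : nat) (eps bd vd lam x : nat -> R) (W W' : R).
Hypothesis heps : forall k i, \int[Lam]_o ((up k i o - lo k i o) ^+ 2) <= eps k ^+ 2.
Hypothesis eps0 : forall k, 0 < eps k.
(** At coarse levels the range of [theta] gives the better bounds. At fine levels the threshold of
    the parent controls the sup norm and its bracket width the second moment; the parent level
    [k'.+1] must be positive, as level 0 has neither. *)
Hypothesis regime : forall k, (k <= K)%N ->
  (2 * B <= bd k /\ 4 * B ^+ 2 * fine (Lam setT) <= vd k) \/
  (exists2 k', k = k'.+2 &
     L * tau k'.+1 <= bd k /\ L ^+ 2 * eps k'.+1 ^+ 2 <= vd k).
Hypothesis hlam : forall k, (k <= K)%N -> [/\ 0 < lam k,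
  lam k * C * bd k / fl <= 2^-1 &
  x k + 2 * lam k ^+ 2 * C ^+ 2 * vd k / fl * n%:R <= lam k * W].
Hypothesis C0 : 0 <= C.
Hypothesis W'0 : 0 <= W'.
Hypothesis bias_rem : forall k, (k < K)%N ->
  2 * C * (L / tau k.+1 * eps k.+1 ^+ 2) * n%:R <= W'.
Hypothesis K0 : (0 < K)%N.
Hypothesis bias_dom : 2 * C * (L * eps K * (fine (Lam setT) + 1)) * n%:R <= W'.

Let bwidth k i : bmeas (fun o => up k i o - lo k i o).
Proof.
split; first exact: measurable_funB.
exists 1 => o; have [a b c] := lo_up k i o.
by rewrite ger0_norm ?subr_ge0// lerBlDl (le_trans c)// lerDr.
Qed.

Let bwidth2 k i : bmeas (fun o => (up k i o - lo k i o) ^+ 2).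
Proof. exact: bmeasX. Qed.

(** Increment, remainder and envelope are all dominated by the envelope of the parent, so one sup
    bound and one second moment bound per level serve all three. *)
Let level_bounds k (f : O -> R) : (k <= K)%N -> bmeas f ->
  (k = 0%N -> forall o, `|f o| <= 2 * B) ->
  (forall k', k = k'.+1 -> exists i : cidx k', forall o, `|f o| <= dom i o) ->
  (forall o, `|f o| <= bd k) /\ \int[Lam]_o (f o ^+ 2) <= vd k.
Proof.
move=> kK bf f0 fS.
have [[b1 v1]|[k' kk' [b1 v1]]] := regime kK.
  have f2B o : `|f o| <= 2 * B.
    case: k kK f0 fS {b1 v1} => [_ /(_ erefl)//|k _ _ /(_ _ erefl) [i fi]].
    by rewrite (le_trans (fi o))// (chain_dom_le2B _ lo_up L0 B0).
  split; first by move=> o; rewrite (le_trans (f2B o)).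
  apply: le_trans v1; rewrite -Rintegral_cst//.
  apply: bmeas_le_Rintegral; [exact: bmeasX|exact: bmeas_cst|move=> o].
  have -> : 4 * B ^+ 2 = (2 * B) ^+ 2 by rewrite exprMn; congr (_ * _); rewrite -natrX.
  by rewrite -(real_normK (num_real (f o))) lerXn2r ?nnegrE ?mulr_ge0.
have [i fi] := fS _ kk'; split.
  by move=> o; rewrite (le_trans (fi o))// (le_trans _ b1)// (chain_dom_le_tau lo_up).
apply: le_trans v1; apply: (@le_trans _ _
    (L ^+ 2 * \int[Lam]_o ((up k'.+1 i.2 o - lo k'.+1 i.2 o) ^+ 2))); last first.
  by rewrite ler_wpM2l ?sqr_ge0.
rewrite -bmeas_RintegralZl//; apply: bmeas_le_Rintegral; first exact: bmeasX.
  by apply: bmeasM => //; exact: bmeas_cst.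
move=> o; rewrite -exprMn -(real_normK (num_real (f o))) lerXn2r ?nnegrE//.
  by have [_ a _] := lo_up k'.+1 i.2 o; rewrite mulr_ge0// subr_ge0.
by rewrite (le_trans (fi o))// (chain_dom_le_width tau lo_up L0 B0).
Qed.

Let tail (psi' : nat -> Om -> O -> R) k (f : O -> R) t : (k <= K)%N -> (n < t <= 2 * n)%N ->
  (forall t, (n < t)%N -> measurable_fun
     [set: g_sigma_algebraType (F t.-1) * O] (fun z => psi' t z.1 z.2)) ->
  (forall t w o, `|psi' t w o| <= C) ->
  bmeas f -> (forall o, `|f o| <= bd k) -> \int[Lam]_o (f o ^+ 2) <= vd k ->
  measurable [set w | W <= cs psi' f t w] /\
  (P [set w | (W <= cs psi' f t w)%R] <= (expR (- x k))%:E)%E.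
Proof.
move=> kK /andP[nt tn] mp pC bf fb fv; have [l0 l1 l2] := hlam kK.
have mcs := measurable_centered_sum dsg mp pC bf.1 fb t.
have mS : measurable [set w | W <= cs psi' f t w].
  by rewrite -[X in measurable X]setTI; exact: measurable_fun_ler.
split=> //.
have ntn : (n < t <= 2 * n)%N by rewrite nt.
have := centered_sum_tail dsg mp pC bf.1 fb fv (x k) ntn (ltW l0) l1.
apply: le_trans; apply: le_measure; rewrite ?inE//.
  rewrite -[X in measurable X]setTI; apply: measurable_fun_ler => //.
  exact: measurable_funM.
move=> w /= Ww; apply: le_trans (_ : _ <= lam k * W) _; last by rewrite ler_pM2l.
apply: le_trans l2; rewrite lerD2l ler_wpM2l//; last first.
  by rewrite ler_nat leq_subLR (leq_trans tn)// mul2n -addnn leq_add2r.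
have v0 : 0 <= vd k.
  by apply: le_trans fv; apply: Rintegral_ge0 => o _; rewrite sqr_ge0.
rewrite divr_ge0 ?(ltW (design_floor_gt0 dsg))// mulr_ge0//.
by rewrite -mulrA -exprMn mulr_ge0 ?sqr_ge0.
Qed.

Let mpsiN t : (n < t)%N -> measurable_fun
  [set: g_sigma_algebraType (F t.-1) * O] (fun z => - psi t z.1 z.2).
Proof. by move=> nt; exact: measurableT_comp (mpsi nt). Qed.

Let mC t : (n < t)%N -> measurable_fun
  [set: g_sigma_algebraType (F t.-1) * O] (fun _ => C).
Proof. by move=> _; exact: measurable_cst. Qed.

(** Increments need both signs, obtained by replacing [psi] with its negative; remainders and
    envelopes occur with the constant [C] in place of [psi] and are needed from above only. *)
Let bad k (i : cidx k) t : set Om :=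
  ([set w | W <= cs psi (inc i) t w] `|`
   [set w | W <= cs (fun t w o => - psi t w o) (inc i) t w]) `|`
  ([set w | W <= cs (fun _ _ _ => C) (rem i) t w] `|`
   [set w | W <= cs (fun _ _ _ => C) (dom i) t w]).

Let bad_le k (i : cidx k) t : (k <= K)%N -> (n < t <= 2 * n)%N ->
  measurable (bad i t) /\ (P (bad i t) <= (4 * expR (- x k))%:E)%E.
Proof.
move=> kK nt.
have binc := bmeas_chain_inc tau lo_up mlo mup mtheta thetaB i.
have brem := bmeas_chain_rem L B tau lo_up mlo mup i.
have bdom := bmeas_chain_dom L B tau lo_up mlo mup i.
have psiNC t' w o : `|- psi t' w o| <= C by rewrite normrN.
have CC (t' : nat) (w : Om) (o : O) : `|C| <= C by rewrite ger0_norm.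
have [i1 i2] : (forall o, `|inc i o| <= bd k) /\ \int[Lam]_o (inc i o ^+ 2) <= vd k.
  apply: level_bounds => //.
    by move=> k0; subst k => o /=; rewrite (le_trans (thetaB 0))// mulr_natl lerDr.
  move=> k' kk'; subst k; exists i.1 => o.
  exact: (chain_inc_le tau lo_up L0 thetaL thetaB).
have [r1 r2] : (forall o, `|rem i o| <= bd k) /\ \int[Lam]_o (rem i o ^+ 2) <= vd k.
  apply: level_bounds => //.
    by move=> k0; subst k => o /=; rewrite normr0 mulr_ge0.
  move=> k' kk'; subst k; exists i.1 => o.
  rewrite ger0_norm ?(chain_rem_ge0 tau lo_up L0 B0)//.
  exact: (chain_rem_le tau lo_up L0 B0).
have [d1 d2] : (forall o, `|dom i o| <= bd k) /\ \int[Lam]_o (dom i o ^+ 2) <= vd k.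
  apply: level_bounds => //.
    move=> k0; subst k => o; rewrite ger0_norm ?(chain_dom_ge0 tau lo_up L0 B0)//.
    exact: (chain_dom_le2B tau lo_up L0 B0).
  move=> k' kk'; subst k; exists i.1 => o.
  rewrite ger0_norm ?(chain_dom_ge0 tau lo_up L0 B0)//.
  exact: (chain_dom_le tau lo_up L0 B0).
have [m1 t1] := tail kK nt mpsi psiC binc i1 i2.
have [m2 t2] := tail kK nt mpsiN psiNC binc i1 i2.
have [m3 t3] := tail kK nt mC CC brem r1 r2.
have [m4 t4] := tail kK nt mC CC bdom d1 d2.
split; first by apply: measurableU; exact: measurableU.
have -> : 4 * expR (- x k) = (expR (- x k) + expR (- x k)) + (expR (- x k) + expR (- x k)).
  by ring.
rewrite !EFinD; apply: le_trans (measureU2 _ _ _) _.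
- exact: measurableU.
- exact: measurableU.
by apply: leeD; (apply: le_trans (measureU2 _ _ _) _; [by []|by []|exact: leeD]).
Qed.

(** A union bound over levels, indices and the [n] values of [t], with four events each. The
    function [g] is quantified after the trajectory, so it may depend on the data; the bad event
    involves finitely many fixed functions. *)
Lemma chain_uniform : exists2 Bad : set Om, measurable Bad /\
  (P Bad <= (\sum_(k < K.+1) #|cidx k|%:R * (n%:R * (4 * expR (- x k))))%:E)%E &
  forall w, ~ Bad w -> forall t, (n < t <= 2 * n)%N -> forall g : O -> R,
    measurable_fun setT g -> (forall o, 0 <= g o <= 1) ->
    (forall k, exists i : 'I_(N k), forall o, lo k i o <= g o <= up k i o) ->
    `|cs psi (fun o => theta (g o)) t w| <= (2 * K + 2)%:R * W + K.+1%:R * W'.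
Proof.
pose U k : set Om := \big[setU/set0]_(i : cidx k)
  \big[setU/set0]_(j < n) bad i (n + j.+1)%N.
have nj (j : 'I_n) : (n < n + j.+1 <= 2 * n)%N.
  by rewrite -addn1 leq_add2l ltn0Sn mul2n -addnn leq_add2l ltn_ord.
have Ule (k : 'I_K.+1) : measurable (U k) /\
    (P (U k) <= (#|cidx k|%:R * (n%:R * (4 * expR (- x k))))%:E)%E.
  have Vle (i : cidx k) : measurable (\big[setU/set0]_(j < n) bad i (n + j.+1)%N) /\
      (P (\big[setU/set0]_(j < n) bad i (n + j.+1)%N)
         <= (n%:R * (4 * expR (- x k)))%:E)%E.
    have bl (j : 'I_n) := bad_le i (ltn_ord k : (k <= K)%N) (nj j).
    have [mb bb] := measure_bigsetU_le P (index_enum _) (fun j : 'I_n => (bl j).1).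
    split => //; apply: (le_trans bb).
    apply: (@le_trans _ _ (\sum_(j < n) (4 * expR (- x k))%:E)%E).
      by apply: lee_sum => j _; exact: (bl j).2.
    by rewrite sumEFin sumr_const card_ord -[in leLHS](mulr_natl (_ * _)).
  have [mb bb] := measure_bigsetU_le P (index_enum _) (fun i => (Vle i).1).
  split => //; apply: (le_trans bb).
  apply: (@le_trans _ _ (\sum_(i : cidx k) (n%:R * (4 * expR (- x k)))%:E)%E).
    by apply: lee_sum => i _; exact: (Vle i).2.
  by rewrite sumEFin sumr_const -[in leLHS](mulr_natl (_ * _)).
have [mb bb] := measure_bigsetU_le P (index_enum _) (fun k => (Ule k).1).
exists (\big[setU/set0]_(k < K.+1) U k).
  split=> //; apply: (le_trans bb); rewrite -sumEFin.
  by apply: lee_sum => k _; exact: (Ule k).2.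
move=> w nB t nt g mg g01 gbr.
have tle : (t - n.+1)%:R <= n%:R :> R.
  case/andP: nt => _ tn.
  by rewrite ler_nat leq_subLR (leq_trans tn)// mul2n -addnn leq_add2r.
apply: chain_decomposition => //.
- move=> k i kK.
  have nb : ~ bad i t w.
    move=> biw; apply: nB; rewrite -bigcup_mkord; exists k => //.
    rewrite /U -bigcup_seq; exists i; first by rewrite /= mem_index_enum.
    rewrite -(bigcup_mkord n (fun j => bad i (n + j.+1))).
    case/andP: nt => nt tn; exists (t - n.+1)%N => /=.
      by rewrite ltn_subLR// (leq_ltn_trans tn)// mul2n -addnn addSn ltnS.
    by rewrite addnS -addSn subnKC.
  have {nb} [n1 n2 n3 n4] : [/\ cs psi (inc i) t w <= W,
      cs (fun t w o => - psi t w o) (inc i) t w <= W,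
      cs (fun _ _ _ => C) (rem i) t w <= W & cs (fun _ _ _ => C) (dom i) t w <= W].
    by split; rewrite leNgt; apply/negP => /ltW h; apply: nb; rewrite /bad /=; tauto.
  split => //.
    rewrite ler_norml n1 andbT lerNl -(centered_sumN Lam ob q mpsi psiC)//.
    exact: (bmeas_chain_inc tau lo_up mlo mup mtheta thetaB).
  case: k i kK {n1 n2 n3 n4} => [|k] i kK.
    by rewrite Rintegral_cst// !mul0r mulr0 mul0r.
  apply: le_trans (bias_rem kK); apply: ler_pM => //.
    rewrite mulr_ge0// ?mulr_ge0//; apply: Rintegral_ge0 => o _.
    exact: (chain_rem_ge0 tau lo_up L0 B0).
  rewrite ler_wpM2l ?mulr_ge0//.
  apply: (@le_trans _ _ (L / tau k.+1 *
      \int[Lam]_o ((up k.+1 i.2 o - lo k.+1 i.2 o) ^+ 2))).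
    rewrite -bmeas_RintegralZl//; apply: bmeas_le_Rintegral.
    - exact: (bmeas_chain_rem L B tau lo_up mlo mup).
    - by apply: bmeasM => //; exact: bmeas_cst.
    - by move=> o; exact: (chain_rem_le_sqr lo_up L0 B0).
  by rewrite ler_wpM2l// divr_ge0// ltW.
- move=> i; apply: le_trans bias_dom; apply: ler_pM => //.
    rewrite mulr_ge0// ?mulr_ge0//; apply: Rintegral_ge0 => o _.
    exact: (chain_dom_ge0 tau lo_up L0 B0).
  rewrite ler_wpM2l ?mulr_ge0//.
  case: K K0 i => // k _ i.
  have e0 := eps0 k.+1.
  (* [le_scaled_sqr] at the scale [eps] of the last level, where only the L2 norm of the width is
     known. A bracket is available there because [K] is positive. *)
  apply: (@le_trans _ _ (\int[Lam]_o (L * (eps k.+1 +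
      (eps k.+1)^-1 * (up k.+1 i.2 o - lo k.+1 i.2 o) ^+ 2)))).
    apply: bmeas_le_Rintegral.
    - exact: (bmeas_chain_dom L B tau lo_up mlo mup).
    - apply: bmeasM; first exact: bmeas_cst.
      by apply: bmeasD; [exact: bmeas_cst|apply: bmeasM => //; exact: bmeas_cst].
    - move=> o; apply: le_trans (chain_dom_le_width tau lo_up L0 B0 i o) _.
      by rewrite ler_wpM2l// le_scaled_sqr.
  rewrite bmeas_RintegralZl; last first.
    by apply: bmeasD; [exact: bmeas_cst|apply: bmeasM => //; exact: bmeas_cst].
  rewrite bmeas_RintegralD ?bmeas_RintegralZl//; last 2 first.
  - exact: bmeas_cst.
  - by apply: bmeasM => //; exact: bmeas_cst.
  rewrite Rintegral_cst// -mulrA ler_wpM2l// mulrDr mulr1 lerD2l.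
  by rewrite ler_pdivrMl// -expr2.
Qed.

End chain_bound.

(** * Rates *)

Section exponents.
Context {R : realType}.
Variables (alpha p : R).

(** The power of [n] that bounds both the sup norm and the second moment at level [k]. The first
    case is the squared bound of [theta], with a slack [gamma]. The second is the Lipschitz constant
    times the threshold of level [k - 1]; it also covers the squared Lipschitz constant times the
    squared width [n^(-2 (k - 1) gamma)]. The two expressions meet at [(k - 1) gamma = alpha]. *)
Definition level_exponent (gamma : R) (k : nat) : R :=
  if k.-1%:R * gamma <= alpha then 2 * alpha + gamma
  else 4 * alpha + gamma - 2 * (k.-1%:R * gamma).

(* The requirement is affine in (k - 1) gamma on each side of alpha, so that
   only the values alpha and 2 alpha matter: they give the two conditions
   alpha < 1 / (3 + p) and alpha < 1 / (1 + 2 p). *)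
Lemma exists_chain_exponents : 0 < p -> 0 <= alpha ->
  alpha < 1 / (3 + p) -> alpha < 1 / (1 + 2 * p) ->
  exists gamma (K : nat), [/\ 0 < gamma < 1 / 4, (0 < K)%N,
    2 * alpha + gamma <= K%:R * gamma &
    forall k, (k <= K)%N ->
      alpha + level_exponent gamma k + p * (k%:R * gamma) + 3 * gamma <= 1].
Proof.
move=> p0 a0; rewrite !ltr_pdivlMr; [|lra|lra] => h1 h2.
(* [s] is the slack in the two conditions. Either regime leaves at most [4 + 2 p] stray multiples of
   [gamma], so the choice [gamma = s / (5 + 2 p)] absorbs them and also keeps [gamma] below 1/4. *)
pose s := Num.min (1 - alpha * (3 + p)) (1 - alpha * (1 + 2 * p)).
have s0 : 0 < s by rewrite lt_min; apply/andP; split; lra.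
have s1 : s <= 1 - alpha * (3 + p) by rewrite ge_min lexx.
have s2 : s <= 1 - alpha * (1 + 2 * p) by rewrite ge_min lexx orbT.
pose g := s / (5 + 2 * p).
have g0 : 0 < g by rewrite divr_gt0//; lra.
have gs : s = g * (5 + 2 * p) by rewrite divfK//; lra.
have g4 : g < 1 / 4.
  have : 0 <= alpha * (3 + p) by rewrite mulr_ge0//; lra.
  have : 0 < g * (2 * p) by rewrite mulr_gt0// mulr_gt0.
  move: gs; rewrite mulrDr; lra.
(* [K] is [x] rounded down plus one: [K gamma] reaches [2 alpha + gamma], while [(K - 1) gamma] does
   not exceed it, so [y] stays in the range where the affine bounds are checked. *)
pose x := (2 * alpha + g) / g.
have x0 : 0 <= x by rewrite divr_ge0 ?(ltW g0)//; lra.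
have xg : x * g = 2 * alpha + g by rewrite divfK// gt_eqF.
have /andP[tx xt] := truncn_itv x0.
exists g, (Num.truncn x).+1; split=> //; first by rewrite g0.
  by rewrite -xg ler_wpM2r ?(ltW g0)// ltW.
move=> k kK; rewrite /level_exponent.
set y := k.-1%:R * g.
have y0 : 0 <= y by rewrite mulr_ge0// ltW.
have ky : k%:R * g <= y + g.
  rewrite /y -{3}[g]mul1r -mulrDl ler_wpM2r ?(ltW g0)//.
  by case: k {kK y y0} => [|k]; rewrite ?addr_ge0// -natr1.
have yx : y <= 2 * alpha + g.
  rewrite -xg ler_wpM2r ?(ltW g0)// (le_trans _ tx)// ler_nat.
  by case: k kK {y y0 ky} => // k; rewrite ltnS.
have pk : p * (k%:R * g) <= p * y + p * g by rewrite -mulrDr ler_wpM2l// ltW.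
have pg : 0 < p * g by rewrite mulr_gt0.
case: ifPn => [ya|]; last rewrite -ltNge => ay.
  have : p * y <= p * alpha by rewrite ler_wpM2l// ltW.
  lra.
have [p2|p2] := leP p 2.
  have : (2 - p) * alpha <= (2 - p) * y 
    by apply: ler_wpM2l; [rewrite subr_ge0|exact: ltW].
  lra.
have : (p - 2) * y <= (p - 2) * (2 * alpha + g).
  by rewrite ler_wpM2l// subr_ge0 ltW.
lra.
Qed.

End exponents.

(** Brackets are indexed by all naturals, each with valid range and width, and only the first [N]
    need to cover. Brackets for all levels can then be chosen without types depending on their
    numbers. *)
Record bracket_family {R : realType} {d} {O : measurableType d}
    (Lam : {finite_measure set O -> \bar R}) (G : set (O -> R)) (eps : R)
    (N : nat) (lo up : nat -> O -> R) : Prop := BracketFamily {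
  bracket_range : forall i o, [/\ 0 <= lo i o, lo i o <= up i o & up i o <= 1] ;
  bracket_mlo : forall i, measurable_fun setT (lo i) ;
  bracket_mup : forall i, measurable_fun setT (up i) ;
  bracket_width : forall i, \int[Lam]_o ((up i o - lo i o) ^+ 2) <= eps ^+ 2 ;
  bracket_covers : forall g, G g ->
    exists i : 'I_N, forall o, lo i o <= g o <= up i o
}.

Section chain_rate.
Context {R : realType} {dO d : measure_display}.
Context {Om : measurableType dO} {O : measurableType d}.
Variables (P : probability Om R) (Lam : {finite_measure set O -> \bar R}).
Variables (F : nat -> set_system Om) (ob : nat -> Om -> O).
Variables (alpha p gamma f C Cb : R) (K : nat) (G : set (O -> R)).
Hypotheses (p0 : 0 < p) (alpha0 : 0 <= alpha) (gamma0 : 0 < gamma).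
Hypothesis K0 : (0 < K)%N.
Hypothesis Kgamma : 2 * alpha + gamma <= K%:R * gamma.
Hypothesis Kexp : forall k, (k <= K)%N ->
  alpha + level_exponent alpha gamma k + p * (k%:R * gamma) + 3 * gamma <= 1.
Hypotheses (f0 : 0 < f) (f1 : f <= 1) (C1 : 1 <= C) (Cb0 : 0 <= Cb).
Hypothesis Gm : forall g, G g -> measurable_fun setT g /\ forall o, 0 <= g o <= 1.
Hypothesis Gb : forall eps, 0 < eps <= 1 -> exists N lo up,
  N%:R <= expR (Cb * eps `^ (- p)) /\ bracket_family Lam G eps N lo up.

Let Lm := fine (Lam setT).
(** [M] absorbs the numerical factors of both regimes, the largest power being the squared Lipschitz
    constant, of order [f^(-4)]. [l0] normalizes the tilt so that [lam * C * bd / fl] equals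
    [n^(-gamma) / 2]. *)
Let M := 4 * (f^-1) ^+ 4 * (1 + Lm).
Let l0 := f / (2 * C * M).

Let Lm0 : 0 <= Lm. Proof. exact: fine_ge0. Qed.
Let fV1 : 1 <= f^-1. Proof. by rewrite invf_ge1. Qed.
Let M1 : 1 <= M.
Proof.
have h : 1 <= (f^-1) ^+ 4 by rewrite exprn_ege1.
by rewrite /M; have := Lm0; nra.
Qed.
Let l00 : 0 < l0.
Proof.
have C0 : 0 < C := lt_le_trans ltr01 C1; have M0 : 0 < M := lt_le_trans ltr01 M1.
by rewrite divr_gt0// mulr_gt0// mulr_gt0.
Qed.

Definition chain_constant : R :=
  (2 * K + 2)%:R * (1 + C) + K.+1%:R * (2 * C * f^-1 ^+ 2 * (1 + Lm)).

Definition chain_tail_rate : R := l0.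

Section fixed_n.
Variables (n : nat) (q : nat -> Om -> O -> R) (psi : nat -> Om -> O -> R)
  (theta : R -> R).
Hypothesis n0 : (0 < n)%N.
Local Notation pw a := ((n%:R : R) `^ a).
Hypothesis dsg : sequential_design P Lam F ob q (f * pw (- alpha)) n.
Hypothesis mpsi : forall t, (n < t)%N ->
  measurable_fun [set: g_sigma_algebraType (F t.-1) * O] (fun z => psi t z.1 z.2).
Hypothesis psiC : forall t w o, `|psi t w o| <= C.
Hypothesis mtheta : measurable_fun setT theta.
Hypothesis thetaL : forall u v,
  `|theta u - theta v| <= f^-1 ^+ 2 * pw (2 * alpha) * `|u - v|.
Hypothesis thetaB : forall u, `|theta u| <= f^-1 * pw alpha.

Let X1 : 1 <= n%:R :> R. Proof. by rewrite ler1n. Qed.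
Let X0 : 0 < n%:R :> R. Proof. by rewrite ltr0n. Qed.
Let pw0 (a : R) : 0 < pw a. Proof. exact: powR_gt0. Qed.
Let pwD (a b : R) : pw (a + b) = pw a * pw b.
Proof. by rewrite powRD//; apply/implyP => _; rewrite gt_eqF. Qed.
Let pwN (a : R) : pw (- a) = (pw a)^-1. Proof. exact: powRN. Qed.
Let pw_le (a b : R) : a <= b -> pw a <= pw b. Proof. by move=> ab; exact: ler_powR. Qed.
Let pwX (a : R) : pw a ^+ 2 = pw (2 * a).
Proof. by rewrite mulr_natl mulr2n pwD expr2. Qed.
Let pw_1 : pw 1 = n%:R. Proof. by rewrite powRr1. Qed.

Let e k := level_exponent alpha gamma k.
(** The widths shrink geometrically in powers of [n]. [tauk] makes the remainder bias
    [L * eps ^+ 2 / tau] of order exactly [n^(-gamma)], and [lamk] is the largest tilt allowed by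
    the sup norm, reduced by [n^(-gamma)] so that the variance term is small too. *)
Let epsk k := pw (- (k%:R * gamma)).
Let tauk k := pw (2 * alpha + gamma - 2 * (k%:R * gamma)).
Let lamk k := l0 * pw (- (alpha + e k + gamma)).

Let epsk01 k : 0 < epsk k <= 1.
Proof.
rewrite powR_gt0//= -(powRr0 (n%:R : R)) pw_le// oppr_le0 mulr_ge0//.
exact: ltW.
Qed.

Let lin_exponent1 : alpha <= 2 * alpha + gamma.
Proof. by have := gamma0; have := alpha0; lra. Qed.

Let lin_exponent2 (x : R) :
  2 * (2 * alpha) + 2 * - x <= 4 * alpha + gamma - 2 * x.
Proof. by have := gamma0; have := alpha0; lra. Qed.

Let lin_exponent3 : 2 * alpha - K%:R * gamma + 1 <= 1 - gamma.
Proof. by have := Kgamma; lra. Qed.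

Let lin_exponent4 k : (k <= K)%N ->
  p * (k%:R * gamma) + gamma <= - (alpha + e k + gamma) + (1 - gamma).
Proof. by move=> /Kexp; rewrite /e; lra. Qed.

(** The tail exponent at level [k] is of order [n^(1 - alpha - e_k - 2 gamma)]. By the choice of
    exponents this is at least [n^gamma] times the entropy order [n^(p k gamma)], so the union over
    brackets is absorbed at every level. *)
Lemma chain_rate : exists2 Bad : set Om, measurable Bad /\
  (Cb * K%:R <= l0 * pw gamma ->
   (P Bad <= (K.+1%:R * (4 * n%:R * expR (Cb * K%:R - l0 * pw gamma)))%:E)%E) &
  forall w, ~ Bad w -> forall t, (n < t <= 2 * n)%N -> forall g, G g ->
    `|centered_sum Lam ob q n psi (fun o => theta (g o)) t w|
      <= chain_constant * pw (1 - gamma).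
Proof.
have [N HN] := choice (fun k => Gb (epsk01 k)).
have [lo Hlo] := choice HN; have [up Hup] := choice Hlo.
pose L := f^-1 ^+ 2 * pw (2 * alpha); pose B := f^-1 * pw alpha.
pose bd k := M * pw (e k).
pose W := (1 + C) * pw (1 - gamma).
pose W' := 2 * C * f^-1 ^+ 2 * (1 + Lm) * pw (1 - gamma).
pose x k := lamk k * pw (1 - gamma).
have C0 : 0 <= C := le_trans ler01 C1.
have M0 : 0 < M := lt_le_trans ltr01 M1.
have L0 : 0 <= L by rewrite mulr_ge0 ?sqr_ge0// ltW.
have B0 : 0 <= B by rewrite mulr_ge0 ?invr_ge0 ?(ltW f0)// ltW.
have f4 : (f^-1) ^+ 4 <= M.
  have h : 1 <= (f^-1) ^+ 4 by rewrite exprn_ege1.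
  by rewrite /M; have := Lm0; nra.
have f2 : (f^-1) ^+ 2 <= M by apply: le_trans f4; rewrite ler_weXn2l.
have f2' : f^-1 <= M by apply: le_trans f2; rewrite -[leLHS]expr1 ler_weXn2l.
have LmM : 4 * (f^-1) ^+ 2 * Lm <= M.
  have h : (f^-1) ^+ 2 <= (f^-1) ^+ 4 by rewrite ler_weXn2l.
  rewrite /M; have : 4 * (f^-1) ^+ 2 * Lm <= 4 * (f^-1) ^+ 4 * Lm.
    by rewrite ler_wpM2r// ler_wpM2l.
  have : 0 <= (f^-1) ^+ 4 by rewrite exprn_ge0// invr_ge0 ltW.
  by rewrite mulrDr mulr1; lra.
have f2'' : 2 * f^-1 <= M.
  have : f^-1 <= (f^-1) ^+ 4 by rewrite -[leLHS]expr1 ler_weXn2l.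
  have : 0 <= 4 * (f^-1) ^+ 4 * Lm by rewrite mulr_ge0// mulr_ge0// exprn_ge0// invr_ge0 ltW.
  by have := fV1; rewrite /M mulrDr mulr1; lra.
have eps0 k : 0 < epsk k by exact: pw0.
have lo_up k i o := bracket_range (Hup k).2 i o.
have mlo k i := bracket_mlo (Hup k).2 i.
have mup k i := bracket_mup (Hup k).2 i.
have heps k i := bracket_width (Hup k).2 i.
have gbr g k : G g -> exists i : 'I_(N k), forall o, lo k i o <= g o <= up k i o.
  by move=> Gg; exact: (bracket_covers (Hup k).2 Gg).
have regime k : (k <= K)%N ->
    (2 * B <= bd k /\ 4 * B ^+ 2 * fine (Lam setT) <= bd k) \/
    (exists2 k', k = k'.+2 &
     L * tauk k'.+1 <= bd k /\ L ^+ 2 * epsk k'.+1 ^+ 2 <= bd k).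
  move=> kK; rewrite /bd /e /level_exponent; case: ifPn => [_|].
    left; split.
      rewrite /B mulrA ler_pM//; first by rewrite mulr_ge0// invr_ge0 ltW.
      by apply: pw_le; exact: lin_exponent1.
    rewrite /B exprMn pwX mulrA [_ * Lm]mulrAC ler_pM//.
    - by rewrite mulr_ge0// mulr_ge0// sqr_ge0.
    - by apply: pw_le; rewrite lerDl ltW.
  rewrite -ltNge; case: k kK => [|[|k]] kK /=; rewrite ?mul0r ?ltNge ?alpha0// => _.
  right; exists k => //; split.
    rewrite /L /tauk -mulrA -pwD ler_pM ?sqr_ge0//.
    by apply: pw_le; rewrite le_eqVlt; apply/orP; left; apply/eqP; ring.
  rewrite /L /epsk exprMn pwX pwX -mulrA -pwD -exprM ler_pM//.
  - by rewrite exprn_ge0// invr_ge0 ltW.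
  - by apply: pw_le; exact: lin_exponent2.
have hlam k : (k <= K)%N -> [/\ 0 < lamk k,
    lamk k * C * bd k / (f * pw (- alpha)) <= 2^-1 &
    x k + 2 * lamk k ^+ 2 * C ^+ 2 * bd k / (f * pw (- alpha)) * n%:R <= lamk k * W].
  move=> kK.
  have Cn0 : C != 0 by rewrite gt_eqF// (lt_le_trans ltr01).
  have Mn0 : M != 0 by rewrite gt_eqF.
  have fn0 : f != 0 by rewrite gt_eqF.
  have key : lamk k * C * bd k / (f * pw (- alpha)) = 2^-1 * pw (- gamma).
    have -> : lamk k * C * bd k / (f * pw (- alpha)) =
      (l0 * C * M / f) * (pw (- (alpha + e k + gamma)) * pw (e k) * (pw (- alpha))^-1).
      by rewrite /lamk /bd; field; rewrite fn0 gt_eqF.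
    rewrite -pwN -!pwD.
    have -> : - (alpha + e k + gamma) + e k - - alpha = - gamma by ring.
    by congr (_ * _); rewrite /l0; field; rewrite Cn0 Mn0 fn0.
  split; first by rewrite mulr_gt0.
    rewrite key -[leRHS]mulr1 ler_wpM2l// -[leRHS](powRr0 (n%:R : R)) pw_le//.
    by rewrite oppr_le0 ltW.
  have -> : 2 * lamk k ^+ 2 * C ^+ 2 * bd k / (f * pw (- alpha)) * n%:R =
    lamk k * (2 * C * (lamk k * C * bd k / (f * pw (- alpha)))) * n%:R by ring.
  rewrite key /x /W -[X in _ + _ * X <= _]pw_1.
  have -> : lamk k * (2 * C * (2^-1 * pw (- gamma))) * pw 1 =
            lamk k * C * (pw 1 * pw (- gamma)) by field.
  by rewrite -pwD le_eqVlt; apply/orP; left; apply/eqP; ring.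
have W'0 : 0 <= W'.
  rewrite mulr_ge0 ?(ltW (pw0 _))// !mulr_ge0 ?addr_ge0// invr_ge0; exact: ltW.
have bias_rem k : (k < K)%N ->
    2 * C * (L / tauk k.+1 * epsk k.+1 ^+ 2) * n%:R <= W'.
  move=> _; rewrite /L /tauk /epsk pwX -pwN.
  have -> : 2 * C * (f^-1 ^+ 2 * pw (2 * alpha) *
      pw (- (2 * alpha + gamma - 2 * (k.+1%:R * gamma))) *
      pw (2 * - (k.+1%:R * gamma))) * n%:R
    = 2 * C * f^-1 ^+ 2 * (pw (2 * alpha) *
      pw (- (2 * alpha + gamma - 2 * (k.+1%:R * gamma))) *
      pw (2 * - (k.+1%:R * gamma)) * n%:R) by ring.
  rewrite -[X in _ * (_ * X)]pw_1 -!pwD /W'.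
  have -> : 2 * alpha + - (2 * alpha + gamma - 2 * (k.+1%:R * gamma)) +
      2 * - (k.+1%:R * gamma) + 1 = 1 - gamma by ring.
  rewrite ler_wpM2r ?(ltW (pw0 _))// ler_peMr ?mulr_ge0 ?invr_ge0 ?(ltW f0)//.
  by rewrite lerDl.
have bias_dom : 2 * C * (L * epsk K * (Lm + 1)) * n%:R <= W'.
  rewrite /L /epsk.
  have -> : 2 * C * (f^-1 ^+ 2 * pw (2 * alpha) * pw (- (K%:R * gamma)) *
      (Lm + 1)) * n%:R = 2 * C * f^-1 ^+ 2 * (1 + Lm) *
      (pw (2 * alpha) * pw (- (K%:R * gamma)) * n%:R) by ring.
  rewrite -[X in _ * (_ * X)]pw_1 -!pwD /W' ler_wpM2l ?mulr_ge0 ?addr_ge0 ?invr_ge0 ?(ltW f0)//.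
  by apply: pw_le; exact: lin_exponent3.
have [Bad [mBad PBad] good] := chain_uniform dsg mpsi psiC N lo_up mlo mup L0 B0
  mtheta thetaL thetaB (fun k => pw0 _) heps eps0 regime hlam C0 W'0 bias_rem K0 bias_dom.
exists Bad; last first.
  move=> w nB t nt g Gg; have [mg g01] := Gm Gg.
  apply: le_trans (good w nB t nt g mg g01 (fun k => gbr g k Gg)) _.
  by rewrite le_eqVlt; apply/orP; left; apply/eqP; rewrite /W /W' /chain_constant; ring.
split=> // Cbl; apply: le_trans PBad _; rewrite lee_fin.
(* Every earlier level has an entropy bound no larger than that of level [k], so the logarithm of
   the product is at most [k] times the latter. *)
have card_le k : #|chain_index N k|%:R <=
    expR (Cb * (k%:R * pw (p * (k%:R * gamma)))) :> R.
  elim: k => [|k IH] /=; first by rewrite card_unit mul0r mulr0 expR0.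
  rewrite card_prod card_ord natrM; apply: le_trans (ler_pM _ _ IH (Hup k.+1).1) _ => //.
  rewrite -expRD ler_expR -mulrDr ler_wpM2l// /epsk -powRrM mulrNN [_ * p]mulrC.
  have kk : pw (p * (k%:R * gamma)) <= pw (p * (k.+1%:R * gamma)).
    by rewrite pw_le// ler_wpM2l ?(ltW p0)// ler_wpM2r ?(ltW gamma0)// ler_nat.
  move: kk; set Q' := pw (p * (k.+1%:R * gamma)) => kk.
  by rewrite -natr1 mulrDl mul1r lerD// ler_wpM2l.
have term k : (k <= K)%N ->
    #|chain_index N k|%:R * (n%:R * (4 * expR (- x k))) <=
    4 * n%:R * expR (Cb * K%:R - l0 * pw gamma) :> R.
  move=> kK; have -> : #|chain_index N k|%:R * (n%:R * (4 * expR (- x k))) =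
    4 * n%:R * (#|chain_index N k|%:R * expR (- x k)) :> R by ring.
  rewrite ler_wpM2l// ?mulr_ge0//.
  apply: le_trans (ler_wpM2r (expR_ge0 _) (card_le k)) _.
  rewrite -expRD ler_expR; set Q := pw (p * (k%:R * gamma)).
  have Q1 : 1 <= Q.
    rewrite -[leLHS](powRr0 (n%:R : R)) pw_le// mulr_ge0 ?(ltW p0)//.
    by rewrite mulr_ge0// ltW.
  have xk : l0 * (Q * pw gamma) <= x k.
    rewrite /x /lamk /Q -mulrA -!pwD ler_wpM2l ?(ltW l00)// pw_le//.
    exact: lin_exponent4.
  have kC : Cb * (k%:R * Q) <= Q * (Cb * K%:R).
    by rewrite [leRHS]mulrCA [Q * _]mulrC !ler_wpM2l// ler_wpM2r ?ler_nat// (le_trans ler01).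
  apply: (@le_trans _ _ (Q * (Cb * K%:R - l0 * pw gamma))).
    by rewrite mulrBr [Q * (l0 * _)]mulrCA lerB.
  by rewrite ler_neMl// subr_le0.
apply: (@le_trans _ _ (\sum_(k < K.+1)
    4 * n%:R * expR (Cb * K%:R - l0 * pw gamma))).
  by apply: ler_sum => k _; exact: term (ltn_ord k).
by rewrite sumr_const card_ord -[leLHS]mulr_natl.
Qed.

End fixed_n.
End chain_rate.

(** * From tail bounds to almost sure bounds *)

Section eventually_as.
Context {R : realType}.

Lemma sum_inv_sqr_le2 m : \sum_(0 <= k < m) (k.+1%:R^-1) ^+ 2 <= 2 :> R.
Proof.
(* Strengthened for the induction: the bound grows by [2 / ((m + 1) (m + 2))], which is at least
   [1 / (m + 1)^2]. *)
suff : \sum_(0 <= k < m) (k.+1%:R^-1) ^+ 2 <= 2 - 2 * m.+1%:R^-1 :> R.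
  by move/le_trans; apply; rewrite gerBl mulr_ge0 ?invr_ge0.
elim: m => [|m IH]; first by rewrite big_geq// invr1 mulr1 subrr.
rewrite big_nat_recr//=; apply: le_trans (lerD IH (lexx _)) _.
have a0 : 0 < m.+1%:R :> R by rewrite ltr0n.
have b0 : 0 < m.+2%:R :> R by rewrite ltr0n.
rewrite -subr_ge0; have -> : 2 - 2 * m.+2%:R^-1 - (2 - 2 * m.+1%:R^-1 + m.+1%:R^-1 ^+ 2) =
  (2 * m.+1%:R * (m.+2%:R - m.+1%:R) - m.+2%:R) / (m.+1%:R ^+ 2 * m.+2%:R) :> R.
  by field; rewrite !gt_eqF.
rewrite divr_ge0 ?mulr_ge0 ?sqr_ge0 ?(ltW b0)//.
have -> : m.+2%:R = m.+1%:R + 1 :> R by rewrite -natr1.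
have : 1 <= m.+1%:R :> R by rewrite ler1n.
set y := m.+1%:R; move=> y1; have -> : 2 * y * (y + 1 - y) - (y + 1) = y - 1 by ring.
by rewrite subr_ge0.
Qed.

Lemma sum_inv_le n : (0 < n)%N ->
  \sum_(0 <= k < n) k.+1%:R^-1 <= 1 + ln n%:R :> R.
Proof.
elim: n => // -[|n] IH _; first by rewrite big_nat1 invr1 ln1 addr0.
rewrite big_nat_recr//=; apply: le_trans (lerD (IH isT) (lexx _)) _.
rewrite -addrA lerD2l.
have a0 : 0 < n.+1%:R :> R by rewrite ltr0n.
have b0 : 0 < n.+2%:R :> R by rewrite ltr0n.
have -> : n.+1%:R = n.+2%:R * (n.+1%:R / n.+2%:R) :> R by field; rewrite gt_eqF.
rewrite lnM ?posrE ?divr_gt0// -addrA gerDl.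
have -> : n.+1%:R / n.+2%:R = 1 + - n.+2%:R^-1 :> R.
  have -> : n.+1%:R = n.+2%:R - 1 :> R by rewrite -[n.+2%:R]natr1 addrK.
  by field; rewrite gt_eqF.
rewrite -lerBrDr sub0r; apply: le_ln1Dx.
by rewrite ltrN2 invf_lt1// ltr1n.
Qed.

(** This is [1 + d ln x <= e^(d ln x)]; it trades the logarithm of the harmonic sum for an
    arbitrarily small power. *)
Lemma ln_le_powR (x d : R) : 0 < d -> 1 <= x -> ln x <= d^-1 * x `^ d.
Proof.
move=> d0 x1; rewrite ler_pdivlMl// /powR gt_eqF ?(lt_le_trans ltr01)//.
by apply: le_trans (expR_ge1Dx _); rewrite lerDr.
Qed.

(** One term of the exponential series, of order at least [3 / g], beats the cube. Two powers of [n]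
    give summability and the third pays for the union over rounds. *)
Lemma cube_expR_bounded (l g : R) : 0 < l -> 0 < g ->
  exists2 c, 0 <= c & forall n, (0 < n)%N ->
    n%:R ^+ 3 * expR (- (l * n%:R `^ g)) <= c.
Proof.
move=> l0 g0; pose k := (Num.truncn (3 / g)).
have kg : 3 <= k.+1%:R * g.
  rewrite -ler_pdivrMr//.
  by have /andP[_ /ltW] := truncn_itv (divr_ge0 (ler0n R 3) (ltW g0)).
exists (k.+1`!%:R / l ^+ k.+1); first by rewrite divr_ge0// exprn_ge0// ltW.
move=> n n0; set y := n%:R `^ g.
have y0 : 0 < y by rewrite powR_gt0// ltr0n.
have ly0 : 0 < l * y by rewrite mulr_gt0.
have h : (l * y) ^+ k.+1 / k.+1`!%:R <= expR (l * y).
  by apply: le_trans (expR_ge1Dxn k (ltW ly0)); rewrite lerDr.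
have yk : n%:R ^+ 3 <= y ^+ k.+1.
  rewrite -!powR_mulrn ?powR_ge0// /y -powRrM ler_powR//; last by rewrite mulrC.
  by rewrite ler1n.
rewrite expRN ler_pdivrMr ?expR_gt0//.
apply: (le_trans yk); rewrite -ler_pdivrMl ?divr_gt0 ?exprn_gt0 ?ltr0n ?fact_gt0//.
apply: le_trans h; rewrite exprMn invf_div.
by rewrite le_eqVlt; apply/orP; left; apply/eqP; ring.
Qed.

Context {d} {Om : measurableType d} (P : probability Om R).

Lemma ae_eventually_notin (Bad : nat -> set Om) (c : R) n1 : 0 <= c ->
  (forall n, measurable (Bad n)) ->
  (forall n, (n1 <= n)%N -> (0 < n)%N -> (P (Bad n) <= (c * (n%:R^-1) ^+ 2)%:E)%E) ->
  {ae P, forall w, exists n0, forall n, (n0 <= n)%N -> ~ Bad n w}.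
Proof.
(* The shift makes every index positive and larger than [n1], where the probability bound is
   available. *)
move=> c0 mB PB; pose F k := Bad (n1 + k).+1.
have : P (lim_sup_set F) = 0%E.
  apply: lim_sup_set_cvg0; first by move=> k; exact: mB.
  apply: (@le_lt_trans _ _ (c * 2)%:E); last by rewrite ltry.
  apply: lime_le; first by apply: is_cvg_nneseries => n _ _; exact: measure_ge0.
  apply: nearW => m.
  apply: (@le_trans _ _ (\sum_(0 <= k < m) (c * (k.+1%:R^-1) ^+ 2)%:E)%E).
    apply: lee_sum => k _; apply: (le_trans (PB _ _ _)) => //.
      by rewrite ltnW// ltnS leq_addr.
    rewrite lee_fin ler_wpM2l// lerXn2r ?nnegrE ?invr_ge0//.
    by rewrite lef_pV2 ?posrE ?ltr0n// ler_nat ltnS leq_addl.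
  by rewrite sumEFin lee_fin -mulr_sumr ler_wpM2l// sum_inv_sqr_le2.
move=> PF; exists (lim_sup_set F); split=> //.
  by apply: bigcap_measurable => // n _; apply: bigcup_measurable => k _; exact: mB.
move=> w /= h n _; apply: contrapT => nF; apply: h.
exists (n1 + n).+1 => j jn Bj; apply: nF.
have jn1 : (n1 < j)%N by rewrite (leq_trans _ jn)// ltnS leq_addr.
exists (j - n1.+1)%N; first by rewrite /= leq_subRL// addSn.
by rewrite /F -addSn subnKC.
Qed.

Lemma ae_eventually_notin_expR (Bad : nat -> set Om) (c l g : R) n1 : 0 <= c ->
  0 < l -> 0 < g -> (forall n, measurable (Bad n)) ->
  (forall n, (n1 <= n)%N -> (0 < n)%N ->
    (P (Bad n) <= (c * (n%:R * expR (- (l * n%:R `^ g))))%:E)%E) ->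
  {ae P, forall w, exists n0, forall n, (n0 <= n)%N -> ~ Bad n w}.
Proof.
move=> c0 l0 g0 mB PB; have [c' c'0 cE] := cube_expR_bounded l0 g0.
apply: (@ae_eventually_notin _ (c * c') n1) => //; first exact: mulr_ge0.
move=> n nn1 n0; apply: (le_trans (PB n nn1 n0)); rewrite lee_fin -mulrA ler_wpM2l//.
have nR : 0 < n%:R :> R by rewrite ltr0n.
rewrite exprVn ler_pdivlMr ?exprn_gt0//; apply: le_trans (cE n n0).
by rewrite le_eqVlt; apply/orP; left; apply/eqP; ring.
Qed.

End eventually_as.

Section as_rates.
Context {R : realType} {dO d : measure_display}.
Context {Om : measurableType dO} {O : measurableType d}.
Variables (P : probability Om R) (Lam : {finite_measure set O -> \bar R}).
Variables (F : nat -> set_system Om) (ob : nat -> Om -> O).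
Variables (q : nat -> nat -> Om -> O -> R) (alpha f : R).
Hypotheses (alpha0 : 0 <= alpha) (f0 : 0 < f) (f1 : f <= 1).
Hypothesis dsg : forall n, (0 < n)%N ->
  sequential_design P Lam F ob (q n) (f * n%:R `^ (- alpha)) n.

Let Lm := fine (Lam setT).

Let Lm0 : 0 <= Lm. Proof. exact: fine_ge0. Qed.

(* The total importance weight, needed because the first moment estimator enters
   the variance estimator quadratically. *)
Lemma sum_inv_density_as (g : R) : 0 < g ->
  exists2 c, 0 <= c & {ae P, forall w, exists n0, forall n, (n0 <= n)%N ->
    forall t, (n < t <= 2 * n)%N ->
    \sum_(n.+1 <= s < t) (q n s w (ob s w))^-1
      <= c * ((t - n.+1)%:R + n%:R `^ (alpha + g))}.
Proof.
move=> g0; exists (2 * Lm + 2 / f).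
  by apply: addr_ge0; apply: mulr_ge0; rewrite ?invr_ge0 ?(ltW f0).
(* With [psi] and the test function equal to 1, the centered sum is the total importance weight
   minus [Lm] per round. *)
pose cs n t w := centered_sum Lam ob (q n) n (fun _ _ _ => 1) (fun=> 1) t w.
pose fl n : R := f * n%:R `^ (- alpha).
pose bad n t := [set w | n%:R `^ g + fl n * Lm / 2 * (t - n.+1)%:R
  <= fl n / 2 * cs n t w].
have bad_le n t : (0 < n)%N -> (n < t <= 2 * n)%N ->
    measurable (bad n t) /\ (P (bad n t) <= (expR (- n%:R `^ g))%:E)%E.
  move=> n0 nt; have fl0 : 0 < fl n := design_floor_gt0 (dsg n0).
  have m1 (s : nat) : (n < s)%N -> measurable_fun
    [set: g_sigma_algebraType (F s.-1) * O] (fun=> 1 : R) by [].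
  have b1 (s : nat) (w : Om) (o : O) : `|1 : R| <= 1 by rewrite normr1.
  have mc1 : measurable_fun setT ((fun=> 1) : O -> R) by exact: measurable_cst.
  have c1 (o : O) : `|1 : R| <= 1 by rewrite normr1.
  have v1 : \int[Lam]_o (1 ^+ 2) <= Lm by rewrite Rintegral_cst// expr1n mul1r.
  have mcs := measurable_centered_sum (dsg n0) m1 b1 mc1 c1 t.
  split.
    rewrite -[X in measurable X]setTI; apply: measurable_fun_ler => //.
    exact: measurable_funM.
  have := centered_sum_tail (dsg n0) m1 b1 mc1 c1 v1
    (n%:R `^ g) nt (ltW (divr_gt0 fl0 (ltr0n R 2))).
  rewrite -/(fl n); have -> : fl n / 2 * 1 * 1 / fl n = 2^-1 by field; rewrite gt_eqF.
  have -> : 2 * (fl n / 2) ^+ 2 * 1 ^+ 2 * Lm / fl n = fl n * Lm / 2.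
    by field; rewrite gt_eqF.
  by move=> /(_ (lexx _)).
pose Bad n := \big[setU/set0]_(j < n) bad n (n + j.+1)%N.
have nj n (j : 'I_n) : (n < n + j.+1 <= 2 * n)%N.
  by rewrite -addn1 leq_add2l ltn0Sn mul2n -addnn leq_add2l ltn_ord.
have n_gt0 n (j : 'I_n) : (0 < n)%N by case: n j => // -[].
have mBad n : measurable (Bad n).
  by apply: bigsetU_measurable => j _; case: (bad_le _ _ (n_gt0 n j) (nj n j)).
have : {ae P, forall w, exists n0, forall n, (n0 <= n)%N -> ~ Bad n w}.
  apply: (@ae_eventually_notin_expR _ _ _ _ _ 1 1 g 0) => // n _ n0.
  have bl (j : 'I_n) := bad_le _ _ n0 (nj n j).
  have [_ bb] := measure_bigsetU_le P (index_enum _) (fun j : 'I_n => (bl j).1).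
  apply: (le_trans bb).
  apply: (@le_trans _ _ (\sum_(j < n) (expR (- n%:R `^ g))%:E)%E).
    by apply: lee_sum => j _; exact: (bl j).2.
  by rewrite sumEFin sumr_const card_ord -[in leLHS](mulr_natl (expR _)) !mul1r.
apply: filterS => w [n0 nB]; exists (maxn n0 1) => n; rewrite geq_max => /andP[n0n n1] t nt.
have {nB} : ~ bad n t w.
  move=> bw; apply: (nB n n0n); rewrite /Bad -(bigcup_mkord n (fun j => bad n (n + j.+1)%N)).
  case/andP: nt => nt tn; exists (t - n.+1)%N => /=.
    by rewrite ltn_subLR// (leq_ltn_trans tn)// mul2n -addnn addSn ltnS.
  by rewrite addnS -addSn subnKC.
move/negP; rewrite -ltNge => lt.
have fl0 : 0 < fl n := design_floor_gt0 (dsg n1).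
have csE : cs n t w = \sum_(n.+1 <= s < t) (q n s w (ob s w))^-1 - Lm * (t - n.+1)%:R.
  rewrite /cs /centered_sum sumrB; congr (_ - _).
    by apply: eq_bigr => s _; rewrite mulr1 mul1r.
  rewrite mulr_natr -sumr_const_nat; apply: eq_bigr => s _.
  by under eq_Rintegral do rewrite mulr1; rewrite Rintegral_cst// mul1r.
have flE : (fl n)^-1 * n%:R `^ g = f^-1 * n%:R `^ (alpha + g).
  rewrite /fl invfM powRN invrK -mulrA powRD//; apply/implyP => _.
  by rewrite pnatr_eq0 -lt0n.
set S := \sum_(_ <= _ < _) _ in csE *.
have S_le : S <= 2 * ((fl n)^-1 * n%:R `^ g) + 2 * Lm * (t - n.+1)%:R.
  rewrite -lerBlDr -(@ler_pM2l _ (fl n / 2)) ?divr_gt0//.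
  have -> : fl n / 2 * (2 * ((fl n)^-1 * n%:R `^ g)) = n%:R `^ g.
    by field; rewrite gt_eqF.
  move: lt; rewrite csE => /ltW.
  set m := (t - n.+1)%:R; have -> : fl n * Lm / 2 * m = fl n / 2 * (Lm * m) by ring.
  have -> : fl n / 2 * (S - 2 * Lm * m) = fl n / 2 * (S - Lm * m) - fl n / 2 * (Lm * m).
    by ring.
  by rewrite lerBlDr.
apply: (le_trans S_le); rewrite flE -subr_ge0.
set m := (t - n.+1)%:R; set y := n%:R `^ (alpha + g).
have -> : (2 * Lm + 2 / f) * (m + y) - (2 * (f^-1 * y) + 2 * Lm * m) =
  2 * Lm * y + 2 / f * m by ring.
by apply: addr_ge0; apply: mulr_ge0; rewrite ?powR_ge0// mulr_ge0// invr_ge0 ltW.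
Qed.

Variables (p gamma C Cb : R) (K : nat) (G : set (O -> R)).
Hypotheses (p0 : 0 < p) (gamma0 : 0 < gamma).
Hypothesis K0 : (0 < K)%N.
Hypothesis Kgamma : 2 * alpha + gamma <= K%:R * gamma.
Hypothesis Kexp : forall k, (k <= K)%N ->
  alpha + level_exponent alpha gamma k + p * (k%:R * gamma) + 3 * gamma <= 1.
Hypotheses (C1 : 1 <= C) (Cb0 : 0 <= Cb).
Hypothesis Gm : forall g, G g -> measurable_fun setT g /\ forall o, 0 <= g o <= 1.
Hypothesis Gb : forall eps, 0 < eps <= 1 -> exists N lo up,
  N%:R <= expR (Cb * eps `^ (- p)) /\ bracket_family Lam G eps N lo up.

Lemma centered_sum_rate_as (psi : nat -> nat -> Om -> O -> R) (theta : nat -> R -> R) :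
  (forall n t, (n < t)%N -> measurable_fun
     [set: g_sigma_algebraType (F t.-1) * O] (fun z => psi n t z.1 z.2)) ->
  (forall n t w o, `|psi n t w o| <= C) ->
  (forall n, measurable_fun setT (theta n)) ->
  (forall n u v, (0 < n)%N ->
     `|theta n u - theta n v| <= f^-1 ^+ 2 * n%:R `^ (2 * alpha) * `|u - v|) ->
  (forall n u, (0 < n)%N -> `|theta n u| <= f^-1 * n%:R `^ alpha) ->
  {ae P, forall w, exists n0, forall n, (n0 <= n)%N ->
    forall t, (n < t <= 2 * n)%N -> forall g, G g ->
    `|centered_sum Lam ob (q n) n (psi n) (fun o => theta n (g o)) t w|
      <= chain_constant Lam f C K * n%:R `^ (1 - gamma)}.
Proof.
move=> mpsi psiC mtheta thetaL thetaB.
pose l0 := chain_tail_rate Lam f C.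
have l00 : 0 < l0.
  have V1 : 1 <= f^-1 by rewrite invf_ge1.
  have h : 1 <= (f^-1) ^+ 4 by rewrite exprn_ege1.
  rewrite /l0 /chain_tail_rate divr_gt0// mulr_gt0//.
    by rewrite mulr_gt0// (lt_le_trans ltr01).
  by apply: mulr_gt0; [rewrite mulr_gt0// (lt_le_trans ltr01 h)|rewrite ltr_pwDl].
have H n : exists Bad : set Om, measurable Bad /\ ((0 < n)%N ->
    (Cb * K%:R <= l0 * n%:R `^ gamma ->
      (P Bad <= (K.+1%:R * (4 * n%:R * expR (Cb * K%:R - l0 * n%:R `^ gamma)))%:E)%E) /\
    forall w, ~ Bad w -> forall t, (n < t <= 2 * n)%N -> forall g, G g ->
    `|centered_sum Lam ob (q n) n (psi n) (fun o => theta n (g o)) t w|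
      <= chain_constant Lam f C K * n%:R `^ (1 - gamma)).
  case: (posnP n) => [->|n0]; first by exists set0; split.
  have [Bad [mB PB] good] := chain_rate p0 alpha0 gamma0 K0 Kgamma Kexp f0 f1 C1 Cb0
    Gm Gb n0 (dsg n0) (mpsi n) (psiC n) (mtheta n) (fun u v => thetaL n u v n0)
    (fun u => thetaB n u n0).
  by exists Bad; split.
have [Bad HB] := choice H.
(* From [n1] on the tail exponent exceeds the entropy constant, the condition under which the bad
   event was bounded. *)
pose n1 := (Num.truncn ((Cb * K%:R / l0) `^ gamma^-1)).+1.
have n1P n : (n1 <= n)%N -> Cb * K%:R <= l0 * n%:R `^ gamma.
  move=> n1n; rewrite -ler_pdivrMl// mulrC.
  have x0 : 0 <= Cb * K%:R / l0 by apply: divr_ge0 (ltW l00); exact: mulr_ge0.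
  move: x0; rewrite /n1 in n1n *; move: n1n; set x := Cb * K%:R / l0 => n1n x0.
  have -> : x = (x `^ gamma^-1) `^ gamma by rewrite -powRrM mulVf ?powRr1// gt_eqF.
  rewrite ge0_ler_powR ?(ltW gamma0) ?nnegrE ?powR_ge0//.
  have /andP[_ /ltW h] := truncn_itv (powR_ge0 x gamma^-1).
  by rewrite (le_trans h)// ler_nat.
have : {ae P, forall w, exists n0, forall n, (n0 <= n)%N -> ~ Bad n w}.
  apply: (@ae_eventually_notin_expR _ _ _ _ _ (K.+1%:R * 4 * expR (Cb * K%:R)) l0 gamma n1) => //.
  - by move=> n; case: (HB n).
  - move=> n n1n n0; have [_ /(_ n0)[/(_ (n1P n n1n)) h _]] := HB n.
    apply: (le_trans h); rewrite lee_fin expRD le_eqVlt; apply/orP; left; apply/eqP; ring.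
apply: filterS => w [n0 nB]; exists (maxn n0 1) => n; rewrite geq_max => /andP[n0n n1n].
by have [_ /(_ n1n)[_]] := HB n; apply; exact: nB.
Qed.

End as_rates.

Lemma le_of_expanded_sqr (R : realDomainType) (x y i : R) :
  i <= x -> 0 <= y - 2 * x + i -> x <= y.
Proof. lra. Qed.

(** * Plug-in estimators *)

Section plugin.
Context {R : realType} {dO d : measure_display}.
Context {Om : measurableType dO} {O : measurableType d}.
Variables (P : probability Om R) (Lam : {finite_measure set O -> \bar R}).
Variables (F : nat -> set_system Om) (ob : nat -> Om -> O).
Variables (alpha beta f : R) (gpol : nat -> Om -> O -> R).
Hypotheses (alpha0 : 0 <= alpha) (f0 : 0 < f) (f1 : f <= 1).

Definition policy_floor n : R := f * n%:R `^ (- alpha).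

(* Clipping is inactive almost surely; it makes the bounds on the density hold
   everywhere. *)
Definition clip n (u : R) : R := Num.min (Num.max u (policy_floor n)) 1.

Let q n t w o := clip n (gpol t w o).

Hypothesis dsg : forall n, (0 < n)%N ->
  sequential_design P Lam F ob (q n) (policy_floor n) n.

Lemma policy_floorV n : (policy_floor n)^-1 = f^-1 * n%:R `^ alpha.
Proof. by rewrite /policy_floor invfM powRN invrK. Qed.

Section clip_theory.
Variable n : nat.
Hypothesis n0 : (0 < n)%N.

Lemma policy_floor_gt0 : 0 < policy_floor n.
Proof. by rewrite mulr_gt0// powR_gt0// ltr0n. Qed.

Lemma policy_floor_le1 : policy_floor n <= 1.
Proof.
rewrite -invf_ge1 ?policy_floor_gt0// policy_floorV.
rewrite -[leLHS]mulr1 ler_pM ?invf_ge1//.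
by rewrite -[leLHS](powRr0 (n%:R : R)) ler_powR// ler1n.
Qed.

Lemma clip_ge u : policy_floor n <= clip n u.
Proof. by rewrite le_min le_max lexx orbT policy_floor_le1. Qed.

Lemma clip_le1 u : clip n u <= 1.
Proof. by rewrite ge_min lexx orbT. Qed.

Lemma clip_gt0 u : 0 < clip n u.
Proof. exact: lt_le_trans policy_floor_gt0 (clip_ge u). Qed.

Lemma clip_lip u v : `|clip n u - clip n v| <= `|u - v|.
Proof.
wlog uv : u v / u <= v.
  move=> h; have [|/ltW] := leP u v; first exact: h.
  by move=> vu; rewrite distrC [leRHS]distrC; exact: h.
rewrite /clip; move: (policy_floor n) => b.
rewrite distrC [leRHS]distrC ger0_norm; last by rewrite subr_ge0 le_min2// le_max2.
rewrite ger0_norm ?subr_ge0//.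
apply: (@le_trans _ _ (Num.max v b - Num.max u b)).
  have : Num.max u b <= Num.max v b by rewrite le_max2.
  move: (Num.max u b) (Num.max v b) => x y xy.
  by have [h|h] := leP x 1; have [h'|h'] := leP y 1; lra.
by have [h|h] := leP u b; have [h'|h'] := leP v b; lra.
Qed.

Lemma measurable_clip : measurable_fun setT (clip n).
Proof.
apply: measurable_minr => //.
by apply: measurable_maxr => //; exact: measurable_id.
Qed.

(** Source of the Lipschitz order [n^(2 alpha)]: the inverse has derivative at most the inverse
    squared floor. The identity and the constant are covered by the same constant because it is at
    least 1. *)
Lemma clipV_lip u v : `|(clip n u)^-1 - (clip n v)^-1|
  <= f^-1 ^+ 2 * n%:R `^ (2 * alpha) * `|u - v|.
Proof.
have u0 := clip_gt0 u; have v0 := clip_gt0 v; have fl0 := policy_floor_gt0.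
have -> : (clip n u)^-1 - (clip n v)^-1 =
    (clip n u)^-1 * (clip n v)^-1 * (clip n v - clip n u).
  by field; rewrite !gt_eqF.
have V x : (clip n x)^-1 <= (policy_floor n)^-1.
  by rewrite lef_pV2 ?posrE// ?clip_ge// clip_gt0.
have -> : f^-1 ^+ 2 * n%:R `^ (2 * alpha) = (policy_floor n)^-1 * (policy_floor n)^-1.
  rewrite policy_floorV mulr_natl mulr2n powRD; first by ring.
  by apply/implyP => _; rewrite pnatr_eq0 -lt0n.
rewrite !normrM !normfV (gtr0_norm u0) (gtr0_norm v0).
rewrite ler_pM ?mulr_ge0 ?invr_ge0 ?(ltW u0) ?(ltW v0)//.
  by rewrite ler_pM ?invr_ge0 ?(ltW u0) ?(ltW v0).
by rewrite distrC clip_lip.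
Qed.

Lemma lip_const_ge1 : 1 <= f^-1 ^+ 2 * n%:R `^ (2 * alpha).
Proof.
rewrite -[leLHS]mulr1 ler_pM// ?exprn_ege1 ?invf_ge1//.
by rewrite -[leLHS](powRr0 (n%:R : R)) ler_powR ?ler1n// mulr_ge0.
Qed.

Lemma bound_const_ge1 : 1 <= f^-1 * n%:R `^ alpha.
Proof. by rewrite -policy_floorV invf_ge1 ?policy_floor_gt0 ?policy_floor_le1. Qed.

End clip_theory.

Variables (p gamma c Cb : R) (K : nat) (G : set (O -> R)).
Hypotheses (p0 : 0 < p) (gamma0 : 0 < gamma).
Hypothesis K0 : (0 < K)%N.
Hypothesis Kgamma : 2 * alpha + gamma <= K%:R * gamma.
Hypothesis Kexp : forall k, (k <= K)%N ->
  alpha + level_exponent alpha gamma k + p * (k%:R * gamma) + 3 * gamma <= 1.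
Hypotheses (c1 : 1 <= c) (Cb0 : 0 <= Cb).
Hypothesis Gm : forall g, G g -> measurable_fun setT g /\ forall o, 0 <= g o <= 1.
Hypothesis Gb : forall eps, 0 < eps <= 1 -> exists N lo up,
  N%:R <= expR (Cb * eps `^ (- p)) /\ bracket_family Lam G eps N lo up.
Hypothesis gG : forall t w, (1 <= t)%N -> G (gpol t w).

Let c0 : 0 <= c := le_trans ler01 c1.
Let Lm := fine (Lam setT).
Let Lm0 : 0 <= Lm. Proof. exact: fine_ge0. Qed.

(** A bound along one fixed trajectory, uniform over the rounds from [n + 2] on; round [n + 1] is
    excluded because its estimators are default values. *)
Definition window_bigO (u b : nat -> nat -> R) := exists k n0, forall n,
  (n0 <= n)%N -> forall t, (n.+1 < t <= 2 * n)%N -> `|u n t| <= k * b n t.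

Lemma window_bigOD u v b : window_bigO u b -> window_bigO v b ->
  window_bigO (fun n t => u n t + v n t) b.
Proof.
move=> [k [n0 h]] [k' [n1 h']]; exists (k + k'), (maxn n0 n1) => n.
rewrite geq_max => /andP[nn0 nn1] t nt; rewrite mulrDl (le_trans (ler_normD _ _))//.
by rewrite lerD ?h ?h'.
Qed.

(** The martingale bound divided by the sample size, plus the drift: [theta] is of order [n^alpha]
    and [psi] moves by [n^(-beta)]. *)
Definition plugin_error n t : R :=
  n%:R `^ (1 - gamma) / (t - n.+1)%:R + n%:R `^ (alpha - beta).

(** Two rounds are compared with each other, since the estimator averages [psi] over past rounds
    whereas the target uses [psi] of the current one. *)
Definition stable (w : Om) (psi : nat -> nat -> Om -> O -> R) := exists k n0,
  forall n, (n0 <= n)%N -> forall s t, (n < s <= 2 * n)%N -> (n < t <= 2 * n)%N ->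
  \int[Lam]_o `|psi n s w o - psi n t w o| <= k * n%:R `^ (- beta).

Definition est (comp : nat -> nat -> nat -> Om -> O -> R) n t w : R :=
  (t - n.+1)%:R^-1 *
    \sum_(n.+1 <= s < t) comp n s t w (ob s w) / q n s w (ob s w).

Definition tgt (comp : nat -> nat -> nat -> Om -> O -> R) n t w : R :=
  \int[Lam]_o comp n t t w o.

Lemma bmeas_gpol t w : (1 <= t)%N -> bmeas (gpol t w).
Proof.
move=> t1; have [mg g01] := Gm (gG w t1); split=> //.
by exists 1 => o; case/andP: (g01 o) => ? ?; rewrite ger0_norm.
Qed.

Lemma plugin_component_as (psi : nat -> nat -> Om -> O -> R) (theta : nat -> R -> R) :
  (forall n t, (n < t)%N -> measurable_fun
     [set: g_sigma_algebraType (F t.-1) * O] (fun z => psi n t z.1 z.2)) ->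
  (forall n t w o, `|psi n t w o| <= 2 * c ^+ 2) ->
  (forall n, measurable_fun setT (theta n)) ->
  (forall n u v, (0 < n)%N ->
     `|theta n u - theta n v| <= f^-1 ^+ 2 * n%:R `^ (2 * alpha) * `|u - v|) ->
  (forall n u, (0 < n)%N -> `|theta n u| <= f^-1 * n%:R `^ alpha) ->
  {ae P, forall w, stable w psi} ->
  let comp n s t w o := psi n s w o * theta n (gpol t w o) in
  {ae P, forall w,
    window_bigO (fun n t => est comp n t w - tgt comp n t w) plugin_error}.
Proof.
move=> mpsi psiC mtheta thetaL thetaB stab comp.
have C1 : 1 <= 2 * c ^+ 2 by rewrite -[leLHS]mulr1 ler_pM ?exprn_ege1// ler1n.
have := centered_sum_rate_as alpha0 f0 f1 dsg p0 gamma0 K0 Kgamma Kexp C1 Cb0 Gm Gb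
  mpsi psiC mtheta thetaL thetaB.
set cc := chain_constant _ _ _ _ => rate.
apply: filterS2 rate stab => w [n0 rate] [k [n1 stab]].
exists (Num.max cc (f^-1 * k)), (maxn (maxn n0 n1) 1) => n.
rewrite !geq_max -andbA => /and3P[nn0 nn1 n_gt0] t nt.
have nt' : (n < t <= 2 * n)%N by case/andP: nt => nt tn; rewrite ltnW.
have m0 : 0 < (t - n.+1)%:R :> R by rewrite ltr0n subn_gt0; case/andP: nt.
have t1 : (1 <= t)%N by case/andP: nt' => nt0 _; exact: leq_ltn_trans nt0.
have bth : bmeas (fun o => theta n (gpol t w o)).
  split; first exact: measurableT_comp (mtheta n) (bmeas_gpol w t1).1.
  by exists (f^-1 * n%:R `^ alpha) => o; exact: thetaB.
have bpsi s : (n < s)%N -> bmeas (psi n s w).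
  by move=> ns; exact: (bmeas_psi (mpsi n) (psiC n) w ns).
(* Both integrals carry the same [theta (gpol t w o)]: after centering, only the difference between
   [psi] at rounds [s] and [t] remains. *)
pose bias s := \int[Lam]_o (psi n s w o * theta n (gpol t w o)) -
  \int[Lam]_o (psi n t w o * theta n (gpol t w o)).
have estE : est comp n t w - tgt comp n t w = (t - n.+1)%:R^-1 *
    (centered_sum Lam ob (q n) n (psi n) (fun o => theta n (gpol t w o)) t w +
     \sum_(n.+1 <= s < t) bias s).
  rewrite /est /tgt /bias /centered_sum !sumrB sumr_const_nat -mulr_natl /comp.
  by field; rewrite gt_eqF.
have bias_le s : (n < s < t)%N -> `|bias s| <= f^-1 * k * n%:R `^ (alpha - beta).
  move=> /andP[ns st]; have sn : (n < s <= 2 * n)%N.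
    by rewrite ns (leq_trans (ltnW st))//; case/andP: nt.
  have bs := bpsi s ns; have bt := bpsi t (leq_trans ns (ltnW st)).
  rewrite /bias -bmeas_RintegralB; [|exact: bmeasM|exact: bmeasM].
  apply: le_trans (bmeas_normr_Rintegral _ _) _.
    by apply: bmeasB; exact: bmeasM.
  apply: (@le_trans _ _ (\int[Lam]_o (f^-1 * n%:R `^ alpha * `|psi n s w o - psi n t w o|))).
    apply: bmeas_le_Rintegral.
    - by apply: bmeas_norm; apply: bmeasB; exact: bmeasM.
    - by apply: bmeasM; [exact: bmeas_cst|apply: bmeas_norm; exact: bmeasB].
    - by move=> o; rewrite -mulrBl normrM mulrC ler_wpM2r// thetaB.
  rewrite bmeas_RintegralZl; last by apply: bmeas_norm; exact: bmeasB.
  have -> : f^-1 * k * n%:R `^ (alpha - beta) =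
      f^-1 * n%:R `^ alpha * (k * n%:R `^ (- beta)).
    rewrite powRD; first by ring.
    by apply/implyP => _; rewrite pnatr_eq0 -lt0n.
  by rewrite ler_wpM2l ?mulr_ge0 ?powR_ge0 ?invr_ge0 ?(ltW f0)// stab.
rewrite estE normrM (ger0_norm (x := _^-1)) ?invr_ge0// /plugin_error.
apply: (@le_trans _ _ ((t - n.+1)%:R^-1 * (cc * n%:R `^ (1 - gamma) +
    (f^-1 * k * n%:R `^ (alpha - beta)) * (t - n.+1)%:R))).
  rewrite ler_wpM2l ?invr_ge0// (le_trans (ler_normD _ _))// lerD//.
    exact: rate (gG w t1).
  rewrite mulr_natr -sumr_const_nat (le_trans (ler_norm_sum _ _ _))//.
  by apply: ler_sum_nat => s /bias_le.
rewrite mulrDr mulrDr lerD//.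
  rewrite mulrC -mulrA ler_wpM2r ?divr_ge0 ?powR_ge0//.
  by rewrite le_max lexx.
rewrite mulrC mulfK ?gt_eqF// ler_wpM2r ?powR_ge0//.
by rewrite le_max lexx orbT.
Qed.

Variables r e : nat -> nat -> Om -> O -> R.
Hypothesis mr : forall n t, (n < t)%N -> measurable_fun
  [set: g_sigma_algebraType (F t.-1) * O] (fun z => r n t z.1 z.2).
Hypothesis me : forall n t, (n < t)%N -> measurable_fun
  [set: g_sigma_algebraType (F t.-1) * O] (fun z => e n t z.1 z.2).
Hypothesis rc : forall n t w o, `|r n t w o| <= c.
Hypothesis ec : forall n t w o, `|e n t w o| <= c.
Hypothesis stab_r : {ae P, forall w, stable w r}.
Hypothesis stab_e : {ae P, forall w, stable w e}.

(* With r and e the two parts of the score, xi_t is r / q + e at O_t, and comp1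
   and comp2 are q times this quantity and q times its square. *)
Definition comp1 n s t w o := r n s w o + e n s w o * q n t w o.

Definition comp2 n s t w o :=
  r n s w o ^+ 2 * (q n t w o)^-1 + 2 * (r n s w o * e n s w o)
  + e n s w o ^+ 2 * q n t w o.

Let bmeas_r n t w : (n < t)%N -> bmeas (r n t w).
Proof. by move=> nt; exact: (bmeas_psi (mr (n := n)) (rc n) w nt). Qed.

Let bmeas_e n t w : (n < t)%N -> bmeas (e n t w).
Proof. by move=> nt; exact: (bmeas_psi (me (n := n)) (ec n) w nt). Qed.

Let bmeas_qt n t w : (0 < n)%N -> (n < t)%N -> bmeas (q n t w).
Proof. by move=> n0 nt; exact: (bmeas_q (dsg n0) w nt). Qed.

Let bmeas_qVt n t w : (0 < n)%N -> (n < t)%N -> bmeas (fun o => (q n t w o)^-1).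
Proof. by move=> n0 nt; exact: (bmeas_qV (dsg n0) w nt). Qed.

Lemma stable_prod u v w : 
  (forall n t, (n < t)%N -> bmeas (u n t w)) ->
  (forall n t, (n < t)%N -> bmeas (v n t w)) ->
  (forall n t o, `|u n t w o| <= c) -> (forall n t o, `|v n t w o| <= c) ->
  stable w u -> stable w v -> stable w (fun n t w o => u n t w o * v n t w o).
Proof.
move=> bu bv uc vc [k [n0 su]] [k' [n1 sv]].
exists (c * (k + k')), (maxn n0 n1) => n; rewrite geq_max => /andP[nn0 nn1] s t ns nt.
have /andP[ns' _] := ns; have /andP[nt' _] := nt.
have bs := bu n s ns'; have bt := bu n t nt'; have bs' := bv n s ns'; have bt' := bv n t nt'.
have b1 := bmeas_norm (bmeasB bs bt); have b2 := bmeas_norm (bmeasB bs' bt').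
apply: (@le_trans _ _ (\int[Lam]_o (c * (`|u n s w o - u n t w o|
    + `|v n s w o - v n t w o|)))).
  apply: bmeas_le_Rintegral.
  - by apply: bmeas_norm; apply: bmeasB; exact: bmeasM.
  - by apply: bmeasM; [exact: bmeas_cst|exact: bmeasD].
  - move=> o; have -> : u n s w o * v n s w o - u n t w o * v n t w o =
      (u n s w o - u n t w o) * v n s w o + u n t w o * (v n s w o - v n t w o) by ring.
    rewrite [leRHS]mulrDr (le_trans (ler_normD _ _))// !normrM [X in _ <= X + _]mulrC.
    by apply: lerD; [rewrite ler_wpM2l|rewrite ler_wpM2r].
rewrite bmeas_RintegralZl ?bmeas_RintegralD//; last exact: bmeasD.
by rewrite -mulrA ler_wpM2l// mulrDl lerD// ?su ?sv.
Qed.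

Let mtheta1 (n : nat) : measurable_fun setT ((fun=> 1) : R -> R).
Proof. exact: measurable_cst. Qed.
Let lip1 n (u v : R) : (0 < n)%N -> `|1 - 1 : R| <=
  f^-1 ^+ 2 * n%:R `^ (2 * alpha) * `|u - v|.
Proof.
move=> n0; rewrite subrr normr0 mulr_ge0// (le_trans ler01)//.
exact: lip_const_ge1.
Qed.
Let bound1 n (u : R) : (0 < n)%N -> `|1 : R| <= f^-1 * n%:R `^ alpha.
Proof. by move=> n0; rewrite normr1 bound_const_ge1. Qed.
Let clipL n u v : (0 < n)%N -> `|clip n u - clip n v| <=
  f^-1 ^+ 2 * n%:R `^ (2 * alpha) * `|u - v|.
Proof.
move=> n0; apply: le_trans (clip_lip n u v) _.
by rewrite ler_peMl// lip_const_ge1.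
Qed.
Let clipB n u : (0 < n)%N -> `|clip n u| <= f^-1 * n%:R `^ alpha.
Proof.
move=> n0; rewrite gtr0_norm ?clip_gt0// (le_trans (clip_le1 n u))//.
exact: bound_const_ge1.
Qed.
Let mclipV n : measurable_fun setT (fun u => (clip n u)^-1).
Proof.
rewrite (_ : (fun u => _) = (fun u => clip n u `^ (-1))).
  by apply: (measurableT_comp (f := (@powR R)^~ (-1))) => //; exact: measurable_clip.
apply/funext => u; rewrite powRN powRr1// le_min ler01 andbT le_max.
by rewrite mulr_ge0 ?orbT ?powR_ge0// ltW.
Qed.
Let clipVB n u : (0 < n)%N -> `|(clip n u)^-1| <= f^-1 * n%:R `^ alpha.
Proof.
move=> n0; rewrite normfV gtr0_norm ?clip_gt0// -policy_floorV.
by rewrite lef_pV2 ?posrE ?clip_gt0 ?policy_floor_gt0 ?clip_ge.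
Qed.
Let cc2 : c <= 2 * c ^+ 2.
Proof. by rewrite expr2 mulrA ler_peMl//; have := c1; lra. Qed.
Let sqc2 u v : `|u| <= c -> `|v| <= c -> `|u * v| <= 2 * c ^+ 2.
Proof.
move=> uc vc; rewrite normrM (@le_trans _ _ (c ^+ 2))//.
  by rewrite expr2 ler_pM.
by rewrite ler_peMl ?sqr_ge0// ler1n.
Qed.

Lemma plugin1_as : {ae P, forall w,
  window_bigO (fun n t => est comp1 n t w - tgt comp1 n t w) plugin_error}.
Proof.
have A1 := @plugin_component_as r (fun _ _ => 1) mr
  (fun n t w o => le_trans (rc n t w o) cc2) mtheta1 lip1 bound1 stab_r.
have A2 := @plugin_component_as e clip me
  (fun n t w o => le_trans (ec n t w o) cc2) measurable_clip clipL clipB stab_e.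
apply: filterS2 A1 A2 => w A1 A2.
have [k [n0 h]] := window_bigOD A1 A2.
exists k, (maxn n0 1) => n; rewrite geq_max => /andP[nn0 n_gt0] t nt.
apply: le_trans (h n nn0 t nt); rewrite le_eqVlt; apply/orP; left; apply/eqP; congr `|_|.
rewrite addrACA -opprD; congr (_ - _).
  rewrite /est -mulrDr -big_split/=; congr (_ * _); apply: eq_bigr => s _.
  by rewrite /comp1 mulr1 mulrDl.
have nt' : (n < t)%N by case/andP: nt => nt _; exact: ltnW.
rewrite /tgt -bmeas_RintegralD//.
- by apply: eq_Rintegral => o _; rewrite /comp1 mulr1.
- by apply: bmeasM; [exact: bmeas_r|exact: bmeas_cst].
- by apply: bmeasM; [exact: bmeas_e|exact: bmeas_qt].
Qed.

Lemma plugin2_as : {ae P, forall w,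
  window_bigO (fun n t => est comp2 n t w - tgt comp2 n t w) plugin_error}.
Proof.
have S1 : {ae P, forall w, stable w (fun n t w o => r n t w o * r n t w o)}.
  apply: filterS stab_r => w sr; apply: stable_prod => // n t; exact: bmeas_r.
have S2 : {ae P, forall w, stable w (fun n t w o => r n t w o * e n t w o)}.
  apply: filterS2 stab_r stab_e => w sr se.
  by apply: stable_prod => // n t; [exact: bmeas_r|exact: bmeas_e].
have S3 : {ae P, forall w, stable w (fun n t w o => e n t w o * e n t w o)}.
  apply: filterS stab_e => w se; apply: stable_prod => // n t; exact: bmeas_e.
have A1 := @plugin_component_as _ (fun n u => (clip n u)^-1)
  (fun n t nt => measurable_funM (mr nt) (mr nt))
  (fun n t w o => sqc2 (rc n t w o) (rc n t w o)) mclipV (fun n u v n0 => clipV_lip n0 u v) clipVB S1.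
have A2 := @plugin_component_as _ (fun _ _ => 1)
  (fun n t nt => measurable_funM (mr nt) (me nt))
  (fun n t w o => sqc2 (rc n t w o) (ec n t w o)) mtheta1 lip1 bound1 S2.
have A3 := @plugin_component_as _ clip
  (fun n t nt => measurable_funM (me nt) (me nt))
  (fun n t w o => sqc2 (ec n t w o) (ec n t w o)) measurable_clip clipL clipB S3.
apply: filterS3 A1 A2 A3 => w A1 A2 A3.
pose cA n s t w o := r n s w o * r n s w o * (clip n (gpol t w o))^-1.
pose cB n s (t : nat) w o := r n s w o * e n s w o * 1.
pose cC n s t w o := e n s w o * e n s w o * clip n (gpol t w o).
have [k [n0 h]] : window_bigO (fun n t => (est cA n t w - tgt cA n t w) +
    ((est cB n t w - tgt cB n t w) + (est cB n t w - tgt cB n t w)) +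
    (est cC n t w - tgt cC n t w)) plugin_error.
  exact: window_bigOD (window_bigOD A1 (window_bigOD A2 A2)) A3.
exists k, (maxn n0 1) => n; rewrite geq_max => /andP[nn0 n_gt0] t nt.
apply: le_trans (h n nn0 t nt); rewrite le_eqVlt; apply/orP; left; apply/eqP; congr `|_|.
have nt' : (n < t)%N by case/andP: nt => nt _; exact: ltnW.
have br := bmeas_r w nt'; have be := bmeas_e w nt'.
have b1 : bmeas (cA n t t w).
  by apply: bmeasM; [exact: bmeasM|exact: bmeas_qVt].
have b2 : bmeas (cB n t t w).
  by apply: bmeasM; [exact: bmeasM|exact: bmeas_cst].
have b3 : bmeas (cC n t t w).
  by apply: bmeasM; [exact: bmeasM|exact: bmeas_qt].
have cE s o : comp2 n s t w o = cA n s t w o + (cB n s t w o + cB n s t w o) + cC n s t w o.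
  by rewrite /comp2 /cA /cB /cC /q; ring.
have -> : est comp2 n t w = est cA n t w + (est cB n t w + est cB n t w) + est cC n t w.
  rewrite /est -!mulrDr -!big_split/=; congr (_ * _); apply: eq_bigr => s _.
  by rewrite cE !mulrDl.
have -> : tgt comp2 n t w = tgt cA n t w + (tgt cB n t w + tgt cB n t w) + tgt cC n t w.
  rewrite /tgt; under eq_Rintegral do rewrite cE.
  have b4 := bmeasD b2 b2; have b5 := bmeasD b1 b4.
  by rewrite !bmeas_RintegralD.
by ring.
Qed.

Lemma tgt1_le n t w : (0 < n)%N -> (n < t)%N -> `|tgt comp1 n t w| <= 2 * c * Lm.
Proof.
move=> n0 nt; have br := bmeas_r w nt; have be := bmeas_e w nt.
have b1 : bmeas (comp1 n t t w) by apply: bmeasD => //; apply: bmeasM => //; exact: bmeas_qt.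
apply: le_trans (bmeas_normr_Rintegral _ b1) _; rewrite -Rintegral_cst//.
apply: bmeas_le_Rintegral; [exact: bmeas_norm|exact: bmeas_cst|move=> o].
rewrite mulr_natl mulr2n (le_trans (ler_normD _ _))// lerD// normrM.
by rewrite -[leRHS]mulr1 ler_pM// gtr0_norm ?clip_gt0 ?clip_le1.
Qed.

Lemma tgt2_le n t w : (0 < n)%N -> (n < t)%N ->
  `|tgt comp2 n t w| <= 4 * c ^+ 2 * Lm * (f^-1 * n%:R `^ alpha).
Proof.
move=> n0 nt; have br := bmeas_r w nt; have be := bmeas_e w nt.
have b1 : bmeas (comp2 n t t w).
  apply: bmeasD; last by apply: bmeasM; [exact: bmeasX|exact: bmeas_qt].
  apply: bmeasD; first by apply: bmeasM; [exact: bmeasX|exact: bmeas_qVt].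
  by apply: bmeasM; [exact: bmeas_cst|exact: bmeasM].
apply: le_trans (bmeas_normr_Rintegral _ b1) _.
rewrite mulrAC -Rintegral_cst//.
apply: bmeas_le_Rintegral; [exact: bmeas_norm|exact: bmeas_cst|move=> o].
set B := f^-1 * _; have B1 : 1 <= B := bound_const_ge1 n0.
have sq u : `|u| <= c -> u ^+ 2 <= c ^+ 2.
  by move=> uc; rewrite -real_normK ?num_real// lerXn2r ?nnegrE.
have q1 := clip_le1 n (gpol t w o); have q0 := clip_gt0 n0 (gpol t w o).
have h1 : `|r n t w o ^+ 2 * (q n t w o)^-1| <= c ^+ 2 * B.
  by rewrite normrM ger0_norm ?sqr_ge0// ler_pM ?sqr_ge0 ?sq ?clipVB.
have h2 : `|2 * (r n t w o * e n t w o)| <= 2 * c ^+ 2 * B.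
  by rewrite -[leLHS]mulr1 ler_pM// normrM ger0_norm// ler_wpM2l// normrM expr2 ler_pM.
have h3 : `|e n t w o ^+ 2 * q n t w o| <= c ^+ 2 * B.
  by rewrite normrM ger0_norm ?sqr_ge0// ler_pM ?sqr_ge0 ?sq// gtr0_norm// (le_trans q1).
have -> : 4 * c ^+ 2 * B = (c ^+ 2 * B + 2 * c ^+ 2 * B) + c ^+ 2 * B by ring.
rewrite (le_trans (ler_normD _ _))// lerD//.
by rewrite (le_trans (ler_normD _ _))// lerD.
Qed.

(* Expand int q (r/q + e - tgt1)^2 and use that q has mass at most 1. *)
Lemma sqr_tgt1_le n t w : (0 < n)%N -> (n < t)%N -> \int[Lam]_o q n t w o <= 1 ->
  tgt comp1 n t w ^+ 2 <= tgt comp2 n t w.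
Proof.
move=> n0 nt mass; have br := bmeas_r w nt; have be := bmeas_e w nt.
have bq := bmeas_qt w n0 nt; have bqV := bmeas_qVt w n0 nt.
have b1 : bmeas (comp1 n t t w) by apply: bmeasD => //; exact: bmeasM.
have b2 : bmeas (comp2 n t t w).
  apply: bmeasD; last by apply: bmeasM => //; exact: bmeasX.
  apply: bmeasD; first by apply: bmeasM => //; exact: bmeasX.
  by apply: bmeasM; [exact: bmeas_cst|exact: bmeasM].
set T := tgt comp1 n t w.
have : 0 <= \int[Lam]_o (comp2 n t t w o - 2 * T * comp1 n t t w o + T ^+ 2 * q n t w o).
  apply: Rintegral_ge0 => o _; have q0 : 0 < q n t w o := clip_gt0 n0 _.
  have -> : comp2 n t t w o - 2 * T * comp1 n t t w o + T ^+ 2 * q n t w o =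
    q n t w o * (r n t w o / q n t w o + e n t w o - T) ^+ 2.
    by rewrite /comp1 /comp2; field; rewrite gt_eqF.
  by rewrite mulr_ge0 ?sqr_ge0 ?(ltW q0).
have b3 := bmeasM (@bmeas_cst _ _ O (2 * T)) b1.
have b4 := bmeasM (@bmeas_cst _ _ O (T ^+ 2)) bq.
rewrite bmeas_RintegralD ?bmeas_RintegralB ?bmeas_RintegralZl//; last exact: bmeasB.
rewrite -/(tgt comp2 n t w) -/(tgt comp1 n t w) -/T.
have : T ^+ 2 * \int[Lam]_o q n t w o <= T ^+ 2 by rewrite ler_piMr ?sqr_ge0.
by rewrite -[2 * T * T]mulrA -expr2; exact: le_of_expanded_sqr.
Qed.

(** Each summand is at most [2 c] divided by the density at the observation, so the total importance
    weight bounds the sum. The estimator is thus bounded once the sample size exceeds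
    [n^(alpha + gamma)]. *)
Lemma est1_le_as : {ae P, forall w,
  window_bigO (fun n t => est comp1 n t w)
    (fun n t => 1 + n%:R `^ (alpha + gamma) / (t - n.+1)%:R)}.
Proof.
have [k k0] := sum_inv_density_as f0 dsg gamma0.
apply: filterS => w [n0 h]; exists (2 * c * k), (maxn n0 1) => n.
rewrite geq_max => /andP[nn0 n_gt0] t nt.
have m0 : 0 < (t - n.+1)%:R :> R by rewrite ltr0n subn_gt0; case/andP: nt.
rewrite /est normrM normfV (gtr0_norm m0) mulrC ler_pdivrMr//.
have -> : 2 * c * k * (1 + n%:R `^ (alpha + gamma) / (t - n.+1)%:R) * (t - n.+1)%:R =
  2 * c * (k * ((t - n.+1)%:R + n%:R `^ (alpha + gamma))).
  by field; rewrite gt_eqF.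
have nt' : (n < t <= 2 * n)%N by case/andP: nt => nt tn; rewrite ltnW.
apply: le_trans (_ : _ <= 2 * c * \sum_(n.+1 <= s < t) (q n s w (ob s w))^-1) _; last first.
  by rewrite ler_wpM2l ?mulr_ge0//; exact: h.
rewrite mulr_sumr (le_trans (ler_norm_sum _ _ _))//; apply: ler_sum => s _.
have q0 : 0 < q n s w (ob s w) := clip_gt0 n_gt0 _.
rewrite normrM normfV (gtr0_norm q0) ler_wpM2r ?invr_ge0 ?(ltW q0)//.
rewrite mulr_natl mulr2n (le_trans (ler_normD _ _))// lerD// normrM.
by rewrite -[leRHS]mulr1 ler_pM// gtr0_norm ?clip_gt0 ?clip_le1.
Qed.

End plugin.

(** * Averaging the errors over the second half *)

Section averaging.
Context {R : realType}.
Variables (alpha beta gamma nu : R).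
Hypotheses (alpha0 : 0 <= alpha) (gamma0 : 0 < gamma).
Hypothesis exps : 3 * alpha + 4 * gamma <= 1.
Hypotheses (nu_gamma : nu <= gamma / 2) (nu_beta : nu <= beta - alpha).

(** The additional square is the price of squaring the first moment estimator; it exceeds 1 only for
    sample sizes below [n^(alpha + gamma)]. *)
Definition sigma_error n t : R := plugin_error alpha beta gamma n t
  + (n%:R `^ (alpha + gamma) / (t - n.+1)%:R) ^+ 2.

Lemma plugin_error_ge0 n t : 0 <= plugin_error alpha beta gamma n t.
Proof. by rewrite addr_ge0 ?divr_ge0 ?powR_ge0. Qed.

Lemma plugin_le_sigma_error n t :
  plugin_error alpha beta gamma n t <= sigma_error n t.
Proof. by rewrite lerDl sqr_ge0. Qed.

(** The martingale part sums to a harmonic series, whose logarithm is bounded by a multiple of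
    [n^(gamma / 2)], hence the halved exponent. The squared part is summable in the sample size, and
    [3 alpha + 4 gamma <= 1] makes its prefactor negligible. *)
Lemma sum_sigma_error n : (0 < n)%N ->
  n%:R^-1 * \sum_(n.+2 <= t < (2 * n).+1) sigma_error n t
    <= (4 + 2 / gamma) * n%:R `^ (- nu).
Proof.
move=> n0; have X1 : 1 <= n%:R :> R by rewrite ler1n.
have X0 : 0 < n%:R :> R by rewrite ltr0n.
have pwD (a b : R) : n%:R `^ (a + b) = n%:R `^ a * n%:R `^ b.
  by rewrite powRD//; apply/implyP => _; rewrite gt_eqF.
have pw1 : n%:R `^ (- 1) = n%:R^-1 :> R by rewrite powRN powRr1// ltW.
have sub1 : (n.-1 <= n)%N := leq_pred n.
have -> : \sum_(n.+2 <= t < (2 * n).+1) sigma_error n t =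
    n%:R `^ (1 - gamma) * \sum_(0 <= k < n.-1) k.+1%:R^-1 +
    n.-1%:R * n%:R `^ (alpha - beta) +
    (n%:R `^ (alpha + gamma)) ^+ 2 * \sum_(0 <= k < n.-1) (k.+1%:R^-1) ^+ 2.
  rewrite -{1}[n.+2]add0n big_addn.
  have -> : ((2 * n).+1 - n.+2 = n.-1)%N by lia.
  have -> : n.-1%:R * n%:R `^ (alpha - beta) =
      \sum_(0 <= k < n.-1) (n%:R `^ (alpha - beta) : R).
    by rewrite sumr_const_nat subn0 mulr_natl.
  rewrite !mulr_sumr -!big_split/=; apply: eq_bigr => k _.
  by rewrite /sigma_error /plugin_error (_ : (k + n.+2 - n.+1)%N = k.+1) ?exprMn//; lia.
set S1 := \sum_(0 <= k < n.-1) k.+1%:R^-1.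
set S2 := \sum_(0 <= k < n.-1) _ ^+ 2.
have S1_le : S1 <= (1 + 2 / gamma) * n%:R `^ (gamma / 2).
  apply: (@le_trans _ _ (\sum_(0 <= k < n) k.+1%:R^-1)).
    rewrite [leRHS](@big_cat_nat _ _ _ n.-1)//= lerDl; apply: sumr_ge0 => k _.
    by rewrite invr_ge0.
  apply: (le_trans (sum_inv_le n0)); rewrite mulrDl mul1r lerD//.
    by rewrite -[leLHS](powRr0 (n%:R : R)) ler_powR// divr_ge0// ltW.
  have := ln_le_powR (divr_gt0 gamma0 (ltr0n R 2)) X1.
  by rewrite invf_div.
have S2_le : S2 <= 2 := sum_inv_sqr_le2 n.-1.
rewrite !mulrDr.
have h1 : n%:R^-1 * (n%:R `^ (1 - gamma) * S1) <= (1 + 2 / gamma) * n%:R `^ (- nu).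
  rewrite mulrA -pw1 -pwD (le_trans (ler_wpM2l (powR_ge0 _ _) S1_le))//.
  rewrite mulrCA -pwD ler_wpM2l ?addr_ge0 ?divr_ge0 ?(ltW gamma0)//.
  by rewrite ler_powR//; have := nu_gamma; lra.
have h2 : n%:R^-1 * (n.-1%:R * n%:R `^ (alpha - beta)) <= n%:R `^ (- nu).
  rewrite mulrA -[leRHS]mul1r ler_pM ?powR_ge0 ?mulr_ge0 ?invr_ge0//.
    by rewrite mulrC ler_pdivrMr// mul1r ler_nat.
  by rewrite ler_powR//; have := nu_beta; lra.
have h3 : n%:R^-1 * ((n%:R `^ (alpha + gamma)) ^+ 2 * S2) <= 2 * n%:R `^ (- nu).
  rewrite expr2 -pwD mulrA -pw1 -pwD mulrC ler_pM ?powR_ge0//.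
    by apply: sumr_ge0 => k _; rewrite sqr_ge0.
  rewrite ler_powR//; have := exps; have := nu_gamma; have := alpha0; have := gamma0; lra.
have -> : (4 + 2 / gamma) * n%:R `^ (- nu) = (1 + 2 / gamma) * n%:R `^ (- nu) +
  n%:R `^ (- nu) + 2 * n%:R `^ (- nu) by ring.
by rewrite lerD// lerD.
Qed.

(** Round [n + 1] is treated apart: its default values may be wrong by [n^alpha], which averaging
    reduces to [n^(alpha - 1)]. *)
Lemma mean_error_le (e : nat -> nat -> R) k0 : window_bigO e sigma_error ->
  (forall n, (0 < n)%N -> `|e n n.+1| <= k0 * n%:R `^ alpha) ->
  exists k n0, forall n, (n0 <= n)%N ->
    n%:R^-1 * \sum_(n.+1 <= t < (2 * n).+1) `|e n t| <= k * n%:R `^ (- nu).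
Proof.
move=> [k [n0 h]] e0; exists (`|k0| + `|k| * (4 + 2 / gamma)), (maxn n0 1) => n.
rewrite geq_max => /andP[nn0 n_gt0].
have X1 : 1 <= n%:R :> R by rewrite ler1n.
rewrite big_ltn ?ltnS; last by rewrite mul2n -addnn -addn1 leq_add2l.
rewrite mulrDr mulrDl lerD//.
  apply: (@le_trans _ _ (n%:R^-1 * (`|k0| * n%:R `^ alpha))).
    rewrite ler_wpM2l ?invr_ge0// (le_trans (e0 n n_gt0))// ler_wpM2r ?powR_ge0//.
    exact: ler_norm.
  rewrite mulrCA ler_wpM2l//.
  have -> : n%:R^-1 = n%:R `^ (- 1) :> R by rewrite powRN powRr1.
  rewrite -powRD; last by apply/implyP => _; rewrite pnatr_eq0 -lt0n.
  rewrite ler_powR//; have := exps; have := nu_gamma; have := alpha0; have := gamma0; lra.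
apply: (@le_trans _ _ (n%:R^-1 *
    \sum_(n.+2 <= t < (2 * n).+1) (`|k| * sigma_error n t))).
  rewrite ler_wpM2l ?invr_ge0//; apply: ler_sum_nat => t.
  rewrite ltnS => nt; rewrite (le_trans (h n nn0 t nt))// ler_wpM2r ?ler_norm//.
  by rewrite (le_trans (plugin_error_ge0 n t))// plugin_le_sigma_error.
rewrite -mulr_sumr mulrCA -[leRHS]mulrA ler_wpM2l//.
exact: sum_sigma_error.
Qed.

End averaging.

Section limsup.
Context {R : realType}.

Lemma limn_esup_lt_pinfty (u : (\bar R)^nat) (k : R) n0 :
  (forall n, (n0 <= n)%N -> (u n <= k%:E)%E) -> (limn_esup u < +oo)%E.
Proof.
move=> h; rewrite limn_esup_lim; apply: (@le_lt_trans _ _ k%:E); last by rewrite ltry.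
apply: lime_le; first exact: is_cvg_esups.
exists n0 => // m /= n0m; apply: ge_ereal_sup => _ [n /= mn <-].
by apply: h; exact: leq_trans mn.
Qed.

Lemma limn_esup_bounded (u : (\bar R)^nat) : (limn_esup u < +oo)%E ->
  exists k n0, forall n, (n0 <= n)%N -> (u n <= k%:E)%E.
Proof.
move=> /ereal_inf_lt[_ [V [n0 _ n0V] <-]] supV.
have [k kV] : exists k : R, (ereal_sup (u @` V) <= k%:E)%E.
  move: supV; case: ereal_sup => [r _|//|_]; first by exists r.
  by exists 0; rewrite leNye.
exists k, n0 => n n0n; apply: le_trans kV; apply: ereal_sup_ubound; exists n => //.
exact: n0V.
Qed.

End limsup.

(** * Scores and brackets of the policy class *)

Section scores.
Context {R : realType} {dO dX dA dY : measure_display}.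
Context {Omega : measurableType dO} {X : measurableType dX}.
Context {A : measurableType dA} {Y : measurableType dY}.
Variables (P : probability Omega R) (PX : probability X R).
Variables (PY : R.-pker (X * A)%type ~> Y) (Pi : set (A -> X -> R)).
Variables (D : adaptive_data R Omega X A Y).
Context {k : Y -> Y -> R} (H : rkhs k).
Variables (a a' : A) (u0 : H) (mu1 mu2 : nat -> Omega -> A -> X -> H).
Hypothesis mA : forall B : set A, measurable B.
Hypothesis mk : measurable_fun setT (fun z : Y * Y => k z.1 z.2).
Hypothesis PiP : Pi `<=` [set g | cond_density g].
Hypothesis samp : adaptive_sampling P PX PY Pi D.
Hypotheses (ad1 : adapted_nuisance D mu1) (ad2 : adapted_nuisance D mu2).
Hypothesis u01 : `|u0| = 1.
Local Notation dot := (rkhs_dot H).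
Local Notation O := (X * A * Y)%type.
Local Notation F t := (g_sigma_algebraType (history D t)).

Definition residual (u : H) (m : A -> X -> H) (o : O) : R :=
  \1_[set a] o.1.2 * dot u (feature H o.2 - m a o.1.1) -
  \1_[set a'] o.1.2 * dot u (feature H o.2 - m a' o.1.1).

Definition effect (u : H) (m : A -> X -> H) (o : O) : R :=
  dot u (m a o.1.1) - dot u (m a' o.1.1).

(** On the event that the action equals [b], the denominator [g b x] is the density at the observed
    action; both target actions thus share one denominator, and the score splits into a weighted and
    an unweighted part. *)
Lemma dot_score_diff u g m t w :
  dot u (score_diff D a a' g m t w) =
    residual u m (obs D t w) / g (act D t w) (ctx D t w) + effect u m (obs D t w).
Proof.
have ind b (x : X) (y : A) : \1_[set b] y / g b x = \1_[set b] y / g y x :> R.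
  rewrite indicE; case: (boolP (y \in [set b])) => [|_]; last by rewrite !mul0r.
  by rewrite inE => ->.
rewrite /score_diff /score /residual /effect /= dotBr !dotDr !dotZr !ind; ring.
Qed.

Lemma norm_pilot_direction n w : `|pilot_direction D a a' mu1 u0 n w| = 1.
Proof.
rewrite /pilot_direction; case: ifPn => [v0|_] //.
by rewrite normrZ normfV normr_id mulVf// normr_eq0.
Qed.

Lemma hmeas_score (m : nat -> Omega -> A -> X -> H) s n b :
  adapted_nuisance D m -> (1 <= s <= n)%N ->
  hmeas (fun w : F n => score (pol D s w) (m s.-1 w) b
    (ctx D s w) (act D s w) (out D s w)).
Proof.
move=> adm sn; have s1 : (1 <= s)%N by case/andP: sn.
have mo := measurable_obs (D := D) sn.
have mctx : measurable_fun [set: F n] (ctx D s).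
  by apply: (measurableT_comp (f := fst \o fst)) mo; exact: measurableT_comp.
have mact : measurable_fun [set: F n] (act D s).
  by apply: (measurableT_comp (f := snd \o fst)) mo; exact: measurableT_comp.
have mout : measurable_fun [set: F n] (out D s).
  exact: (measurableT_comp (f := snd)) mo.
have sn' : (s.-1 <= n)%N by case/andP: sn => _; apply: leq_trans; exact: leq_pred.
have mid := measurable_fun_id_history (D := D) sn'.
have mz : measurable_fun setT (fun w : F n => (w : F s.-1, (b, ctx D s w))).
  by apply: measurable_fun_pair => //; exact: measurable_fun_pair.
have hm : hmeas (fun w : F n => m s.-1 w b (ctx D s w)).
  exact: (hmeas_comp mz (hmeas_strong (H := H) (adm s.-1))).
apply: hmeasD => //; apply: hmeasZ; last by apply: hmeasB => //; exact: hmeas_feature.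
apply: measurable_funM.
  by apply: (measurableT_comp (f := \1_[set b] : A -> R)) => //; exact: measurable_indic.
have mp : measurable_fun [set: F n] (fun w => pol D s w b (ctx D s w)).
  exact: (measurableT_comp (pol_adapted samp s1) mz).
rewrite (_ : (fun w => _) = (fun w => pol D s w b (ctx D s w) `^ (-1))).
  by apply: (measurableT_comp (f := (@powR R)^~ (-1))).
apply/funext => w; rewrite powRN powRr1//.
by have [_ g0 _] := PiP (pol_in_class samp w s1); exact: g0.
Qed.

Lemma hmeas_pilot_direction n t : (n <= t)%N ->
  hmeas (fun w : F t => pilot_direction D a a' mu1 u0 n w).
Proof.
move=> nt.
have hv : hmeas (fun w : F t => pilot_witness D a a' mu1 n w).
  apply: hmeasZ; first exact: measurable_cst.
  rewrite (_ : (fun w => _) = (fun w => \sum_(1 <= s < n.+1)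
      (if (1 <= s <= n)%N then phi_hat D a a' mu1 s w else 0))).
    apply: hmeas_sum => s; case: (boolP (1 <= s <= n)%N) => [/andP[s1 sn]|_].
      by apply: hmeasB; apply: hmeas_score => //; rewrite s1 (leq_trans sn).
    exact: hmeas_cst.
  by apply/funext => w; apply: eq_big_nat => s; rewrite ltnS => ->.
have mn := hmeas_norm mk hv.
(* The case distinction becomes a sum: if the witness vanishes the first summand is zero and the
   indicator selects [u0], otherwise the indicator vanishes. *)
rewrite (_ : (fun w => _) = (fun w => `|pilot_witness D a a' mu1 n w| `^ (-1) *:
    pilot_witness D a a' mu1 n w + \1_[set 0] `|pilot_witness D a a' mu1 n w| *: u0)).
  apply: hmeasD; apply: hmeasZ => //.
  - by apply: (measurableT_comp (f := (@powR R)^~ (-1))).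
  - by apply: (measurableT_comp (f := \1_[set 0] : R -> R)) => //; exact: measurable_indic.
  - exact: hmeas_cst.
apply/funext => w; rewrite /pilot_direction; set v := pilot_witness _ _ _ _ _ _.
have [->|v0] := eqVneq v 0; first by rewrite /= scaler0 add0r normr0 indicE mem_set// scale1r.
rewrite powRN powRr1// indicE memNset ?scale0r ?addr0//=.
by apply/eqP; rewrite normr_eq0.
Qed.

Let hdir n t : (n < t)%N ->
  hmeas (fun z : F t.-1 * O => pilot_direction D a a' mu1 u0 n z.1).
Proof.
move=> nt; apply: (hmeas_comp (u := fst)) => //.
by apply: hmeas_pilot_direction; rewrite -ltnS prednK// (leq_ltn_trans _ nt).
Qed.

Let hmu t b : hmeas (fun z : F t.-1 * O => mu2 t.-1 z.1 b z.2.1.1).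
Proof.
have mz : measurable_fun setT (fun z : F t.-1 * O => (z.1, (b, z.2.1.1))).
  apply: measurable_fun_pair => //; apply: measurable_fun_pair => //.
  by apply: measurableT_comp => //; apply: measurableT_comp.
exact: (hmeas_comp mz (hmeas_strong (H := H) (ad2 t.-1))).
Qed.

Lemma measurable_residual n t : (n < t)%N -> measurable_fun [set: F t.-1 * O]
  (fun z => residual (pilot_direction D a a' mu1 u0 n z.1) (mu2 t.-1 z.1) z.2).
Proof.
move=> nt; have hd := hdir nt.
have hf : hmeas (fun z : F t.-1 * O => feature H z.2.2).
  by apply: hmeas_feature; exact: measurableT_comp.
have mi b : measurable_fun [set: F t.-1 * O] (fun z => \1_[set b] z.2.1.2 : R).
  apply: (measurableT_comp (f := \1_[set b] : A -> R)); first exact: measurable_indic.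
  by apply: measurableT_comp => //; apply: measurableT_comp.
by apply: measurable_funB; apply: measurable_funM => //;
  apply: hmeas_dot => //; apply: hmeasB => //; exact: hmu.
Qed.

Lemma measurable_effect n t : (n < t)%N -> measurable_fun [set: F t.-1 * O]
  (fun z => effect (pilot_direction D a a' mu1 u0 n z.1) (mu2 t.-1 z.1) z.2).
Proof.
move=> nt; have hd := hdir nt.
by apply: measurable_funB; apply: hmeas_dot => //; exact: hmu.
Qed.

Lemma residual_le u m (kap B : R) o : `|u| = 1 -> (forall y, k y y <= kap) ->
  (forall b x, `|m b x| <= B) -> `|residual u m o| <= 2 * (Num.sqrt kap + B).
Proof.
move=> u1 kk mB.
have h b : `|\1_[set b] o.1.2 * dot u (feature H o.2 - m b o.1.1)| <= Num.sqrt kap + B.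
  rewrite normrM -[leRHS]mul1r ler_pM//.
    by rewrite indicE; case: (_ \in _); rewrite ?normr1 ?normr0.
  rewrite (le_trans (dot_cauchy_schwarz _ _))// u1 mul1r (le_trans (ler_normB _ _))//.
  by rewrite lerD// -[leLHS]normr_id -sqrtr_sqr sqr_norm_feature ler_wsqrtr.
by rewrite (le_trans (ler_normB _ _))// mulr_natl mulr2n lerD.
Qed.

Lemma effect_le u m (B : R) o : `|u| = 1 ->
  (forall b x, `|m b x| <= B) -> `|effect u m o| <= 2 * B.
Proof.
move=> u1 mB; rewrite (le_trans (ler_normB _ _))// mulr_natl mulr2n lerD//.
  by rewrite (le_trans (dot_cauchy_schwarz _ _))// u1 mul1r.
by rewrite (le_trans (dot_cauchy_schwarz _ _))// u1 mul1r.
Qed.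

Lemma residual_dist u m m' o : `|u| = 1 ->
  `|residual u m o - residual u m' o| <= 
  `|m a o.1.1 - m' a o.1.1| + `|m a' o.1.1 - m' a' o.1.1|.
Proof.
move=> u1; have -> : residual u m o - residual u m' o =
    \1_[set a'] o.1.2 * dot u (m a' o.1.1 - m' a' o.1.1) -
    \1_[set a] o.1.2 * dot u (m a o.1.1 - m' a o.1.1).
  by rewrite /residual !dotBr; ring.
have h b : `|\1_[set b] o.1.2 * dot u (m b o.1.1 - m' b o.1.1)| <=
    `|m b o.1.1 - m' b o.1.1|.
  rewrite normrM -[leRHS]mul1r ler_pM//.
    by rewrite indicE; case: (_ \in _); rewrite ?normr1 ?normr0.
  by rewrite (le_trans (dot_cauchy_schwarz _ _))// u1 mul1r.
by rewrite (le_trans (ler_normB _ _))// addrC lerD.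
Qed.

Lemma effect_dist u m m' o : `|u| = 1 ->
  `|effect u m o - effect u m' o| <= 
  `|m a o.1.1 - m' a o.1.1| + `|m a' o.1.1 - m' a' o.1.1|.
Proof.
move=> u1; have -> : effect u m o - effect u m' o =
    dot u (m a o.1.1 - m' a o.1.1) - dot u (m a' o.1.1 - m' a' o.1.1).
  by rewrite /effect !dotBr; ring.
have h b : `|dot u (m b o.1.1 - m' b o.1.1)| <= `|m b o.1.1 - m' b o.1.1|.
  by rewrite (le_trans (dot_cauchy_schwarz _ _))// u1 mul1r.
by rewrite (le_trans (ler_normB _ _))// lerD.
Qed.

End scores.

Section finite_actions.
Context {R : realType} {dX dA : measure_display}.
Context {X : measurableType dX} {A : measurableType dA}.

(** Total mass 1 leaves room for at most [1 / c] actions of probability at least [c]. *)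
Lemma finite_of_density_floor (g : A -> X -> R) (x : X) (c : R) :
  (forall B : set A, measurable B) -> 0 < c -> cond_density g ->
  (forall b, c <= g b x) -> finite_set [set: A].
Proof.
move=> mA c0 [_ g0 /(_ x) g1] cg; apply: contrapT => infA.
have : (\int[@counting A R]_b c%:E <= 1)%E.
  rewrite -g1; apply: ge0_le_integral => //.
  - by move=> b _; rewrite lee_fin ltW.
  - by move=> b _; rewrite lee_fin cg.
rewrite integral_cst// /= /counting asboolF// gt0_muley ?lte_fin//.
Qed.

Lemma exists_enum : finite_set [set: A] ->
  exists2 s : seq A, uniq s & forall b, b \in s.
Proof.
move=> /finite_seqP[s sE]; exists (undup s); first exact: undup_uniq.
by move=> b; rewrite mem_undup; have : [set: A] b by []; rewrite sE.
Qed.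

End finite_actions.

Lemma lne_le_EFin (R : realType) (x : \bar R) (y : R) :
  (lne x <= y%:E)%E -> (x <= (expR y)%:E)%E.
Proof.
case: x => [r| |] //=; last by move=> _; exact: leNye.
case: ifPn => [r0 _|]; first by rewrite lee_fin (le_trans r0)// expR_ge0.
by rewrite -ltNge lee_fin => r0 h; rewrite lee_fin -[leLHS]lnK// ler_expR.
Qed.

Lemma poweR_half_le (R : realType) (x : \bar R) (y : R) : (0 <= x)%E -> 0 <= y ->
  (x `^ 2^-1 <= y%:E)%E -> (x <= (y ^+ 2)%:E)%E.
Proof.
move=> x0 y0; case: x x0 => [r| |] //=.
  rewrite !lee_fin => r0 h; rewrite -[leLHS]powRr1// -(@mulVf _ 2%:R) ?pnatr_eq0//.
  by rewrite powRrM powR_mulrn ?powR_ge0// lerXn2r ?nnegrE ?powR_ge0.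
by rewrite invr_eq0 pnatr_eq0.
Qed.

Section brackets.
Context {R : realType} {dX dA dY : measure_display}.
Context {X : measurableType dX} {A : measurableType dA} {Y : measurableType dY}.
Variables (PX : probability X R) (PY : R.-pker (X * A)%type ~> Y) (s : seq A).
Hypothesis mA : forall B : set A, measurable B.
Hypotheses (us : uniq s) (sT : forall b, b \in s).
Local Notation O := (X * A * Y)%type.
Local Notation Lam := (obs_measure PX PY s).

Definition at_obs (g : A -> X -> R) (o : O) : R := g o.1.2 o.1.1.

Lemma measurable_at_obs (g : A -> X -> R) :
  (forall b, measurable_fun setT (g b)) -> measurable_fun setT (at_obs g).
Proof.
move=> mg; rewrite (_ : at_obs g = (fun o =>
    \sum_(b <- s) \1_[set b] o.1.2 * g b o.1.1)).
  apply: measurable_sum => b; apply: measurable_funM.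
    apply: (measurableT_comp (f := \1_[set b] : A -> R)); first exact: measurable_indic.
    by apply: measurableT_comp.
  by apply: measurableT_comp => //; apply: measurableT_comp.
apply/funext => o; rewrite /at_obs (bigD1_seq o.1.2)//= indicE mem_set// mul1r.
rewrite big1 ?addr0// => b bo; rewrite indicE memNset ?mul0r//= => ob.
by rewrite ob eqxx in bo.
Qed.

Lemma cond_density_le1 (g : A -> X -> R) b x : cond_density g -> 0 <= g b x <= 1.
Proof.
move=> [_ g0 /(_ x)]; rewrite g0 (ge0_integral_counting mA us sT); last first.
  by move=> c; rewrite lee_fin.
rewrite sumEFin => -[<-]; rewrite (big_rem b)//= lerDl sumr_ge0// => c _.
Qed.

Let clamp01 (u : R) : R := Num.min (Num.max u 0) 1.

(** Passing from ratios to densities multiplies the squared width by [p ^+ 2], which is at most the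
    weight [p] of the reference norm. The maximum repairs brackets whose ends are in the wrong
    order. *)
Lemma clamp01_width (l u p : R) : 0 <= p <= 1 ->
  (Num.max (clamp01 (l * p)) (clamp01 (u * p)) - clamp01 (l * p)) ^+ 2
    <= (u - l) ^+ 2 * p.
Proof.
move=> /andP[p0 p1].
apply: (@le_trans _ _ ((u * p - l * p) ^+ 2)); last first.
  rewrite -mulrBl exprMn ler_wpM2l ?sqr_ge0// expr2 ler_piMl//.
rewrite -(real_normK (num_real (u * p - l * p))) lerXn2r ?nnegrE//.
  by rewrite subr_ge0 le_max lexx.
move: (u * p) (l * p) => v k; rewrite /clamp01.
have [h1|h1] := leP v 0; have [h2|h2] := leP k 0.
- by rewrite min_l// maxxx subrr.
- rewrite (min_l (x := 0))//; have [h3|h3] := leP k 1.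
    by rewrite max_l ?subrr// ltW.
  by rewrite max_l ?subrr.
- rewrite (min_l (x := 0))// subr0; have [h3|h3] := leP v 1.
    by rewrite max_r ?(ltW h1)// (le_trans _ (ler_norm _))//; lra.
  by rewrite max_r// (le_trans _ (ler_norm _))//; lra.
have [h3|h3] := leP v 1; have [h4|h4] := leP k 1.
- have [h5|h5] := leP k v; first by rewrite ler_norm.
  by rewrite subrr.
- by rewrite max_l ?subrr.
- by rewrite max_r// (le_trans _ (ler_norm _))//; lra.
- by rewrite maxxx subrr.
Qed.

Variables (Pi : set (A -> X -> R)) (pi_ref : A -> X -> R) (C p : R).
Hypothesis PiP : Pi `<=` [set g | cond_density g].
Hypotheses (refP : cond_density pi_ref) (ref_gt0 : forall b x, 0 < pi_ref b x).
Hypothesis p0 : 0 < p.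
Hypothesis entropy : forall eps, 0 < eps ->
  (lne (bracketing_number (ref_norm PX pi_ref) (density_ratios Pi pi_ref) eps)
     <= (C * eps `^ (- p))%:E)%E.

(** Brackets of the ratios are multiplied by [pi_ref] and clamped to the unit interval. An infimum
    of cardinalities is only approached, up to 1, and [|C| + 1] absorbs this: for [eps <= 1] the
    power [y] of [eps] is at least 1, so [e^(C y) + 1 <= e^((|C| + 1) y)]. *)
Lemma exists_brackets eps : 0 < eps <= 1 -> exists N lo up,
  N%:R <= expR ((`|C| + 1) * eps `^ (- p)) /\
  bracket_family Lam [set at_obs g | g in Pi] eps N lo up.
Proof.
move=> /andP[e0 e1].
have y1 : 1 <= eps `^ (- p).
  rewrite powRN invf_ge1 ?powR_gt0//.
  apply: (@le_trans _ _ (1 `^ p)); last by rewrite powR1.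
  by rewrite ge0_ler_powR ?nnegrE ?(ltW p0) ?(ltW e0).
have /lne_le_EFin h := entropy e0.
have [_ [N [l [u [lu cov]]] <-] /ltW] : exists2 x : \bar R,
    [set (n%:R)%:E | n in bracket_cover (ref_norm PX pi_ref)
       (density_ratios Pi pi_ref) eps] x &
    (x < (expR (C * eps `^ (- p)) + 1)%:E)%E.
  apply: ereal_inf_lt; apply: (le_lt_trans h); rewrite lte_fin ltrDl//.
rewrite lee_fin => Nle.
pose lo (i : nat) : O -> R := if insub i is Some j then
  at_obs (fun b x => clamp01 (l j b x * pi_ref b x)) else fun=> 0.
pose up (i : nat) : O -> R := if insub i is Some j then
  at_obs (fun b x => Num.max (clamp01 (l j b x * pi_ref b x))
                             (clamp01 (u j b x * pi_ref b x))) else fun=> 0.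
exists N, lo, up; split.
  apply: (le_trans Nle); set y := eps `^ (- p) in y1 *.
  have yy : C * y <= `|C| * y by rewrite ler_wpM2r ?ler_norm// (le_trans ler01).
  apply: (@le_trans _ _ (expR (`|C| * y) * 2)).
    rewrite mulr_natr mulr2n lerD ?ler_expR//.
    by rewrite -expR0 ler_expR mulr_ge0// (le_trans ler01).
  rewrite mulrDl mul1r expRD ler_wpM2l ?expR_ge0//.
  by apply: le_trans (expR_ge1Dx _); move: y1; lra.
have cl0 v : 0 <= clamp01 v by rewrite /clamp01 le_min ler01 andbT le_max lexx orbT.
have cl1 v : clamp01 v <= 1 by rewrite /clamp01 ge_min lexx orbT.
have mcl (h1 : X -> R) : measurable_fun setT h1 -> measurable_fun setT (fun x => clamp01 (h1 x)).
  by move=> mh; apply: measurable_minr => //; exact: measurable_maxr.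
have [mref _ _] := refP.
have mlo i : measurable_fun setT (lo i).
  rewrite /lo; case: insubP => [j _ _|_]; last exact: measurable_cst.
  apply: measurable_at_obs => b; apply: mcl; apply: measurable_funM => //.
  by have [] := lu j.
have mup i : measurable_fun setT (up i).
  rewrite /up; case: insubP => [j _ _|_]; last exact: measurable_cst.
  have [ml mu _ _ _] := lu j.
  apply: measurable_at_obs => b; apply: measurable_maxr;
    by apply: mcl; exact: measurable_funM.
have lou i o : [/\ 0 <= lo i o, lo i o <= up i o & up i o <= 1].
  rewrite /lo /up; case: insubP => [j _ _|_]; last by split.
  by rewrite /at_obs; split; rewrite ?le_max ?lexx// ge_max !cl1.
split=> //.
- move=> i.
  have mw : measurable_fun setT (fun o => (up i o - lo i o) ^+ 2).
    by apply: measurable_funX; exact: measurable_funB.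
  have int_le : (\int[Lam]_o ((up i o - lo i o) ^+ 2)%:E <= (eps ^+ 2)%:E)%E.
    rewrite ge0_integral_obs_measure//; last 2 first.
    - by move=> o; rewrite lee_fin sqr_ge0.
    - exact/measurable_EFinP.
    rewrite /up /lo; case: insubP => [j _ _|_]; last first.
      rewrite (eq_integral (cst 0%E)) ?integral0 ?lee_fin ?sqr_ge0// => x _.
      by rewrite big1// => b _; rewrite subrr expr0n/= integral0.
    have [ml mu _ _] := lu j.
    move/poweR_half_le => h1; apply: (le_trans _ (h1 _ (ltW e0))); last first.
      apply: integral_ge0 => x _; apply: integral_ge0 => b _.
      by rewrite lee_fin mulr_ge0 ?sqr_ge0// ltW.
    have mw2 b : measurable_fun setT (fun x : X => (u j b x - l j b x) ^+ 2 * pi_ref b x).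
      by apply: measurable_funM => //; apply: measurable_funX; exact: measurable_funB.
    under [leRHS]eq_integral => x _.
      rewrite (ge0_integral_counting mA us sT); last first.
        by move=> b; rewrite lee_fin mulr_ge0 ?sqr_ge0// ltW.
      over.
    pose wd b x := (Num.max (clamp01 (l j b x * pi_ref b x))
      (clamp01 (u j b x * pi_ref b x)) - clamp01 (l j b x * pi_ref b x)) ^+ 2.
    rewrite [leLHS](eq_integral (fun x => (\sum_(b <- s) (wd b x)%:E)%E)); last first.
      move=> x _; apply: eq_bigr => b _.
      rewrite (eq_integral (cst (wd b x)%:E)) ?integral_cst ?prob_kernel ?mule1//.
    have mwd b : measurable_fun setT (wd b).
      apply: measurable_funX; apply: measurable_funB; first apply: measurable_maxr;
        by apply: mcl; exact: measurable_funM.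
    apply: ge0_le_integral => //.
    - by move=> x _; apply: sume_ge0 => b _; rewrite lee_fin sqr_ge0.
    - by apply: emeasurable_sum => b; exact/measurable_EFinP.
    - by apply: emeasurable_sum => b; exact/measurable_EFinP.
    - move=> x _; apply: lee_sum => b _; rewrite lee_fin.
      by apply: clamp01_width; exact: cond_density_le1.
  rewrite -lee_fin; apply: le_trans int_le.
  rewrite -Rintegral_EFin//; split=> //; exists 1 => o.
  have [a1 a2 a3] := lou i o; rewrite normrX exprn_ile1// ger0_norm ?subr_ge0//.
  by rewrite lerBlDl (le_trans a3)// lerDr.
- move=> _ [g Pig <-].
  have [|j lgu] := cov (fun b x => g b x / pi_ref b x); first by exists g.
  exists j => o; rewrite /lo /up valK /at_obs.
  have /andP[g0 g1] := cond_density_le1 o.1.2 o.1.1 (PiP Pig).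
  have /andP[h1 h2] := lgu o.1.2 o.1.1.
  have r0 := ref_gt0 o.1.2 o.1.1.
  apply/andP; split.
    by rewrite /clamp01 ge_min ge_max g0 andbT -ler_pdivlMr// h1.
  have gu : g o.1.2 o.1.1 <= u j o.1.2 o.1.1 * pi_ref o.1.2 o.1.1.
    by rewrite -ler_pdivrMr.
  by rewrite le_max /clamp01 !le_min !le_max gu g1 !orbT.
Qed.

End brackets.

(** * Conditional expectations *)

Section conditional_expectation.
Context {R : realType} {d : measure_display} {Om : measurableType d}.
Variables (P : probability Om R) (F : set_system Om).
Hypothesis mF : @measurable _ (g_sigma_algebraType F) = F.
Hypothesis FM : F `<=` measurable.

Let measurable_of_sub (g : Om -> R) :
  measurable_fun [set: g_sigma_algebraType F] g -> measurable_fun setT g.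
Proof.
move=> mg _ B mB; rewrite setTI; apply: FM; rewrite -mF.
by have := mg measurableT B mB; rewrite setTI.
Qed.

(** The event where [g'] lies below [g] belongs to [F], so the nonnegative difference has integral
    zero on it. *)
Let cond_exp_le f g g' : cond_exp P F f g -> cond_exp P F f g' ->
  {ae P, forall w, g w <= g' w}.
Proof.
move=> [_ ig mg gE] [_ ig' mg' g'E].
pose E := [set w | g' w < g w].
have FE : F E.
  rewrite -mF -[E]setTI; exact: (measurable_fun_ltr (D := [set: g_sigma_algebraType F])).
have mE : measurable E := FM FE.
have iE : P.-integrable E (EFin \o g) by apply: integrableS ig.
have iE' : P.-integrable E (EFin \o g') by apply: integrableS ig'.
have I0 : (\int[P]_(w in E) (g w - g' w)%:E = 0)%E.
  rewrite integralB_EFin// -gE// -g'E// subee// gE//.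
  exact: integrable_fin_num iE.
have mh : measurable_fun E (fun w => (g w - g' w)%:E).
  apply/measurable_EFinP; apply: measurable_funB;
    by apply: measurable_funTS; exact: measurable_of_sub.
have /(ae_eq_integral_abs P mE mh) : (\int[P]_(w in E) `|(g w - g' w)%:E| = 0)%E.
  rewrite -[RHS]I0; apply: eq_integral => w; rewrite inE => /ltW gg.
  by rewrite gee0_abs// lee_fin subr_ge0.
apply: filterS => w /= h; rewrite leNgt; apply/negP => gg.
by have [/subr0_eq ge] := h gg; rewrite ge ltxx in gg.
Qed.

Lemma cond_exp_unique f g g' : cond_exp P F f g -> cond_exp P F f g' ->
  {ae P, forall w, g w = g' w}.
Proof.
move=> h h'; apply: filterS2 (cond_exp_le h h') (cond_exp_le h' h) => w le1 le2.
by apply/eqP; rewrite eq_le le1.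
Qed.

End conditional_expectation.

Section bounded_law.
Context {R : realType} {dO d : measure_display}.
Context {Om : measurableType dO} {O : measurableType d}.
Variables (P : probability Om R) (Lam : {finite_measure set O -> \bar R}).
Variables (F : nat -> set_system Om) (ob : nat -> Om -> O).
Variables (q : nat -> Om -> O -> R) (fl : R) (n : nat).
Hypothesis dsg : sequential_design P Lam F ob q fl n.
Local Notation G t := (g_sigma_algebraType (F t)).

(** The conditional law is stated for nonnegative functions; it is applied to [Phi + B] and to [B],
    and the results are subtracted. *)
Lemma bounded_design_law t (Phi : Om -> O -> R) B : (n < t <= 2 * n)%N ->
  measurable_fun [set: G t.-1 * O] (fun z => Phi z.1 z.2) ->
  (forall w o, `|Phi w o| <= B) ->
  (\int[P]_w (Phi w (ob t w))%:E = \int[P]_w (\int[Lam]_o (q t w o * Phi w o))%:E)%E.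
Proof.
move=> nt mPhi PhiB; have nt' : (n < t)%N by case/andP: nt.
have bPhi w : bmeas (Phi w).
  split; last by exists B => o; exact: PhiB.
  exact: (@measurable_fun_pair2 _ _ _ (G t.-1) O R (fun z => Phi z.1 z.2) w mPhi).
have bq w : bmeas (q t w) := bmeas_q dsg w nt'.
have B0 w o : 0 <= B := le_trans (normr_ge0 _) (PhiB w o).
have q01 w o : 0 <= q t w o <= 1.
  have /andP[h ->] := design_floor dsg w o nt'; rewrite andbT (le_trans _ h)//.
  exact: ltW (design_floor_gt0 dsg).
have law (f : Om -> O -> R) : (forall w o, 0 <= f w o) ->
    measurable_fun [set: G t.-1 * O] (fun z => f z.1 z.2) -> (forall w, bmeas (f w)) ->
    (\int[P]_w (f w (ob t w))%:E = \int[P]_w (\int[Lam]_o (q t w o * f w o))%:E)%E.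
  move=> f0 mf bf; rewrite (design_law dsg (f := fun z => (f z.1 z.2)%:E) nt); last 2 first.
  - by move=> z; rewrite lee_fin.
  - exact/measurable_EFinP.
  apply: eq_integral => w _; rewrite -Rintegral_EFin; last exact: bmeasM.
  by under [RHS]eq_integral do rewrite EFinM.
have PhiB0 w o : 0 <= Phi w o + B.
  by rewrite -lerBlDr sub0r; have := PhiB w o; rewrite ler_norml => /andP[].
have l1 : (\int[P]_w (Phi w (ob t w) + B)%:E =
    \int[P]_w (\int[Lam]_o (q t w o * (Phi w o + B)))%:E)%E.
  apply: (law (fun w o => Phi w o + B)) => //; first exact: measurable_funD.
  by move=> w; apply: bmeasD => //; exact: bmeas_cst.
have l2 : (\int[P]_w B%:E = \int[P]_w (\int[Lam]_o (q t w o * B))%:E)%E.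
  by apply: (law (fun _ _ => B)) => // w; exact: bmeas_cst.
have bI (f : Om -> O -> R) C : measurable_fun [set: G t.-1 * O] (fun z => f z.1 z.2) ->
    (forall w o, `|f w o| <= C) -> bmeas (fun w => \int[Lam]_o f w o).
  move=> mf fC; split.
    exact: (measurable_of_history dsg
      (@measurable_Rintegral_section _ _ _ _ _ Lam F t.-1 f C mf fC)).
  exists (C * fine (Lam setT)) => w.
  have bf : bmeas (f w).
    split; last by exists C => o; exact: fC.
    exact: (@measurable_fun_pair2 _ _ _ (G t.-1) O R (fun z => f z.1 z.2) w mf).
  apply: le_trans (bmeas_normr_Rintegral _ bf) _; rewrite -Rintegral_cst//.
  by apply: bmeas_le_Rintegral; [exact: bmeas_norm|exact: bmeas_cst|exact: fC].
have mq := design_q dsg nt'.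
have b1 : bmeas (fun w => \int[Lam]_o (q t w o * Phi w o)).
  apply: (bI _ B); first exact: measurable_funM.
  move=> w o; have /andP[h0 h1] := q01 w o.
  by rewrite normrM -[leRHS]mul1r ler_pM// ger0_norm.
have b2 : bmeas (fun w => \int[Lam]_o (q t w o * B)).
  apply: (bI _ `|B|); first exact: measurable_funM.
  move=> w o; have /andP[h0 h1] := q01 w o.
  by rewrite normrM -[leRHS]mul1r ler_pM// ger0_norm.
have b3 : bmeas (fun w => Phi w (ob t w)).
  split; last by exists B => w; exact: PhiB.
  apply: (measurable_of_history dsg (t := t)).
  by apply: (measurable_past dsg) => //; rewrite (leq_ltn_trans _ nt')/=.
move: l1; have -> : (fun w => (\int[Lam]_o (q t w o * (Phi w o + B)))%:E) =
    (fun w => (\int[Lam]_o (q t w o * Phi w o) + \int[Lam]_o (q t w o * B))%:E).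
  apply/funext => w; rewrite -bmeas_RintegralD; [|exact: bmeasM|].
    by congr (_%:E); apply: eq_Rintegral => o _; rewrite mulrDr.
  by apply: bmeasM => //; exact: bmeas_cst.
rewrite !Rintegral_EFin//; [|exact: bmeasD|by apply: bmeasD => //; exact: bmeas_cst].
move: l2; rewrite !Rintegral_EFin//; last exact: bmeas_cst.
rewrite !bmeas_RintegralD//; last exact: bmeas_cst.
by move=> [->] [/addIr ->].
Qed.

End bounded_law.

Section truncation.
Context {R : realType}.

(* As for clip, truncation is inactive almost surely. *)
Definition trunc (c x : R) : R := Num.max (- c) (Num.min x c).

Lemma trunc_id c x : `|x| <= c -> trunc c x = x.
Proof.
rewrite ler_norml => /andP[h1 h2].
by rewrite /trunc min_l// max_r.
Qed.

Lemma trunc_le c x : 0 <= c -> `|trunc c x| <= c.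
Proof.
move=> c0; rewrite ler_norml /trunc le_max lexx /= ge_max ge_min lexx orbT andbT.
by rewrite ge0_cp.
Qed.

Lemma trunc_lip c x y : `|trunc c x - trunc c y| <= `|x - y|.
Proof.
wlog xy : x y / x <= y.
  move=> h; have [|/ltW] := leP x y; first exact: h.
  by move=> yx; rewrite distrC [leRHS]distrC; exact: h.
rewrite distrC [leRHS]distrC /trunc ger0_norm; last by rewrite subr_ge0 le_max2// le_min2.
rewrite ger0_norm ?subr_ge0//.
apply: (@le_trans _ _ (Num.min y c - Num.min x c)).
  have : Num.min x c <= Num.min y c by rewrite le_min2.
  move: (Num.min x c) (Num.min y c) => u v uv.
  by have [h|h] := leP (- c) u; have [h'|h'] := leP (- c) v; lra.
by have [h|h] := leP x c; have [h'|h'] := leP y c; lra.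
Qed.

Lemma measurable_trunc c : measurable_fun setT (trunc c).
Proof. by apply: measurable_maxr => //; exact: measurable_minr. Qed.

End truncation.

(** * The adaptive data as a sequential design *)

Section concrete_design.
Context {R : realType} {dO dX dA dY : measure_display}.
Context {Omega : measurableType dO} {X : measurableType dX}.
Context {A : measurableType dA} {Y : measurableType dY}.
Variables (P : probability Omega R) (PX : probability X R).
Variables (PY : R.-pker (X * A)%type ~> Y) (Pi : set (A -> X -> R)).
Variables (D : adaptive_data R Omega X A Y) (s : seq A).
Variables (alpha c : R) (N : set X).
Hypothesis mA : forall B : set A, measurable B.
Hypotheses (us : uniq s) (sT : forall b, b \in s).
Hypothesis PiP : Pi `<=` [set g | cond_density g].
Hypothesis samp : adaptive_sampling P PX PY Pi D.
Hypotheses (alpha0 : 0 <= alpha) (c0 : 0 < c).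
Hypothesis N0 : PX.-negligible N.
Hypothesis floorP : {ae P, forall w, forall t b x, (1 <= t)%N -> ~ N x ->
  c * (t%:R `^ (- alpha)) <= pol D t w b x}.
Local Notation O := (X * A * Y)%type.
Local Notation Lam := (obs_measure PX PY s).

Lemma ge0_integral_obs_ctx (h : X -> \bar R) :
  (forall x, 0 <= h x)%E -> measurable_fun setT h ->
  (\int[Lam]_o h o.1.1 = (size s)%:R%:E * \int[PX]_x h x)%E.
Proof.
move=> h0 mh; rewrite ge0_integral_obs_measure//; last first.
  by apply: measurableT_comp => //; apply: measurableT_comp.
rewrite -ge0_integralZl_EFin//; apply: eq_integral => x _.
rewrite (eq_bigr (fun=> h x)) => [|b _]; last first.
  by rewrite (eq_integral (cst (h x)))// integral_cst// prob_kernel mule1.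
by rewrite big_const_seq count_predT iter_addr addr0 mule_natl.
Qed.

Lemma ae_obs_measure_ctx : {ae Lam, forall o, ~ N o.1.1}.
Proof.
have [B [mB PB NB]] := N0.
exists [set o : O | B o.1.1]; split.
- have mf : measurable_fun [set: O] (fun o => o.1.1) by apply: measurableT_comp.
  by rewrite -[X in measurable X]setTI; exact: mf.
- rewrite -[LHS]mul1e -[LHS]integral_cst//; last first.
    have mf : measurable_fun [set: O] (fun o => o.1.1) by apply: measurableT_comp.
    by rewrite -[X in measurable X]setTI; exact: mf.
  rewrite integral_mkcond (eq_integral (fun o => (\1_B o.1.1)%:E)).
    rewrite (ge0_integral_obs_ctx (h := fun x => (\1_B x)%:E)).
    + have -> : (\int[PX]_x (\1_B x)%:E = 0)%E by rewrite integral_indic// setIT; exact: PB.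
      by rewrite mule0.
    + by move=> x; rewrite lee_fin.
    + by apply/measurable_EFinP; exact: measurable_indic.
  move=> o _; rewrite patchE indicE; case: ifPn => oB.
    by rewrite mem_set//; move: oB; rewrite inE.
  by rewrite memNset// => Bo; move/negP: oB; apply; rewrite inE.
- by move=> o /= /contrapT; exact: NB.
Qed.

Lemma ae_ctx_notin : {ae P, forall w, forall t, (1 <= t)%N -> ~ N (ctx D t w)}.
Proof.
apply: ae_foralln => t; case: (posnP t) => [->|t1].
  by apply: aeW.
have [B [mB PB NB]] := N0; exists (ctx D t @^-1` B); split.
- by rewrite -[X in measurable X]setTI; exact: (measurable_ctx samp t1).
- have := ctx_law samp t1 _ mB; move=> /(_ setT).
  by rewrite setTI PB mule0; apply; rewrite -measurable_historyE; exact: measurableT.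
- move=> w /= h; apply: contrapT => nB; apply: h => _ Nw; apply: nB; exact: NB.
Qed.

(** The factor [2^(-alpha)] replaces [t^(-alpha)] by [n^(-alpha)] for [t] up to [2 n]; the minimum
    with 1 keeps the floor at most 1. *)
Definition floor_const : R := Num.min c 1 * 2 `^ (- alpha).

Lemma floor_const_gt0 : 0 < floor_const.
Proof. by rewrite mulr_gt0 ?powR_gt0// lt_min c0 ltr01. Qed.

Lemma floor_const_le1 : floor_const <= 1.
Proof.
rewrite -[leRHS]mulr1 ler_pM ?powR_ge0//.
- by rewrite le_min (ltW c0) ler01.
- by rewrite ge_min lexx orbT.
- by rewrite -[leRHS](powRr0 2) ler_powR ?oppr_le0// ler1n.
Qed.

Lemma policy_floor_le n t : (0 < n)%N -> (n < t <= 2 * n)%N ->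
  policy_floor alpha floor_const n <= c * t%:R `^ (- alpha).
Proof.
move=> n0 /andP[nt tn]; rewrite /policy_floor /floor_const -mulrA -powRM//.
rewrite ler_pM ?powR_ge0//.
- by rewrite le_min (ltW c0) ler01.
- by rewrite ge_min lexx.
rewrite !powRN lef_pV2 ?posrE ?powR_gt0 ?mulr_gt0 ?ltr0n// ?(leq_ltn_trans _ nt)//.
by rewrite ge0_ler_powR ?nnegrE// -natrM ler_nat.
Qed.

Definition obs_pol t w : O -> R := at_obs (pol D t w).

Local Notation clipn := (clip alpha floor_const).

Lemma clip_obs_pol n t w o : (0 < n)%N -> (n < t <= 2 * n)%N ->
  c * (t%:R `^ (- alpha)) <= pol D t w o.1.2 o.1.1 ->
  clipn n (obs_pol t w o) = obs_pol t w o.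
Proof.
move=> n0 nt h; have t1 : (1 <= t)%N by case/andP: nt => + _; exact: leq_ltn_trans.
rewrite /clip max_l; last exact: le_trans (policy_floor_le n0 nt) h.
by rewrite min_l// (pol_le1 mA us sT PiP samp).
Qed.

Lemma ae_clip_obs_pol : {ae P, forall w, forall n t, (0 < n)%N -> (n < t <= 2 * n)%N ->
  forall o, ~ N o.1.1 -> clipn n (obs_pol t w o) = obs_pol t w o}.
Proof.
apply: filterS floorP => w h n t n0 nt o No; apply: clip_obs_pol => //.
by apply: h => //; case/andP: nt => + _; exact: leq_ltn_trans.
Qed.

Lemma measurable_clip_obs_pol n t : (n < t)%N -> measurable_fun
  [set: g_sigma_algebraType (history D t.-1) * O]
  (fun z => clipn n (obs_pol t z.1 z.2)).
Proof.
move=> nt; apply: (measurableT_comp (measurable_clip alpha floor_const n)).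
exact: (measurable_pol samp (leq_ltn_trans (leq0n n) nt)).
Qed.

Lemma integral_obs_pol t w : (1 <= t)%N ->
  (\int[Lam]_o (obs_pol t w o)%:E = 1)%E.
Proof.
move=> t1; rewrite ge0_integral_obs_measure//; last 2 first.
- by move=> o; rewrite lee_fin (pol_ge0 PiP samp).
- apply/measurable_EFinP; apply: (measurable_at_obs mA us sT) => b.
  by have [] := PiP (pol_in_class samp w t1).
rewrite (eq_integral (cst 1%E)) => [|x _]; last first.
  rewrite (eq_bigr (fun b => (pol D t w b x)%:E)) => [|b _].
    by rewrite sumEFin (sum_pol mA us sT PiP samp).
  by rewrite (eq_integral (cst (pol D t w b x)%:E))// integral_cst// prob_kernel mule1.
by rewrite integral_cst// mul1e; exact: probability_setT.
Qed.

(** For almost every trajectory, clipping changes the policy only at contexts in [N], a set that the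
    observation measure does not charge. The law and the mass of the actual policy are thereby
    inherited by the clipped one. *)
Lemma concrete_design n : (0 < n)%N -> sequential_design P Lam (history D) (obs D)
  (fun t w o => clipn n (obs_pol t w o)) (policy_floor alpha floor_const n) n.
Proof.
move=> n0; have fl0 := policy_floor_gt0 alpha floor_const_gt0 n0.
have fq t w o : policy_floor alpha floor_const n <= clipn n (obs_pol t w o) <= 1.
  by rewrite clip_ge ?clip_le1// ?floor_const_gt0 ?floor_const_le1.
have q0 t w o : 0 <= clipn n (obs_pol t w o).
  by case/andP: (fq t w o) => + _; apply: le_trans; exact: ltW.
split=> //.
- by move=> t t' tt'; exact: measurable_fun_id_history.
- by move=> t; exact: (measurable_fun_history samp).
- by move=> t t' tt'; exact: measurable_obs.
- exact: measurable_clip_obs_pol.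
- move=> t f nt f0 mf; have nt' : (n < t)%N by case/andP: nt.
  have t1 : (1 <= t)%N := leq_ltn_trans (leq0n n) nt'.
  rewrite (integral_obs mA us sT PiP samp t1 f0 mf).
  have mq := measurable_clip_obs_pol nt'.
  have mint (g : g_sigma_algebraType (history D t.-1) * O -> R) :
      measurable_fun setT g -> (forall z, 0 <= g z) ->
      measurable_fun [set: Omega] (fun w : Omega => \int[Lam]_o ((g (w, o))%:E * f (w, o)))%E.
    move=> mg g0; apply: (measurableT_comp (f := fun w : g_sigma_algebraType (history D t.-1) =>
      (\int[Lam]_o ((g (w, o))%:E * f (w, o)))%E)); last exact: (measurable_fun_history samp).
    apply: (measurable_fun_integral_finite_kernel
      (fun z : g_sigma_algebraType (history D t.-1) * O => ((g z)%:E * f z)%E) (kconst Lam)).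
      by move=> z; rewrite mule_ge0// lee_fin.
    by apply: emeasurable_funM => //; exact/measurable_EFinP.
  apply: ae_eq_integral => //.
  - by apply: (mint (fun z => pol D t z.1 z.2.1.2 z.2.1.1)) => [|z];
      [exact: (measurable_pol samp)|exact: (pol_ge0 PiP samp)].
  - by apply: (mint (fun z => clipn n (obs_pol t z.1 z.2))).
  apply: filterS ae_clip_obs_pol => w h _; apply: ae_eq_integral => //.
  + apply: emeasurable_funM.
      apply/measurable_EFinP; apply: (measurable_at_obs mA us sT) => b.
      by have [] := PiP (pol_in_class samp w t1).
    exact: (@measurable_fun_pair2 _ _ _ (g_sigma_algebraType (history D t.-1)) O _ f w mf).
  + apply: emeasurable_funM.
      apply/measurable_EFinP; exact: (@measurable_fun_pair2 _ _ _
        (g_sigma_algebraType (history D t.-1)) O R (fun z => clipn n (obs_pol t z.1 z.2)) w mq).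
    exact: (@measurable_fun_pair2 _ _ _ (g_sigma_algebraType (history D t.-1)) O _ f w mf).
  + by apply: filterS ae_obs_measure_ctx => o No _; rewrite h.
- apply: filterS ae_clip_obs_pol => w h t nt.
  have nt' : (n < t)%N by case/andP: nt.
  have t1 : (1 <= t)%N := leq_ltn_trans (leq0n n) nt'.
  have bq : bmeas (fun o => clipn n (obs_pol t w o)).
    split; last by exists 1 => o; case/andP: (fq t w o) => _ q1; rewrite ger0_norm.
    exact: (@measurable_fun_pair2 _ _ _ (g_sigma_algebraType (history D t.-1)) O R
      (fun z => clipn n (obs_pol t z.1 z.2)) w (measurable_clip_obs_pol nt')).
  rewrite -lee_fin -Rintegral_EFin// -(integral_obs_pol w t1).
  rewrite le_eqVlt; apply/orP; left; apply/eqP; apply: ae_eq_integral => //.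
  + by apply/measurable_EFinP; case: bq.
  + apply/measurable_EFinP; apply: (measurable_at_obs mA us sT) => b.
    by have [] := PiP (pol_in_class samp w t1).
  + by apply: filterS ae_obs_measure_ctx => o No _; rewrite h.
Qed.

End concrete_design.

(** * Stabilization of the nuisance estimators along rounds *)

Section stabilization.
Context {R : realType} {dO dX dA dY : measure_display}.
Context {Omega : measurableType dO} {X : measurableType dX}.
Context {A : measurableType dA} {Y : measurableType dY}.
Variables (P : probability Omega R) (PX : probability X R).
Variables (PY : R.-pker (X * A)%type ~> Y).
Variables (D : adaptive_data R Omega X A Y) (s : seq A).
Context {k : Y -> Y -> R} (H : rkhs k).
Variables (a a' : A) (mu2 : nat -> Omega -> A -> X -> H) (mu_inf : A -> X -> H).
Variable (beta : R).
Hypothesis mA : forall B : set A, measurable B.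
Hypotheses (us : uniq s) (sT : forall b, b \in s).
Hypothesis mk : measurable_fun setT (fun z : Y * Y => k z.1 z.2).
Hypothesis ad2 : adapted_nuisance D mu2.
Hypothesis minf : strongly_measurable (fun z : A * X => mu_inf z.1 z.2).
Hypothesis beta0 : 0 < beta.
Hypothesis rate : bigO_as P
  (fun t w => L2_norm PX (fun b x => mu2 t.-1 w b x - mu_inf b x))
  (fun t => t%:R `^ (- beta)).
Local Notation O := (X * A * Y)%type.
Local Notation Lam := (obs_measure PX PY s).

Let dist t w b x : R := `|mu2 t.-1 w b x - mu_inf b x|.

Let measurable_dist t w b : measurable_fun setT (dist t w b).
Proof.
apply: (hmeas_norm mk); apply: hmeasB.
  have mz : measurable_fun setT
      (fun x : X => ((w : g_sigma_algebraType (history D t.-1)), (b, x))).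
    by apply: measurable_fun_pair => //; exact: measurable_fun_pair.
  exact: (hmeas_comp mz (hmeas_strong (H := H) (ad2 t.-1))).
have mz : measurable_fun setT (fun x : X => (b, x)) by exact: measurable_fun_pair.
exact: (hmeas_comp mz (hmeas_strong (H := H) minf)).
Qed.

Lemma ae_L2_rate : {ae P, forall w, exists K n0, forall t, (n0 <= t)%N ->
  forall b, (\int[PX]_x (dist t w b x ^+ 2)%:E <= ((K * t%:R `^ (- beta)) ^+ 2)%:E)%E}.
Proof.
apply: filterS rate => w /limn_esup_bounded[K [n0 h]].
exists `|K|, (maxn n0 1) => t; rewrite geq_max => /andP[/h {}h t1] b.
have y0 : 0 < t%:R `^ (- beta) by rewrite powR_gt0// ltr0n.
have L0 : (0 <= L2_norm PX (fun b x => (mu2 t.-1 w b x - mu_inf b x)%R))%E by exact: poweR_ge0.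
have Lle : (L2_norm PX (fun b x => (mu2 t.-1 w b x - mu_inf b x)%R)
    <= (`|K| * t%:R `^ (- beta))%:E)%E.
  move: L0 h; case: (L2_norm _ _) => [r| |]//=.
    rewrite !lee_fin => r0; rewrite ger0_norm// ler_pdivrMr// => /le_trans; apply.
    by rewrite ler_wpM2r ?ler_norm// ltW.
  by move=> _; rewrite gt0_mulye ?lte_fin ?invr_gt0.
apply: le_trans (poweR_half_le _ _ Lle); last 2 first.
- by apply: integral_ge0 => x _; apply: integral_ge0 => c _; rewrite lee_fin sqr_ge0.
- by rewrite mulr_ge0// ltW.
have ms c : measurable_fun setT (fun x => (dist t w c x ^+ 2)%:E).
  by apply/measurable_EFinP; apply: measurable_funX.
rewrite [leRHS](eq_integral (fun x => (\sum_(c <- s) (dist t w c x ^+ 2)%:E)%E)).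
  apply: ge0_le_integral => //.
  - by move=> x _; rewrite lee_fin sqr_ge0.
  - exact: emeasurable_sum.
  - move=> x _; rewrite (big_rem b)//= leeDl//; apply: sume_ge0 => c _.
    by rewrite lee_fin sqr_ge0.
by move=> x _; rewrite (ge0_integral_counting mA us sT).
Qed.

(** Triangle inequality through [mu_inf], for both target actions and both rounds: four L2
    distances, each turned into an L1 bound by [le_scaled_sqr] at scale [n^(-beta)]. The factor
    [size s] is the ratio of the context marginal of the observation measure to [PX]. *)
Lemma ae_stable (g : nat -> nat -> Omega -> O -> R) :
  (forall n t w, (n < t)%N -> bmeas (g n t w)) ->
  (forall n i j w o, `|g n i w o - g n j w o| <=
     `|mu2 i.-1 w a o.1.1 - mu2 j.-1 w a o.1.1| +
     `|mu2 i.-1 w a' o.1.1 - mu2 j.-1 w a' o.1.1|) ->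
  {ae P, forall w, stable Lam beta w g}.
Proof.
move=> bg gd; apply: filterS ae_L2_rate => w [K [n0 h]].
exists ((size s)%:R * (4 * (1 + K ^+ 2))), (maxn n0 1) => n.
rewrite geq_max => /andP[nn0 n1] i j ni nj.
set e := n%:R `^ (- beta); have e0 : 0 < e by rewrite powR_gt0// ltr0n.
pose hh t b x := e + e^-1 * dist t w b x ^+ 2.
have hh0 t b x : 0 <= hh t b x by rewrite addr_ge0 ?(ltW e0)// mulr_ge0 ?sqr_ge0// invr_ge0 ltW.
have mhh t b : measurable_fun setT (fun x => (hh t b x)%:E).
  apply/measurable_EFinP; apply: measurable_funD => //.
  by apply: measurable_funM => //; exact: measurable_funX.
have dist_hh t b x : dist t w b x <= hh t b x by exact: le_scaled_sqr.
have Ihh t b : (n < t <= 2 * n)%N -> (\int[PX]_x (hh t b x)%:E <= (e * (1 + K ^+ 2))%:E)%E.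
  move=> /andP[nt _]; have mS : measurable_fun setT (fun x => (dist t w b x ^+ 2)%:E).
    by apply/measurable_EFinP; exact: measurable_funX.
  have S0 x : (0 <= (dist t w b x ^+ 2)%:E)%E by rewrite lee_fin sqr_ge0.
  rewrite (eq_integral (fun x => e%:E + (e^-1)%:E * (dist t w b x ^+ 2)%:E)%E)//.
  rewrite ge0_integralD//; last 3 first.
  - by move=> x _; rewrite lee_fin ltW.
  - by move=> x _; rewrite mule_ge0// lee_fin invr_ge0 ltW.
  - by apply: emeasurable_funM.
  rewrite integral_cst// ge0_integralZl_EFin ?invr_ge0 ?(ltW e0)//.
  have -> : (e%:E * PX setT = e%:E)%E by rewrite -[RHS]mule1; congr (_ * _)%E; exact: probability_setT.
  rewrite mulrDr mulr1 EFinD leeD2l//.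
  apply: (@le_trans _ _ ((e^-1)%:E * ((K * t%:R `^ (- beta)) ^+ 2)%:E)%E).
    by rewrite lee_wpmul2l ?lee_fin ?invr_ge0 ?(ltW e0)// h// (leq_trans nn0)// ltnW.
  rewrite -EFinM lee_fin ler_pdivrMl// exprMn.
  have -> : e * (e * K ^+ 2) = K ^+ 2 * e ^+ 2 by ring.
  rewrite ler_wpM2l ?sqr_ge0// lerXn2r ?nnegrE ?powR_ge0//.
  rewrite /e !powRN lef_pV2 ?posrE ?powR_gt0 ?ltr0n ?(leq_trans _ nt)//.
  by rewrite ge0_ler_powR ?nnegrE ?(ltW beta0)// ler_nat ltnW.
have bd : bmeas (fun o => `|g n i w o - g n j w o|).
  by apply: bmeas_norm; apply: bmeasB; apply: bg; [case/andP: ni|case/andP: nj].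
rewrite -lee_fin -Rintegral_EFin//.
pose S x := ((hh i a x)%:E + (hh j a x)%:E + ((hh i a' x)%:E + (hh j a' x)%:E))%E.
have S0 x : (0 <= S x)%E by rewrite !adde_ge0 ?lee_fin.
have mS : measurable_fun setT S by apply: emeasurable_funD; exact: emeasurable_funD.
apply: (@le_trans _ _ (\int[Lam]_o S o.1.1)%E).
  apply: ge0_le_integral => //.
  - by apply/measurable_EFinP; case: bd.
  - by apply: measurableT_comp => //; apply: measurableT_comp.
  - move=> o _; rewrite /S -!EFinD lee_fin; apply: (le_trans (gd n i j w o)).
    have tri b : `|mu2 i.-1 w b o.1.1 - mu2 j.-1 w b o.1.1| <=
        hh i b o.1.1 + hh j b o.1.1.
      apply: (@le_trans _ _ (dist i w b o.1.1 + dist j w b o.1.1)).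
        rewrite /dist [X in _ <= _ + X]distrC (le_trans _ (ler_normD _ _))//.
        by rewrite addrA subrK.
      by rewrite lerD.
    by rewrite lerD.
rewrite (ge0_integral_obs_ctx PX PY s mA S0 mS) -!mulrA EFinM.
rewrite lee_wpmul2l ?lee_fin// /S ge0_integralD//; last 4 first.
- by move=> x _; rewrite adde_ge0 ?lee_fin.
- exact: emeasurable_funD.
- by move=> x _; rewrite adde_ge0 ?lee_fin.
- exact: emeasurable_funD.
rewrite !ge0_integralD//; try by move=> x _; rewrite lee_fin.
have -> : 4 * ((1 + K ^+ 2) * e) =
   (e * (1 + K ^+ 2) + e * (1 + K ^+ 2)) + (e * (1 + K ^+ 2) + e * (1 + K ^+ 2)) by ring.
by rewrite !EFinD; apply: leeD; apply: leeD; exact: Ihh.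
Qed.

End stabilization.

Section design_conditional_expectation.
Context {R : realType} {dO d : measure_display}.
Context {Om : measurableType dO} {O : measurableType d}.
Variables (P : probability Om R) (Lam : {finite_measure set O -> \bar R}).
Variables (F : nat -> set_system Om) (ob : nat -> Om -> O).
Variables (q : nat -> Om -> O -> R) (fl : R) (n : nat).
Hypothesis dsg : sequential_design P Lam F ob q fl n.
Local Notation G t := (g_sigma_algebraType (F t)).

(** The score is bounded only almost surely, so it is replaced by a version [Phi] that is bounded
    everywhere, whose conditional expectation is computed from the conditional law. *)
Lemma design_cond_exp t (g : Om -> R) (Phi : Om -> O -> R) B :
  (n < t <= 2 * n)%N ->
  @measurable _ (G t.-1) = F t.-1 -> F t.-1 `<=` measurable ->
  P.-integrable setT (EFin \o g) ->
  measurable_fun [set: G t.-1 * O] (fun z => Phi z.1 z.2) ->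
  (forall w o, `|Phi w o| <= B) ->
  {ae P, forall w, g w = Phi w (ob t w)} ->
  cond_exp P (F t.-1) g (fun w => \int[Lam]_o (q t w o * Phi w o)).
Proof.
move=> nt mF FM ig mPhi PhiB gPhi; have nt' : (n < t)%N by case/andP: nt.
have mq := design_q dsg nt'.
have q01 w o : 0 <= q t w o <= 1.
  have /andP[h ->] := design_floor dsg w o nt'; rewrite andbT (le_trans _ h)//.
  exact: ltW (design_floor_gt0 dsg).
have qPhiB w o : `|q t w o * Phi w o| <= B.
  have /andP[h0 h1] := q01 w o.
  by rewrite normrM -[leRHS]mul1r ler_pM// ger0_norm.
have mI : measurable_fun [set: G t.-1] (fun w => \int[Lam]_o (q t w o * Phi w o)).
  apply: (@measurable_Rintegral_section _ _ _ _ _ Lam F t.-1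
    (fun w o => q t w o * Phi w o)); last exact: qPhiB.
  exact: measurable_funM.
have bI : bmeas (fun w => \int[Lam]_o (q t w o * Phi w o)).
  split; first exact: (measurable_of_history dsg mI).
  exists (B * fine (Lam setT)) => w.
  have bf : bmeas (fun o => q t w o * Phi w o).
    split; last by exists B => o; exact: qPhiB.
    exact: (@measurable_fun_pair2 _ _ _ (G t.-1) O R (fun z => q t z.1 z.2 * Phi z.1 z.2) w
      (measurable_funM mq mPhi)).
  apply: le_trans (bmeas_normr_Rintegral _ bf) _; rewrite -Rintegral_cst//.
  by apply: bmeas_le_Rintegral; [exact: bmeas_norm|exact: bmeas_cst|exact: qPhiB].
split=> //; first exact: bmeas_integrable.
move=> E FE; have mE : measurable E := FM _ FE.
have mE' : measurable (E : set (G t.-1)) by rewrite mF.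
have mPo : measurable_fun setT (fun w => Phi w (ob t w)).
  apply: (measurable_of_history dsg (t := t)).
  by apply: (measurable_past dsg) => //; rewrite (leq_ltn_trans _ nt')/=.
have m1E : measurable_fun [set: G t.-1 * O] (fun z => \1_E z.1 : R).
  apply: (measurableT_comp (f := \1_E : G t.-1 -> R)); last exact: measurable_fst.
  exact: measurable_indic.
transitivity (\int[P]_(w in E) (Phi w (ob t w))%:E)%E.
  apply: ae_eq_integral => //.
  - by apply: measurable_funTS; exact: measurable_int ig.
  - by apply: measurable_funTS; exact/measurable_EFinP.
  - by apply: filterS gPhi => w /= -> _.
have restr (h : Om -> R) :
    (\int[P]_(w in E) (h w)%:E = \int[P]_w (\1_E w * h w)%:E)%E.
  rewrite integral_mkcond; apply: eq_integral => w _; rewrite patchE indicE.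
  by case: (w \in E); rewrite ?mul1r ?mul0r.
rewrite !restr (bounded_design_law dsg nt (Phi := fun w o => \1_E w * Phi w o) (B := B)).
- apply: eq_integral => w _; congr (_%:E); rewrite -bmeas_RintegralZl.
    by apply: eq_Rintegral => o _; rewrite mulrCA.
  split; last by exists B => o; exact: qPhiB.
  exact: (@measurable_fun_pair2 _ _ _ (G t.-1) O R (fun z => q t z.1 z.2 * Phi z.1 z.2) w
    (measurable_funM mq mPhi)).
- exact: measurable_funM.
- move=> w o; rewrite normrM -[leRHS]mul1r ler_pM// indicE.
  by case: (_ \in _); rewrite ?normr1 ?normr0.
Qed.

End design_conditional_expectation.

(** * Assembly *)

Section sigma.
Context {R : realType}.
Variables (alpha beta gamma : R).

(** The positive part does not increase the error because the true variance is nonnegative; what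
    remains is the error of the squared first moment. *)
Lemma window_bigO_sigma (h1 h2 M1 M2 : nat -> nat -> R) c : 0 <= c ->
  window_bigO (fun n t => h1 n t - M1 n t) (plugin_error alpha beta gamma) ->
  window_bigO (fun n t => h2 n t - M2 n t) (plugin_error alpha beta gamma) ->
  window_bigO h1 (fun n t => 1 + n%:R `^ (alpha + gamma) / (t - n.+1)%:R) ->
  (exists n0, forall n, (n0 <= n)%N -> forall t, (n.+1 < t <= 2 * n)%N ->
    `|M1 n t| <= c /\ M1 n t ^+ 2 <= M2 n t) ->
  window_bigO (fun n t => Num.max (h2 n t - h1 n t ^+ 2) 0 - (M2 n t - M1 n t ^+ 2))
    (sigma_error alpha beta gamma).
Proof.
move=> c0 [k1 [n1 H1]] [k2 [n2 H2]] [k3 [n3 H3]] [n4 H4].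
pose kk := `|k3| + c.
exists (`|k2| + 3 * kk * `|k1| + 5 * kk ^+ 2), (maxn (maxn n1 n2) (maxn n3 n4)) => n.
rewrite !geq_max => /andP[/andP[/H1{}H1 /H2{}H2] /andP[/H3{}H3 /H4{}H4]] t nt.
have {}H1 := H1 t nt; have {}H2 := H2 t nt; have {}H3 := H3 t nt.
have {H4} [Mc MM] := H4 t nt.
set y := n%:R `^ (alpha + gamma) / (t - n.+1)%:R in H3 *.
have y0 : 0 <= y by rewrite divr_ge0 ?powR_ge0.
set pe := plugin_error alpha beta gamma n t in H1 H2 *.
have pe0 : 0 <= pe := plugin_error_ge0 alpha beta gamma n t.
have kk0 : 0 <= kk by rewrite addr_ge0.
have {}H1 : `|h1 n t - M1 n t| <= `|k1| * pe.
  by apply: (le_trans H1); rewrite ler_wpM2r// ler_norm.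
have {}H2 : `|h2 n t - M2 n t| <= `|k2| * pe.
  by apply: (le_trans H2); rewrite ler_wpM2r// ler_norm.
have {}H3 : `|h1 n t| <= kk * (1 + y).
  apply: (le_trans H3); rewrite ler_wpM2r ?addr_ge0// (le_trans (ler_norm _))//.
  by rewrite lerDl.
have Mk : `|M1 n t| <= kk by rewrite (le_trans Mc)// lerDr.
have sqd : `|h1 n t ^+ 2 - M1 n t ^+ 2| <= 3 * kk * `|k1| * pe + 5 * kk ^+ 2 * y ^+ 2.
  (* For [y <= 1] both first moments are bounded and the difference of squares is linear in the
     error. For [y >= 1] it is bounded by the sum of the squares, [(2 kk y)^2 + (kk y)^2], whence
     the 5. *)
  have [y1|/ltW y1] := leP y 1.
    apply: (@le_trans _ _ (3 * kk * `|k1| * pe)); last first.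
      by rewrite lerDl -mulrA mulr_ge0// -exprMn sqr_ge0.
    rewrite subr_sqr normrM -mulrA mulrC ler_pM//.
    rewrite (le_trans (ler_normD _ _))//.
    have -> : 3 * kk = kk * (1 + 1) + kk by ring.
    by rewrite lerD// (le_trans H3)// ler_wpM2l// lerD2l.
  apply: (@le_trans _ _ (5 * kk ^+ 2 * y ^+ 2)); last first.
    by rewrite lerDr mulr_ge0// mulr_ge0// mulr_ge0.
  have -> : 5 * kk ^+ 2 * y ^+ 2 = (kk * (y + y)) ^+ 2 + (kk * y) ^+ 2 by ring.
  rewrite (le_trans (ler_normB _ _))// !normrX lerD// lerXn2r ?nnegrE ?mulr_ge0 ?addr_ge0//.
    by rewrite (le_trans H3)// ler_wpM2l// lerD2r.
  by rewrite (le_trans Mk)// ler_peMr.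
have maxd (u v : R) : 0 <= v -> `|Num.max u 0 - v| <= `|u - v|.
  move=> v0; have [u0|u0] := leP u 0; last by [].
  by rewrite sub0r normrN ger0_norm// distrC ler_normr; apply/orP; left; lra.
have v0 : 0 <= M2 n t - M1 n t ^+ 2 by rewrite subr_ge0.
apply: (le_trans (maxd _ _ v0)).
have -> : h2 n t - h1 n t ^+ 2 - (M2 n t - M1 n t ^+ 2) =
  (h2 n t - M2 n t) - (h1 n t ^+ 2 - M1 n t ^+ 2) by ring.
rewrite (le_trans (ler_normB _ _))//.
apply: (@le_trans _ _ (`|k2| * pe + (3 * kk * `|k1| * pe + 5 * kk ^+ 2 * y ^+ 2))).
  exact: lerD.
rewrite /sigma_error -/pe -/y -subr_ge0.
have -> : (`|k2| + 3 * kk * `|k1| + 5 * kk ^+ 2) * (pe + y ^+ 2) -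
  (`|k2| * pe + (3 * kk * `|k1| * pe + 5 * kk ^+ 2 * y ^+ 2)) =
  (`|k2| + 3 * kk * `|k1|) * y ^+ 2 + 5 * kk ^+ 2 * pe by ring.
rewrite addr_ge0// mulr_ge0 ?sqr_ge0//.
  by rewrite addr_ge0// mulr_ge0// mulr_ge0.
by rewrite mulr_ge0 ?sqr_ge0.
Qed.

End sigma.

Lemma bigO_as_of {R : realType} d (Om : measurableType d) (P : probability Om R)
    (Z : nat -> Om -> R) (nu : R) :
  {ae P, forall w, exists K n0, forall n, (n0 <= n)%N -> `|Z n w| <= K * n%:R `^ (- nu)} ->
  bigO_as P (fun n w => (Z n w)%:E) (fun n => n%:R `^ (- nu)).
Proof.
apply: filterS => w [K [n0 h]].
apply: (@limn_esup_lt_pinfty _ _ K (maxn n0 1)) => n; rewrite geq_max => /andP[/h {}h n1].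
by rewrite lee_fin ler_pdivrMr// powR_gt0// ltr0n.
Qed.

Section assembly.
Context {R : realType} {dO dX dA dY : measure_display}.
Context {Omega : measurableType dO} {X : measurableType dX}.
Context {A : measurableType dA} {Y : measurableType dY}.
Variables (P : probability Omega R) (PX : probability X R).
Variables (PY : R.-pker (X * A)%type ~> Y) (Pi : set (A -> X -> R)).
Variables (D : adaptive_data R Omega X A Y) (s : seq A).
Context {k : Y -> Y -> R} (H : rkhs k).
Variables (a a' : A) (u0 : H) (mu1 mu2 : nat -> Omega -> A -> X -> H).
Variables (M1 M2 : nat -> nat -> Omega -> R) (mu_inf : A -> X -> H).
Variables (alpha beta p gamma c kap Bmu C : R) (K : nat) (N : set X).
Variable pi_ref : A -> X -> R.
Hypotheses (p0 : 0 < p) (beta0 : 0 < beta) (alpha0 : 0 <= alpha).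
Hypotheses (gamma0 : 0 < gamma) (K0 : (0 < K)%N).
Hypothesis Kgamma : 2 * alpha + gamma <= K%:R * gamma.
Hypothesis Kexp : forall j, (j <= K)%N ->
  alpha + level_exponent alpha gamma j + p * (j%:R * gamma) + 3 * gamma <= 1.
Hypothesis mA : forall B : set A, measurable B.
Hypotheses (us : uniq s) (sT : forall b, b \in s).
Hypothesis mk : measurable_fun setT (fun z : Y * Y => k z.1 z.2).
Hypothesis PiP : Pi `<=` [set g | cond_density g].
Hypothesis samp : adaptive_sampling P PX PY Pi D.
Hypotheses (ad1 : adapted_nuisance D mu1) (ad2 : adapted_nuisance D mu2).
Hypothesis u01 : `|u0| = 1.
Hypothesis ceM : forall n t, (n.+1 <= t <= 2 * n)%N ->
  cond_exp P (history D t.-1) (xi D a a' mu1 mu2 u0 n t) (M1 n t) /\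
  cond_exp P (history D t.-1)
    (fun w => xi D a a' mu1 mu2 u0 n t w ^+ 2) (M2 n t).
Hypothesis kkap : forall y, k y y <= kap.
Hypothesis muB : {ae P, forall w, forall j b x,
  `|mu1 j w b x| <= Bmu /\ `|mu2 j w b x| <= Bmu}.
Hypothesis minf : strongly_measurable (fun z : A * X => mu_inf z.1 z.2).
Hypothesis rate : bigO_as P
  (fun t w => L2_norm PX (fun b x => mu2 t.-1 w b x - mu_inf b x))
  (fun t => t%:R `^ (- beta)).
Hypotheses (refP : cond_density pi_ref) (ref_gt0 : forall b x, 0 < pi_ref b x).
Hypothesis entropy : forall eps, 0 < eps ->
  (lne (bracketing_number (ref_norm PX pi_ref) (density_ratios Pi pi_ref) eps)
     <= (C * eps `^ (- p))%:E)%E.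
Hypotheses (c0 : 0 < c) (N0 : PX.-negligible N).
Hypothesis floorP : {ae P, forall w, forall t b x, (1 <= t)%N -> ~ N x ->
  c * (t%:R `^ (- alpha)) <= pol D t w b x}.
Local Notation O := (X * A * Y)%type.
Local Notation Lam := (obs_measure PX PY s).
Local Notation f := (floor_const alpha c).
Local Notation clipn := (clip alpha f).
Local Notation gp := (obs_pol D).
Local Notation dir n w := (pilot_direction D a a' mu1 u0 n w).

Let f0 : 0 < f := floor_const_gt0 alpha c0.
Let f1 : f <= 1 := floor_const_le1 alpha0 c0.
Let dsg n : (0 < n)%N -> sequential_design P Lam (history D) (obs D)
  (fun t w o => clipn n (gp t w o)) (policy_floor alpha f n) n.
Proof. exact: (concrete_design mA us sT PiP samp alpha0 c0 N0 floorP). Qed.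

(** Covers both [residual_le] and [effect_le]; the added 1 provides the bound [1 <= cc] required by
    chaining, and the absolute value is there because the sign of [Bmu] is unknown. *)
Let cc : R := 2 * (Num.sqrt kap + `|Bmu|) + 1.
Let cc1 : 1 <= cc. Proof. by rewrite lerDr mulr_ge0// addr_ge0// sqrtr_ge0. Qed.
Let cc0 : 0 <= cc. Proof. exact: le_trans cc1. Qed.

Let r n t w o := trunc cc (residual a a' (dir n w) (mu2 t.-1 w) o).
Let e n t w o := trunc cc (effect a a' (dir n w) (mu2 t.-1 w) o).

Let rc n t w o : `|r n t w o| <= cc. Proof. exact: trunc_le. Qed.
Let ec n t w o : `|e n t w o| <= cc. Proof. exact: trunc_le. Qed.

Let mr n t : (n < t)%N -> measurable_fun
  [set: g_sigma_algebraType (history D t.-1) * O] (fun z => r n t z.1 z.2).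
Proof.
move=> nt; apply: (measurableT_comp (measurable_trunc cc)).
exact: (measurable_residual a a' u0 mA mk PiP samp ad1 ad2 nt).
Qed.

Let me n t : (n < t)%N -> measurable_fun
  [set: g_sigma_algebraType (history D t.-1) * O] (fun z => e n t z.1 z.2).
Proof.
move=> nt; apply: (measurableT_comp (measurable_trunc cc)).
exact: (measurable_effect a a' u0 mA mk PiP samp ad1 ad2 nt).
Qed.

Let stab_r : {ae P, forall w, stable Lam beta w r}.
Proof.
apply: (ae_stable PY (a := a) (a' := a') mA us sT mk ad2 minf beta0 rate).
  by move=> n t w nt; exact: (bmeas_psi (mr (n := n)) (rc n) w nt).
move=> n i j w o; apply: le_trans (trunc_lip _ _ _) _.
by apply: residual_dist; exact: norm_pilot_direction.
Qed.

Let stab_e : {ae P, forall w, stable Lam beta w e}.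
Proof.
apply: (ae_stable PY (a := a) (a' := a') mA us sT mk ad2 minf beta0 rate).
  by move=> n t w nt; exact: (bmeas_psi (me (n := n)) (ec n) w nt).
move=> n i j w o; apply: le_trans (trunc_lip _ _ _) _.
by apply: effect_dist; exact: norm_pilot_direction.
Qed.

Let Gm g : [set at_obs (Y := Y) g | g in Pi] g ->
  measurable_fun setT g /\ forall o, 0 <= g o <= 1.
Proof.
move=> [h Pih <-]; split.
  by apply: (measurable_at_obs mA us sT) => b; have [] := PiP Pih.
by move=> o; exact: (cond_density_le1 mA us sT _ _ (PiP Pih)).
Qed.

Let gG t w : (1 <= t)%N -> [set at_obs (Y := Y) g | g in Pi] (gp t w).
Proof. by move=> t1; exists (pol D t w) => //; exact: (pol_in_class samp). Qed.

Let Gb eps : 0 < eps <= 1 -> exists n lo up,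
  n%:R <= expR ((`|C| + 1) * eps `^ (- p)) /\
  bracket_family Lam [set at_obs (Y := Y) g | g in Pi] eps n lo up.
Proof. exact: (exists_brackets PY mA us sT PiP refP ref_gt0 p0 entropy). Qed.

Let Cb0 : 0 <= `|C| + 1. Proof. exact: addr_ge0. Qed.

Local Notation c1' := (comp1 alpha f gp r e).
Local Notation c2' := (comp2 alpha f gp r e).
Local Notation estn := (est (obs D) alpha f gp).

Let q_gt0 n (u : R) : (0 < n)%N -> 0 < clipn n u.
Proof. by move=> n0; exact: clip_gt0. Qed.

(** The trajectories on which truncation and clipping are inactive. The index [i] of the observation
    is independent of the round [t], since the estimators evaluate the policy of round [t] at
    earlier observations. *)
Definition regular w :=
  (forall n t o, r n t w o = residual a a' (dir n w) (mu2 t.-1 w) o /\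
                 e n t w o = effect a a' (dir n w) (mu2 t.-1 w) o) /\
  (forall n t i, (0 < n)%N -> (n < t <= 2 * n)%N -> (1 <= i)%N ->
    clipn n (gp t w (obs D i w)) = pol D t w (act D i w) (ctx D i w)).

Lemma ae_regular : {ae P, forall w, regular w}.
Proof.
have A1 := ae_clip_obs_pol mA us sT PiP samp alpha0 c0 floorP.
have A2 := ae_ctx_notin samp N0.
apply: filterS3 muB A1 A2 => w mB h1 h2; split.
  move=> n t o; have u1 := norm_pilot_direction D a a' mu1 u01 n w.
  have mB' b x : `|mu2 t.-1 w b x| <= `|Bmu|.
    by have [_ h] := mB t.-1 b x; rewrite (le_trans h)// ler_norm.
  split; apply: trunc_id.
    by apply: (le_trans (residual_le a a' o u1 kkap mB')); rewrite lerDl.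
  apply: (le_trans (effect_le a a' o u1 mB')); rewrite /cc mulrDr addrAC.
  by rewrite lerDr addr_ge0// mulr_ge0// sqrtr_ge0.
by move=> n t i n0 nt i1; rewrite h1//; exact: h2.
Qed.

Let xi_checkE n i t w : regular w -> (0 < n)%N -> (n < t <= 2 * n)%N -> (n < i)%N ->
  xi_check D a a' mu1 mu2 u0 n i t w =
  r n i w (obs D i w) / clipn n (gp t w (obs D i w)) + e n i w (obs D i w).
Proof.
move=> [re qE] n0 nt ni; have [-> ->] := re n i (obs D i w).
have i1 : (1 <= i)%N := leq_ltn_trans (leq0n n) ni.
by rewrite /xi_check dot_score_diff qE.
Qed.

Let weightE n i t w : regular w -> (0 < n)%N -> (n < t <= 2 * n)%N ->
  (n < i <= 2 * n)%N -> weight D i t w =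
  clipn n (gp t w (obs D i w)) / clipn n (gp i w (obs D i w)).
Proof.
move=> [re qE] n0 nt ni; have i1 : (1 <= i)%N.
  by case/andP: ni => + _; exact: leq_ltn_trans.
by rewrite /weight !qE.
Qed.

Lemma M1_hatE n t w : regular w -> (0 < n)%N -> (n.+1 < t <= 2 * n)%N ->
  M1_hat D a a' mu1 mu2 u0 n t w = estn c1' n t w.
Proof.
move=> rw n0 nt; have nt' : (n < t <= 2 * n)%N by case/andP: nt => nt tn; rewrite ltnW.
rewrite /M1_hat /est gtn_eqF; last by case/andP: nt.
congr (_ * _); apply: eq_big_nat => i /andP[ni it].
have ni' : (n < i <= 2 * n)%N.
  by rewrite ni (leq_trans (ltnW it))//; case/andP: nt.
rewrite (xi_checkE rw n0 nt' ni) (weightE rw n0 nt' ni') /comp1.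
by field; rewrite !gt_eqF ?q_gt0.
Qed.

Lemma M2_hatE n t w : regular w -> (0 < n)%N -> (n.+1 < t <= 2 * n)%N ->
  M2_hat D a a' mu1 mu2 u0 n t w = estn c2' n t w.
Proof.
move=> rw n0 nt; have nt' : (n < t <= 2 * n)%N by case/andP: nt => nt tn; rewrite ltnW.
rewrite /M2_hat /est gtn_eqF; last by case/andP: nt.
congr (_ * _); apply: eq_big_nat => i /andP[ni it].
have ni' : (n < i <= 2 * n)%N.
  by rewrite ni (leq_trans (ltnW it))//; case/andP: nt.
rewrite (xi_checkE rw n0 nt' ni) (weightE rw n0 nt' ni') /comp2.
by field; rewrite !gt_eqF ?q_gt0.
Qed.

Let Phi n t w o := r n t w o / clipn n (gp t w o) + e n t w o.
Let PhiB n : R := cc * (policy_floor alpha f n)^-1 + cc.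

Let mPhi n t : (0 < n)%N -> (n < t)%N -> measurable_fun
  [set: g_sigma_algebraType (history D t.-1) * O] (fun z => Phi n t z.1 z.2).
Proof.
move=> n0 nt; apply: measurable_funD; last exact: me.
apply: measurable_funM; first exact: mr.
have mq := design_q (dsg n0) nt.
rewrite (_ : (fun z => _) = (fun z => clipn n (gp t z.1 z.2) `^ (-1))).
  by apply: (measurableT_comp (f := (@powR R)^~ (-1))).
by apply/funext => z; rewrite powRN powRr1// ltW// q_gt0.
Qed.

Let Phi_le n t w o : (0 < n)%N -> `|Phi n t w o| <= PhiB n.
Proof.
move=> n0; have q0 := q_gt0 (gp t w o) n0.
have fl0 := policy_floor_gt0 alpha f0 n0.
have qV : (clipn n (gp t w o))^-1 <= (policy_floor alpha f n)^-1.
  by rewrite lef_pV2 ?posrE//; exact: clip_ge.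
apply: (le_trans (ler_normD _ _)); apply: lerD; last exact: ec.
rewrite normrM normfV (gtr0_norm q0); apply: ler_pM => //.
  by rewrite invr_ge0 ltW.
Qed.

Let xiE n t : (0 < n)%N -> (n < t <= 2 * n)%N ->
  {ae P, forall w, xi D a a' mu1 mu2 u0 n t w = Phi n t w (obs D t w)}.
Proof.
move=> n0 nt; apply: filterS ae_regular => w rw.
have nt' : (n < t)%N by case/andP: nt.
exact: (xi_checkE rw n0 nt nt').
Qed.

Let M1E n t : (0 < n)%N -> (n < t <= 2 * n)%N ->
  {ae P, forall w, M1 n t w = tgt Lam c1' n t w}.
Proof.
move=> n0 nt; have nt' : (n < t)%N by case/andP: nt.
have [ce _] := ceM nt; have [ig _ _ _] := ce.
have FM := history_measurable samp (t := t.-1).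
have mF := measurable_historyE D t.-1.
have := design_cond_exp (dsg n0) nt mF FM ig (mPhi n0 nt')
  (fun w o => Phi_le t w o n0) (xiE n0 nt).
move=> /(cond_exp_unique mF FM ce); apply: filterS => w ->.
apply: eq_Rintegral => o _; rewrite /Phi /comp1; field.
by rewrite gt_eqF ?q_gt0.
Qed.

Let M2E n t : (0 < n)%N -> (n < t <= 2 * n)%N ->
  {ae P, forall w, M2 n t w = tgt Lam c2' n t w}.
Proof.
move=> n0 nt; have nt' : (n < t)%N by case/andP: nt.
have [_ ce] := ceM nt; have [ig _ _ _] := ce.
have FM := history_measurable samp (t := t.-1).
have mF := measurable_historyE D t.-1.
have PhiB2 w o : `|Phi n t w o ^+ 2| <= PhiB n ^+ 2.
  rewrite normrX lerXn2r ?nnegrE//; last exact: Phi_le.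
  exact: le_trans (normr_ge0 _) (Phi_le t w o n0).
have := design_cond_exp (Phi := fun w o => Phi n t w o ^+ 2) (dsg n0) nt mF FM ig
  (measurable_funX 2 (mPhi n0 nt')) PhiB2.
have xi2 : {ae P, forall w,
    xi D a a' mu1 mu2 u0 n t w ^+ 2 = Phi n t w (obs D t w) ^+ 2}.
  by apply: filterS (xiE n0 nt) => w ->.
move=> /(_ xi2) /(cond_exp_unique mF FM ce); apply: filterS => w ->.
apply: eq_Rintegral => o _; rewrite /Phi /comp2; field.
by rewrite gt_eqF ?q_gt0.
Qed.

(** The given versions of the conditional moments agree with the computed ones up to null sets, of
    which there are countably many, one for each pair [(n, t)]. *)
Lemma ae_conditional_moments : {ae P, forall w, forall n t, (0 < n)%N ->
  (n < t <= 2 * n)%N -> M1 n t w = tgt Lam c1' n t w /\ M2 n t w = tgt Lam c2' n t w}.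
Proof.
apply: ae_foralln => n; apply: ae_foralln => t.
have [n0|n0] := boolP (0 < n)%N; last by apply: aeW.
have [nt|nt] := boolP (n < t <= 2 * n)%N; last by apply: aeW.
by apply: filterS2 (M1E n0 nt) (M2E n0 nt) => w e1 e2 _ _.
Qed.

Lemma ae_mass : {ae P, forall w, forall n, (0 < n)%N -> forall t, (n < t <= 2 * n)%N ->
  \int[Lam]_o clipn n (gp t w o) <= 1}.
Proof.
apply: ae_foralln => n; have [n0|n0] := boolP (0 < n)%N; last by apply: aeW.
by apply: filterS (design_mass (dsg n0)) => w h _.
Qed.

Variable nu : R.
Hypothesis exps : 3 * alpha + 4 * gamma <= 1.
Hypotheses (nu_gamma : nu <= gamma / 2) (nu_beta : nu <= beta - alpha).

Lemma mean_errors : [/\ bigO_as P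
    (fun n w => (mean_abs_error (M1_hat D a a' mu1 mu2 u0) M1 n w)%:E)
    (fun n => n%:R `^ (- nu)),
  bigO_as P
    (fun n w => (mean_abs_error (M2_hat D a a' mu1 mu2 u0) M2 n w)%:E)
    (fun n => n%:R `^ (- nu)) &
  bigO_as P
    (fun n w => (mean_abs_error (sigma2_hat D a a' mu1 mu2 u0)
       (fun n t w => M2 n t w - M1 n t w ^+ 2) n w)%:E)
    (fun n => n%:R `^ (- nu))].
Proof.
have B1 := plugin1_as alpha0 f0 f1 dsg p0 gamma0 K0 Kgamma Kexp cc1 Cb0 Gm Gb gG
  mr me rc ec stab_r stab_e.
have B2 := plugin2_as alpha0 f0 f1 dsg p0 gamma0 K0 Kgamma Kexp cc1 Cb0 Gm Gb gG
  mr me rc ec stab_r stab_e.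
have B3 := est1_le_as alpha0 f0 f1 dsg gamma0 cc1 rc ec.
have T1 n t w n0 nt := @tgt1_le _ _ _ _ _ _ _ _ _ _ _ _ alpha0 f0 f1 dsg _ _ _ mr me rc ec n t w n0 nt.
have T2 n t w n0 nt := @tgt2_le _ _ _ _ _ _ _ _ _ _ _ _ alpha0 f0 f1 dsg _ cc1 _ _ mr me rc ec n t w n0 nt.
pose kt1 := 2 * cc * fine (Lam setT).
pose kt2 := 4 * cc ^+ 2 * fine (Lam setT) * f^-1.
have kt1_ge0 : 0 <= kt1 by rewrite !mulr_ge0// fine_ge0.
have kt2_ge0 : 0 <= kt2.
  by rewrite mulr_ge0 ?invr_ge0 ?(ltW f0)// mulr_ge0 ?fine_ge0// mulr_ge0 ?sqr_ge0.
have na n : (0 < n)%N -> 1 <= n%:R `^ alpha :> R.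
  by move=> n0; rewrite -[leLHS](powRr0 n%:R) ler_powR// ler1n.
have win n : (0 < n)%N -> (n < n.+1 <= 2 * n)%N.
  by move=> n0; rewrite ltnSn /= mul2n -addnn -addn1 leq_add2l.
have mean U V w k0 :
  window_bigO (fun n t => U n t w - V n t w) (sigma_error alpha beta gamma) ->
  (forall n, (0 < n)%N -> `|U n n.+1 w - V n n.+1 w| <= k0 * n%:R `^ alpha) ->
  exists k' n0, forall n, (n0 <= n)%N ->
    `|mean_abs_error U V n w : R| <= k' * n%:R `^ (- nu).
  move=> h1 h2; have [k' [n0 h]] := mean_error_le alpha0 gamma0 exps nu_gamma nu_beta h1 h2.
  exists k', n0 => n n0n; rewrite ger0_norm; first exact: h.
  by rewrite mulr_ge0 ?invr_ge0// sumr_ge0.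
have sub (u : nat -> nat -> R) : window_bigO u (plugin_error alpha beta gamma) ->
    window_bigO u (sigma_error alpha beta gamma).
  move=> [k' [n0 h]]; exists `|k'|, n0 => n n0n t nt; apply: (le_trans (h n n0n t nt)).
  apply: (@le_trans _ _ (`|k'| * plugin_error alpha beta gamma n t)).
    by rewrite ler_wpM2r ?plugin_error_ge0// ler_norm.
  by rewrite ler_wpM2l// plugin_le_sigma_error.
have shift (u v : nat -> nat -> R) b : (forall n, (0 < n)%N -> forall t,
    (n.+1 < t <= 2 * n)%N -> u n t = v n t) -> window_bigO v b -> window_bigO u b.
  move=> uv [k' [n0 h]]; exists k', (maxn n0 1) => n.
  by rewrite geq_max => /andP[n0n n1] t nt; rewrite uv//; exact: h.
have nt' n t : (n.+1 < t <= 2 * n)%N -> (n < t <= 2 * n)%N.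
  by case/andP => nt tn; rewrite ltnW.
have W1 : {ae P, forall w, window_bigO
    (fun n t => M1_hat D a a' mu1 mu2 u0 n t w - M1 n t w) (plugin_error alpha beta gamma)}.
  apply: filterS3 ae_regular ae_conditional_moments B1 => w rw cm b1.
  apply: shift b1 => n n0 t nt; have [-> _] := cm n t n0 (nt' _ _ nt).
  by rewrite (M1_hatE rw).
have W2 : {ae P, forall w, window_bigO
    (fun n t => M2_hat D a a' mu1 mu2 u0 n t w - M2 n t w) (plugin_error alpha beta gamma)}.
  apply: filterS3 ae_regular ae_conditional_moments B2 => w rw cm b1.
  apply: shift b1 => n n0 t nt; have [_ ->] := cm n t n0 (nt' _ _ nt).
  by rewrite (M2_hatE rw).
have W3 : {ae P, forall w, window_bigO
    (fun n t => Num.max (M2_hat D a a' mu1 mu2 u0 n t w - M1_hat D a a' mu1 mu2 u0 n t w ^+ 2) 0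
      - (M2 n t w - M1 n t w ^+ 2)) (sigma_error alpha beta gamma)}.
  have andAE (Q Q' : Omega -> Prop) : {ae P, forall w, Q w} -> {ae P, forall w, Q' w} ->
    {ae P, forall w, Q w /\ Q' w} by move=> h h'; apply: filterS2 h h'.
  have H1 := andAE _ _ W1 W2; have H2 := andAE _ _ B3 ae_regular.
  have H3 := andAE _ _ ae_conditional_moments ae_mass.
  apply: filterS3 H1 H2 H3 => w [w1 w2] [b3 rw] [cm mass].
  apply: (window_bigO_sigma kt1_ge0 w1 w2).
    by apply: shift b3 => n n0 t nt; rewrite (M1_hatE rw).
  exists 1%N => n n1 t nt; have [-> ->] := cm n t n1 (nt' _ _ nt).
  have nt1 : (n < t)%N by case/andP: (nt' _ _ nt).
  split; first exact: T1.
  apply: (sqr_tgt1_le alpha0 f0 f1 dsg mr me rc ec n1 nt1).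
  exact: mass (nt' _ _ nt).
(* In the first round of the second half the estimates are the defaults 0, 1 and 1, so the error is
   bounded by the size of the targets alone. *)
have E1 : {ae P, forall w, forall n, (0 < n)%N -> `|M1_hat D a a' mu1 mu2 u0 n n.+1 w
    - M1 n n.+1 w| <= kt1 * n%:R `^ alpha}.
  apply: filterS ae_conditional_moments => w cm n n0; have [-> _] := cm n n.+1 n0 (win n n0).
  rewrite /M1_hat eqxx sub0r normrN (le_trans (T1 n n.+1 w n0 (ltnSn n)))//.
  by rewrite ler_peMr// na.
have E2 : {ae P, forall w, forall n, (0 < n)%N -> `|M2_hat D a a' mu1 mu2 u0 n n.+1 w
    - M2 n n.+1 w| <= (1 + kt2) * n%:R `^ alpha}.
  apply: filterS ae_conditional_moments => w cm n n0; have [_ ->] := cm n n.+1 n0 (win n n0).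
  rewrite /M2_hat eqxx (le_trans (ler_normB _ _))// normr1 mulrDl mul1r lerD ?na//.
  by rewrite (le_trans (T2 n n.+1 w n0 (ltnSn n)))// mulrA.
have E3 : {ae P, forall w, forall n, (0 < n)%N -> `|sigma2_hat D a a' mu1 mu2 u0 n n.+1 w
    - (M2 n n.+1 w - M1 n n.+1 w ^+ 2)| <= (1 + kt2) * n%:R `^ alpha}.
  apply: filterS2 ae_conditional_moments ae_mass => w cm mass n n0.
  have [-> ->] := cm n n.+1 n0 (win n n0).
  have V := sqr_tgt1_le alpha0 f0 f1 dsg mr me rc ec n0 (ltnSn n) (mass n n0 _ (win n n0)).
  have t2 := T2 n n.+1 w n0 (ltnSn n); rewrite mulrA in t2.
  rewrite /sigma2_hat eqxx (le_trans (ler_normB _ _))// normr1 mulrDl mul1r lerD ?na//.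
  rewrite (le_trans _ t2)// ger0_norm ?subr_ge0// (le_trans _ (ler_norm _))//.
  by rewrite gerBl sqr_ge0.
split; apply: bigO_as_of.
- by apply: filterS2 W1 E1 => w w1 e1; apply: mean e1; exact: sub.
- by apply: filterS2 W2 E2 => w w1 e1; apply: mean e1; exact: sub.
- apply: filterS2 W3 E3 => w w1 e1; apply: mean e1.
  apply: shift w1 => n n0 t nt; rewrite /sigma2_hat gtn_eqF//.
  by case/andP: nt.
Qed.

End assembly.

Lemma ae_exists {R : realType} d (T : measurableType d) (P : probability T R)
    (Q : T -> Prop) : {ae P, forall w, Q w} -> exists w, Q w.
Proof.
move=> [B [mB PB QB]]; apply: contrapT => nQ.
have BT : B = setT by apply/seteqP; split=> // w _; apply: QB => Qw; apply: nQ; exists w.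
by have := @probability_setT _ _ _ P; rewrite -BT [LHS]PB => -[/eqP]; rewrite eq_sym oner_eq0.
Qed.

Theorem theorem5p4 (R : realType) (alpha beta p : R)
    (p_gt0 : 0 < p) (beta_gt0 : 0 < beta)
    (alpha_ge0 : 0 <= alpha) (alpha_lt1 : alpha < 1)
    (alpha_lt : alpha <
       Num.min (Num.min (1 / (3 + p)) (1 / (1 + 2 * p))) beta) :
  exists nu : R, 0 < nu /\
  forall (dO dX dA dY : measure_display)
    (Omega : measurableType dO) (X : measurableType dX)
    (A : measurableType dA) (Y : measurableType dY)
    (P : probability Omega R) (PX : probability X R)
    (PY : R.-pker (X * A)%type ~> Y) (Pi : set (A -> X -> R))
    (D : adaptive_data R Omega X A Y)
    (k : Y -> Y -> R) (H : rkhs k)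
    (a a' : A) (u0 : H)
    (mu1 mu2 : nat -> Omega -> A -> X -> H)
    (M1 M2 : nat -> nat -> Omega -> R),
  (* setting *)
  countable [set: A] -> (forall B : set A, measurable B) ->
  measurable_fun setT (fun z : Y * Y => k z.1 z.2) ->
  Pi `<=` [set g | cond_density g] ->
  adaptive_sampling P PX PY Pi D ->
  adapted_nuisance D mu1 -> adapted_nuisance D mu2 ->
  `|u0| = 1 ->
  (forall n t, (n.+1 <= t <= 2 * n)%N ->
     cond_exp P (history D t.-1) (xi D a a' mu1 mu2 u0 n t) (M1 n t) /\
     cond_exp P (history D t.-1)
       (fun w => xi D a a' mu1 mu2 u0 n t w ^+ 2) (M2 n t)) ->
  (* (1) *)
  (forall b, b = a \/ b = a' -> ignorability P D b) ->
  (* (2) *)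
  characteristic H -> (exists kappa, forall y, k y y <= kappa) ->
  (* (3) *)
  (exists B_mu, {ae P, forall w, forall j b x,
     `|mu1 j w b x| <= B_mu /\ `|mu2 j w b x| <= B_mu}) ->
  (* (4) *)
  (exists mu_inf : A -> X -> H,
     strongly_measurable (fun z : A * X => mu_inf z.1 z.2) /\
     bigO_as P
       (fun t w => L2_norm PX (fun b x => mu2 t.-1 w b x - mu_inf b x))
       (fun t => t%:R `^ (- beta))) ->
  (* (5) *)
  (exists (pi_ref : A -> X -> R) (G C : R),
     [/\ cond_density pi_ref, forall b x, 0 < pi_ref b x,
         forall g, density_ratios Pi pi_ref g ->
           {ae PX, forall x, forall b, `|g b x| <= G} &
         forall eps, 0 < eps ->
           (lne (bracketing_number (ref_norm PX pi_ref)
                   (density_ratios Pi pi_ref) eps)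
              <= (C * eps `^ (- p))%:E)%E]) ->
  (* (6) *)
  (exists2 c_pi, 0 < c_pi & exploration_floor P PX D c_pi alpha) ->
  [/\ bigO_as P
        (fun n w => (mean_abs_error (M1_hat D a a' mu1 mu2 u0) M1 n w)%:E)
        (fun n => n%:R `^ (- nu)),
      bigO_as P
        (fun n w => (mean_abs_error (M2_hat D a a' mu1 mu2 u0) M2 n w)%:E)
        (fun n => n%:R `^ (- nu)) &
      bigO_as P
        (fun n w => (mean_abs_error (sigma2_hat D a a' mu1 mu2 u0)
           (fun n t w => M2 n t w - M1 n t w ^+ 2) n w)%:E)
        (fun n => n%:R `^ (- nu))].

Proof.
have [a1 a2 a3] : [/\ alpha < 1 / (3 + p), alpha < 1 / (1 + 2 * p) & alpha < beta].
  by move: alpha_lt; rewrite !lt_min -andbA => /and3P[].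
have [gamma [K [/andP[g0 g4] K0 Kg Ke]]] := exists_chain_exponents p_gt0 alpha_ge0 a1 a2.
(* Level 0 of the exponent condition, where the level exponent is [2 alpha + gamma]. *)
have exps : 3 * alpha + 4 * gamma <= 1.
  have := Ke 0%N (leq0n K); rewrite /level_exponent/= !mul0r alpha_ge0 mulr0; lra.
(* The first term is the martingale rate, halved to absorb the logarithm; the second is the
   drift. *)
exists (Num.min (gamma / 2) (beta - alpha)); split.
  by rewrite lt_min subr_gt0 a3 andbT divr_gt0.
move=> dO dX dA dY Omega X A Y P PX PY Pi D k H a a' u0 mu1 mu2 M1 M2.
move=> cA mA mk PiP samp ad1 ad2 u01 ceM _ _ [kap kkap] [Bmu muB].
move=> [mu_inf [minf rate]] [pi_ref [_ [C [refP ref0 _ entropy]]]] [c c0 [N N0 floorP]].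
(* One context outside [N] and one trajectory satisfying the floor suffice to see that the action
   set is finite. *)
have [x Nx] : exists x, ~ N x.
  by apply: (@ae_exists _ _ _ PX); move: N0; rewrite -[N in negligible _ N]setCK.
have [w hw] := ae_exists floorP.
have fA : finite_set [set: A].
  apply: (@finite_of_density_floor _ _ _ _ _ (pol D 1 w) x (c * 1%:R `^ (- alpha))) => //.
  - by rewrite mulr_gt0// powR_gt0.
  - by apply: PiP; exact: (pol_in_class samp).
  - by move=> b; exact: hw.
have [s us sT] := exists_enum fA.
apply: (mean_errors (s := s) p_gt0 beta_gt0 alpha_ge0 g0 K0 Kg Ke mA us sT mk PiP samp
  ad1 ad2 u01 ceM kkap muB minf rate refP ref0 entropy c0 N0 floorP exps).
  by rewrite ge_min lexx.
by rewrite ge_min lexx orbT.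
Qed.
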